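(* Let $\nu>0$ and $\alpha\in\mathbb{R}$. The space $\mathcal{F}^{2,\nu}_{\alpha}(\mathbb{C})$ is a closed subspace of $\mathcal{L}^{2,\nu}_{\alpha}(\mathbb{C})$. Its orthogonal complement in $\mathcal{L}^{2,\nu}_{\alpha}(\mathbb{C})$ is spanned by the functions $\psi_{m,n}^{\alpha,\nu}$ with $m=1,2,\dots$ and $n\in\mathbb{Z}$, in the sense that $f\in(\mathcal{F}^{2,\nu}_{\alpha}(\mathbb{C}))^{\perp}$ if and only if $f$ is of the form $$f(z)=\sum_{m=1}^{\infty}\sum_{n\in\mathbb{Z}}a_{m,n}\,\psi_{m,n}^{\alpha,\nu}(z,\overline{z})\qquad\text{with}\qquad\sum_{m=1}^{\infty}\sum_{n\in\mathbb{Z}}|a_{m,n}|^2<+\infty ,$$ where $a_{m,n}\in\mathbb{C}$ and the series converges in $\mathcal{L}^{2,\nu}_{\alpha}(\mathbb{C})$.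
   Context: Write $z=x+iy$, $d\lambda(z)=dx\,dy$, $S=[0,1]\times\mathbb{R}=\{x+iy:0\le x\le1,\ y\in\mathbb{R}\}$. The space $\mathcal{L}^{2,\nu}_{\alpha}(\mathbb{C})$ consists of the (classes modulo almost everywhere equality of) measurable functions $f:\mathbb{C}\to\mathbb{C}$ satisfying $$f(z+m)=e^{2i\pi\alpha m}e^{\nu(z+\frac m2)m}f(z)\qquad\text{for almost every }z\in\mathbb{C}\text{ and all }m\in\mathbb{Z},$$ and $\|f\|_\nu^2=\int_S|f(z)|^2e^{-\nu|z|^2}d\lambda(z)<+\infty$, with inner product $\langle f_1,f_2\rangle_\nu=\int_S f_1\overline{f_2}e^{-\nu|z|^2}d\lambda$. The space $\mathcal{F}^{2,\nu}_{\alpha}(\mathbb{C})$ consists of the entire functions satisfying the functional equation for all $z\in\mathbb{C}$, $m\in\mathbb{Z}$, and with $\|f\|_\nu<+\infty$. For $m\in\{0,1,2,\dots\}$ and $n\in\mathbb{Z}$, $$\psi_{m,n}^{\alpha,\nu}(z,\overline{z})=(2^m m!)^{-1/2}\left(\frac{2\nu}{\pi}\right)^{1/4}e^{-\frac{\pi^2}{\nu}(\alpha+n)^2}e^{\frac{\nu}{2}z^2+2i\pi(\alpha+n)z}\,H_m\!\left(\sqrt{2\nu}\,y+\sqrt{\tfrac{2}{\nu}}\,\pi(n+\alpha)\right),$$ where $H_m(\xi)=(-1)^m e^{\xi^2}\frac{d^m}{d\xi^m}e^{-\xi^2}$ is the $m$-th Hermite polynomial. *)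

(* Defs.v *)
From mathcomp Require Import all_boot all_order all_algebra finmap complex.
From mathcomp Require Import all_classical all_reals all_analysis.
From mathcomp.analysis.showcase Require Import summability.
Set Implicit Arguments.
Unset Strict Implicit.
Unset Printing Implicit Defensive.
Import Order.TTheory GRing.Theory Num.Theory numFieldNormedType.Exports.
Import ComplexField.Normc.
Local Open Scope classical_set_scope.
Local Open Scope ring_scope.
Local Open Scope complex_scope.

Section Definitions.
Context {R : realType}.
Local Notation C := R[i].
Implicit Types (nu alpha : R) (f g : C -> C).

Definition cexp (z : C) : C :=
  (expR (complex.Re z) * cos (complex.Im z))
  +i* (expR (complex.Re z) * sin (complex.Im z)).

Definition of_coords (p : R * R) : C := p.1 +i* p.2.

(* Planar Lebesgue measure, on the Borel sets of R * R: every Lebesgue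
   measurable function is a.e. equal to a Borel one, so restricting to Borel
   functions does not change the space of classes modulo a.e. equality. *)
Local Notation lambda2 :=
  (@lebesgue_measure R \x @lebesgue_measure R)%E.

Definition strip : set (R * R) := `[0, 1]%classic `*` [set: R].

Definition cmeasurable f : Prop :=
  measurable_fun [set: measurableTypeR R * measurableTypeR R]
    (fun p => complex.Re (f (of_coords p)) : measurableTypeR R) /\
  measurable_fun [set: measurableTypeR R * measurableTypeR R]
    (fun p => complex.Im (f (of_coords p)) : measurableTypeR R).

Definition ae_eq_C f g : Prop :=
  {ae lambda2, forall p, f (of_coords p) = g (of_coords p)}.

Definition gauss nu (z : C) : R := expR (- nu * normc z ^+ 2).

Definition sqnorm nu f : \bar R :=
  (\int[lambda2]_(p in strip)
     (normc (f (of_coords p)) ^+ 2 * gauss nu (of_coords p))%:E)%E.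

Definition lnorm nu f : \bar R := sqrte (sqnorm nu f).

Definition strip_integral (h : C -> C) : C :=
  (\int[lambda2]_(p in strip) complex.Re (h (of_coords p)))
  +i* (\int[lambda2]_(p in strip) complex.Im (h (of_coords p))).

Definition inner nu f g : C :=
  strip_integral (fun z => f z * (g z)^*%C * (gauss nu z)%:C).

Definition multiplier nu alpha (m : int) (z : C) : C :=
  cexp (2 * 'i%C * pi%:C * alpha%:C * m%:~R)
  * cexp (nu%:C * (z + m%:~R / 2) * m%:~R).

Definition L2space nu alpha : set (C -> C) := [set f |
  [/\ cmeasurable f,
      {ae lambda2, forall p, forall m : int,
         f (of_coords p + m%:~R)
         = multiplier nu alpha m (of_coords p) * f (of_coords p)}
    & (sqnorm nu f < +oo)%E]].

(* Derivability in the direction 1 over the field C is complex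
   differentiability. *)
Definition entire f : Prop := forall z : C, derivable (f : C^o -> C^o) z 1.

Definition Fspace nu alpha : set (C -> C) := [set f |
  [/\ entire f,
      forall (z : C) (m : int),
        f (z + m%:~R) = multiplier nu alpha m z * f z
    & (sqnorm nu f < +oo)%E]].

(* Elements of L and F are functions rather than classes, so [F] being closed
   in [L] means that any element of [L] adherent to [F] for the norm agrees
   almost everywhere with an element of [F]. *)
Definition closed_subspace nu (L F : set (C -> C)) : Prop :=
  [/\ F `<=` L,
      F (fun=> 0),
      (forall (c : C) f g, F f -> F g -> F (fun z => c * f z + g z))
    & forall f, L f ->
        (forall eps : R, 0 < eps ->
           exists2 g, F g & (lnorm nu (fun z => (f z - g z)%R) < eps%:E)%E) ->
        exists2 g, F g & ae_eq_C f g].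

Definition orthocomplement nu (L F : set (C -> C)) : set (C -> C) :=
  [set f | L f /\ forall g, F g -> inner nu f g = 0].

Definition hermite (m : nat) (xi : R) : R :=
  (-1) ^+ m * expR (xi ^+ 2) * derive1n m (fun t : R => expR (- t ^+ 2)) xi.

Definition psi nu alpha (m : nat) (n : int) (z : C) : C :=
  ((2 ^+ m * m`!%:R) `^ (- 2^-1)
   * (2 * nu / pi) `^ (4^-1)
   * expR (- (pi ^+ 2 / nu) * (alpha + n%:~R) ^+ 2))%:C
  * cexp ((nu / 2)%:C * z ^+ 2 + 2 * 'i%C * pi%:C * (alpha + n%:~R)%:C * z)
  * (hermite m (Num.sqrt (2 * nu) * complex.Im z
                + Num.sqrt (2 / nu) * pi * (n%:~R + alpha)))%:C.

Definition psi_partial_sum nu alpha (a : nat -> int -> C)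
    (J : {fset (nat * int)}) (z : C) : C :=
  \sum_(p <- J | (0 < p.1)%N) a p.1 p.2 * psi nu alpha p.1 p.2 z.

(* The double series over {m >= 1} x Z has sum f in L2space: convergence in
   norm along the finite sets of indices, directed by inclusion. *)
Definition is_psi_series nu alpha (a : nat -> int -> C) f : Prop :=
  [/\ L2space nu alpha f,
      forall J, L2space nu alpha (psi_partial_sum nu alpha a J)
    & (fun J => lnorm nu (fun z => f z - psi_partial_sum nu alpha a J z))
        @ totally --> 0%E].

Definition square_summable (a : nat -> int -> C) : Prop :=
  (\esum_(p in [set p : nat * int | (0 < p.1)%N])
     (normc (a p.1 p.2) ^+ 2)%:E < +oo)%E.

End Definitions.

(* Main.v *)
Require Import Defs.
From mathcomp Require Import all_boot all_order all_algebra finmap complex.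
From mathcomp Require Import all_classical all_reals all_analysis measurable_realfun.
From mathcomp Require Import ring lra.
From mathcomp.analysis.showcase Require Import summability.

(** Multiplication by the square root of the Gaussian weight, [weighted nu], turns the norm
    and the inner product of the strip into those of the unweighted space of square-integrable
    functions on the strip ([sqnormE], [innerE]). It turns [psi nu alpha m n] into
    [phase * e^{2 i pi n x} * h_{n,m}(y)], where the phase has modulus 1 and does not depend on
    [m] and [n], and [h_{n,m}] is the normalised Hermite function of index [m] in the variable
    [xi = sqrt (2 nu) y + sqrt (2 / nu) pi (n + alpha)] ([weighted_psi]). The Fourier
    modes are complete on the unit interval and, for each [n], the functions [h_{n,m}] are
    complete on the line. Applying the Parseval identity first in [x] and then in [y] shows
    that the weighted [psi m n], over all [m >= 0] and [n], form an orthonormal family for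
    which Parseval holds ([weighted_basis_parseval]).

    Both completeness statements are instances of [density]. One looks at the functions [b]
    such that [b e^{i om x} w] is a limit of finite combinations for every frequency [om] of a
    given group.
    They are stable under multiplication by cosines and under bounded limits, so that
    polynomials approximating the sign function yield first the indicators of arcs, then
    those of rays, of all Borel sets, and finally all square-integrable functions.

    The space [F] is orthogonal to the functions [psi m n] with [m > 0] ([ip_Fspace_basis]).
    Indeed, for [g] in [F] the quotient [g / psi 0 n] is entire and of period 1, and by the
    theorem of Goursat on rectangles its integral over a period does not depend on the height.
    The [n]-th Fourier coefficient of [weighted g] is therefore a constant multiple of
    [h_{n,0}], which is orthogonal to [h_{n,m}].

    Closedness ([Fspace_closed]): a function [f] adherent to [F] is orthogonal to [psi m n] for
    [m > 0], so that only the functions [psi 0 n] occur in its expansion. Their coefficients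
    are bounded while the constant factors of [psi 0 n] decrease like [e^{- c n^2}]; hence the
    expansion converges pointwise to an entire quasi-periodic function, and by the lemma of
    Fatou this function agrees with [f] almost everywhere.

    The characterisation of the orthogonal complement follows: since each [psi 0 n] belongs
    to [F], a function orthogonal to [F] only has coefficients with [m > 0], and its expansion
    converges to it along the finite sets of indices; conversely the partial sums, and hence
    their limits, are orthogonal to [F]. *)

Set Implicit Arguments.
Unset Strict Implicit.
Unset Printing Implicit Defensive.
Import Order.TTheory GRing.Theory Num.Theory numFieldNormedType.Exports.
Import ComplexField.Normc.
Local Open Scope classical_set_scope.
Local Open Scope ring_scope.
Local Open Scope complex_scope.

(** * Complex-valued square-integrable functions *)

Section ComplexNumbers.
Context {R : realType}.
Local Notation C := R[i].
Implicit Types (z w : C).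

Lemma sqr_normcE z : normc z ^+ 2 = complex.Re z ^+ 2 + complex.Im z ^+ 2.
Proof. by case: z => a b /=; rewrite sqr_sqrtr// addr_ge0// sqr_ge0. Qed.

Lemma normc_ge0 z : 0 <= normc z.
Proof. by case: z => a b /=; exact: sqrtr_ge0. Qed.

Lemma ReD z w : complex.Re (z + w) = complex.Re z + complex.Re w.
Proof. by case: z; case: w. Qed.

Lemma ImD z w : complex.Im (z + w) = complex.Im z + complex.Im w.
Proof. by case: z; case: w. Qed.

Lemma ReN z : complex.Re (- z) = - complex.Re z.
Proof. by case: z. Qed.

Lemma ImN z : complex.Im (- z) = - complex.Im z.
Proof. by case: z. Qed.

Lemma ReM z w : complex.Re (z * w) =
  complex.Re z * complex.Re w - complex.Im z * complex.Im w.
Proof. by case: z; case: w. Qed.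

Lemma ImM z w : complex.Im (z * w) =
  complex.Re z * complex.Im w + complex.Im z * complex.Re w.
Proof. by case: z; case: w. Qed.

Lemma ReJ z : complex.Re z^*%C = complex.Re z.
Proof. by case: z. Qed.

Lemma ImJ z : complex.Im z^*%C = - complex.Im z.
Proof. by case: z. Qed.

Lemma normcJ z : normc z^*%C = normc z.
Proof. by case: z => a b /=; rewrite sqrrN. Qed.

Lemma normc_real (x : R) : normc x%:C = `|x|.
Proof. by rewrite /= expr0n addr0 sqrtr_sqr. Qed.

Lemma conjcM z w : (z * w)^*%C = z^*%C * w^*%C.
Proof. exact: rmorphM. Qed.

Lemma conjc_sum I (s : seq I) (F : I -> C) :
  (\sum_(i <- s) F i)^*%C = \sum_(i <- s) (F i)^*%C.
Proof. exact: rmorph_sum. Qed.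

Lemma realc_sum I (s : seq I) (F : I -> R) :
  (\sum_(i <- s) F i)%:C = \sum_(i <- s) (F i)%:C.
Proof. exact: rmorph_sum. Qed.

Lemma mulcJ z : z * z^*%C = (normc z ^+ 2)%:C.
Proof.
by rewrite sqr_normcE; case: z => a b; apply/eqP; rewrite eq_complex /=; apply/andP; split;
  apply/eqP; ring.
Qed.

Lemma normc_ge_Re z : `|complex.Re z| <= normc z.
Proof.
rewrite -(@ler_pXn2r _ 2) ?nnegrE ?normc_ge0// real_normK ?num_real//.
by rewrite sqr_normcE lerDl sqr_ge0.
Qed.

Lemma normc_ge_Im z : `|complex.Im z| <= normc z.
Proof.
rewrite -(@ler_pXn2r _ 2) ?nnegrE ?normc_ge0// real_normK ?num_real//.
by rewrite sqr_normcE lerDr sqr_ge0.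
Qed.

Lemma normc_le_ReIm z : normc z <= `|complex.Re z| + `|complex.Im z|.
Proof.
rewrite -(@ler_pXn2r _ 2) ?nnegrE ?normc_ge0 ?addr_ge0//.
rewrite sqr_normcE sqrrD !real_normK ?num_real// -addrA [X in _ <= _ + X]addrC addrA lerDl.
by rewrite mulrn_wge0// mulr_ge0.
Qed.

Lemma sum_sqr_normcB I (s : seq I) (c a : I -> C) :
  \sum_(i <- s) normc (c i - a i) ^+ 2 = \sum_(i <- s) normc (c i) ^+ 2
    - 2 * complex.Re (\sum_(i <- s) (c i)^*%C * a i) + \sum_(i <- s) normc (a i) ^+ 2.
Proof.
elim: s => [|i s ih]; first by rewrite !big_nil /=; ring.
rewrite !big_cons {}ih !sqr_normcE !(ReD, ImD, ReN, ImN, ReM, ReJ, ImJ); ring.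
Qed.

End ComplexNumbers.

#[local] Arguments normc : simpl never.

Section ComplexL2.
Context d (T : measurableType d) (R : realType) (mu : {measure set T -> \bar R}).
Context (D : set T) (mD : measurable D).
Local Notation C := R[i].
Implicit Types (f g h : T -> C).

Definition cmeas f : Prop :=
  measurable_fun D (fun x => complex.Re (f x)) /\
  measurable_fun D (fun x => complex.Im (f x)).

Definition cintegrable f : Prop :=
  mu.-integrable D (EFin \o (fun x => complex.Re (f x))) /\
  mu.-integrable D (EFin \o (fun x => complex.Im (f x))).

Definition cint f : C :=
  (\int[mu]_(x in D) complex.Re (f x)) +i* (\int[mu]_(x in D) complex.Im (f x)).

#[local] Arguments cint : simpl never.

Lemma cmeas_cst (c : C) : cmeas (fun=> c).
Proof. by split; exact: measurable_cst. Qed.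

Lemma cmeasD f g : cmeas f -> cmeas g -> cmeas (fun x => f x + g x).
Proof.
move=> [f1 f2] [g1 g2]; split.
- by under eq_fun do rewrite ReD; exact: measurable_funD.
- by under eq_fun do rewrite ImD; exact: measurable_funD.
Qed.

Lemma cmeasM f g : cmeas f -> cmeas g -> cmeas (fun x => f x * g x).
Proof.
move=> [f1 f2] [g1 g2]; split.
- by under eq_fun do rewrite ReM; apply: measurable_funB; exact: measurable_funM.
- by under eq_fun do rewrite ImM; apply: measurable_funD; exact: measurable_funM.
Qed.

Lemma cmeasZ (c : C) f : cmeas f -> cmeas (fun x => c * f x).
Proof. by move=> mf; apply: cmeasM => //; exact: cmeas_cst. Qed.

Lemma cmeasB f g : cmeas f -> cmeas g -> cmeas (fun x => f x - g x).
Proof.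
move=> mf mg; have -> : (fun x => f x - g x) = (fun x => f x + (-1) * g x).
  by apply/funext => x; rewrite mulN1r.
by apply: cmeasD => //; exact: cmeasZ.
Qed.

Lemma cmeasJ f : cmeas f -> cmeas (fun x => (f x)^*%C).
Proof.
move=> [f1 f2]; split; first by under eq_fun do rewrite ReJ.
under eq_fun do rewrite ImJ -mulN1r.
by apply: measurable_funM => //; exact: measurable_cst.
Qed.

Lemma cmeas_real (u : T -> R) : measurable_fun D u -> cmeas (fun x => (u x)%:C).
Proof. by move=> mu_; split => //; exact: measurable_cst. Qed.

Lemma cmeas_sum I (s : seq I) (F : I -> T -> C) :
  (forall i, cmeas (F i)) -> cmeas (fun x => \sum_(i <- s) F i x).
Proof.
move=> mF; elim: s => [|i s ih].
  by under eq_fun do rewrite big_nil; exact: cmeas_cst.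
by under eq_fun do rewrite big_cons; exact: cmeasD.
Qed.

Lemma measurable_sqr_normc f : cmeas f -> measurable_fun D (fun x => normc (f x) ^+ 2).
Proof.
move=> [f1 f2]; under eq_fun do rewrite sqr_normcE.
by apply: measurable_funD; exact: measurable_funX.
Qed.

Lemma cintegrable_le f (g : T -> R) : cmeas f ->
  mu.-integrable D (EFin \o g) -> (forall x, D x -> normc (f x) <= g x) ->
  cintegrable f.
Proof.
move=> [f1 f2] ig fg; split; apply: le_integrable ig => //=.
- exact/measurable_EFinP.
- move=> x Dx; rewrite lee_fin (le_trans (normc_ge_Re _))//.
  by rewrite (le_trans (fg _ Dx))// ler_norm.
- exact/measurable_EFinP.
- move=> x Dx; rewrite lee_fin (le_trans (normc_ge_Im _))//.
  by rewrite (le_trans (fg _ Dx))// ler_norm.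
Qed.

Lemma integrableZR (k : R) (u : T -> R) : mu.-integrable D (EFin \o u) ->
  mu.-integrable D (EFin \o (fun x => k * u x)).
Proof.
move=> iu; have -> : EFin \o (fun x => k * u x) = (fun x => k%:E * (EFin \o u) x)%E by [].
exact: integrableZl.
Qed.

Lemma integrableDR (u v : T -> R) : mu.-integrable D (EFin \o u) ->
  mu.-integrable D (EFin \o v) -> mu.-integrable D (EFin \o (fun x => u x + v x)).
Proof. by move=> iu iv; exact: (integrableD mD iu iv). Qed.

Lemma cintD f g : cintegrable f -> cintegrable g ->
  cint (fun x => f x + g x) = cint f + cint g.
Proof.
move=> [f1 f2] [g1 g2]; rewrite /cint; apply/eqP; rewrite eq_complex /=.
under eq_Rintegral do rewrite ReD.
under [X in _ && (X == _)]eq_Rintegral do rewrite ImD.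
by rewrite !RintegralD// !eqxx.
Qed.

Lemma cintZ (c : C) f : cintegrable f -> cint (fun x => c * f x) = c * cint f.
Proof.
move=> [f1 f2]; rewrite /cint; apply/eqP; rewrite eq_complex ReM ImM /=.
under eq_Rintegral do rewrite ReM.
under [X in _ && (X == _)]eq_Rintegral do rewrite ImM.
rewrite RintegralB//; [|exact: integrableZR..].
rewrite RintegralD//; [|exact: integrableZR..].
by rewrite !RintegralZl// !eqxx.
Qed.

Lemma cintJ f : cintegrable f -> cint (fun x => (f x)^*%C) = (cint f)^*%C.
Proof.
move=> [f1 f2]; rewrite /cint; apply/eqP; rewrite eq_complex ReJ ImJ /=.
under eq_Rintegral do rewrite ReJ.
under [X in _ && (X == _)]eq_Rintegral do rewrite ImJ -mulN1r.
by rewrite RintegralZl// mulN1r !eqxx.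
Qed.

Lemma eq_cint f g : {in D, f =1 g} -> cint f = cint g.
Proof.
by move=> fg; congr (_ +i* _); apply: eq_Rintegral => x Dx; rewrite fg.
Qed.

Lemma cint_real (u : T -> R) : cint (fun x => (u x)%:C) = (\int[mu]_(x in D) u x)%:C.
Proof. by rewrite /cint /=; congr (_ +i* _); rewrite Rintegral_cst// mul0r. Qed.

Lemma cint0 : cint (fun=> 0) = 0.
Proof. by rewrite /cint /= Rintegral_cst// mul0r. Qed.

(** Bounding the real and the imaginary part separately costs a factor 2. *)
Lemma normc_cint_le f (g : T -> R) : cmeas f ->
  mu.-integrable D (EFin \o g) -> (forall x, D x -> normc (f x) <= g x) ->
  normc (cint f) <= 2 * \int[mu]_(x in D) g x.
Proof.
move=> mf ig fg; have [f1 f2] := cintegrable_le mf ig fg.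
apply: (le_trans (normc_le_ReIm _)); rewrite mulr2n mulrDl mul1r; apply: lerD => /=.
- apply: (le_trans (le_normr_Rintegral _ _)) => //; apply: le_Rintegral => //.
    exact: integrable_norm.
  by move=> x Dx; rewrite (le_trans (normc_ge_Re _))// fg.
- apply: (le_trans (le_normr_Rintegral _ _)) => //; apply: le_Rintegral => //.
    exact: integrable_norm.
  by move=> x Dx; rewrite (le_trans (normc_ge_Im _))// fg.
Qed.

(** Squared norms in place of norms: the extended real [sqn] makes sense for every
    function, and the real number [nq] is its value on [L2]. *)
Definition sqn f : \bar R := (\int[mu]_(x in D) (normc (f x) ^+ 2)%:E)%E.

Definition L2 f : Prop := cmeas f /\ (sqn f < +oo)%E.

Definition nq f : R := fine (sqn f).

Definition ip f g : C := cint (fun x => f x * (g x)^*%C).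

#[local] Arguments ip : simpl never.

Lemma sqn_ge0 f : (0 <= sqn f)%E.
Proof. by apply: integral_ge0 => x _; rewrite lee_fin sqr_ge0. Qed.

Lemma nqK f : L2 f -> (nq f)%:E = sqn f.
Proof. by move=> [_ ?]; rewrite /nq fineK// ge0_fin_numE// sqn_ge0. Qed.

Lemma nq_ge0 f : 0 <= nq f. Proof. exact/fine_ge0/sqn_ge0. Qed.

Lemma integrable_sqr_normc f : L2 f ->
  mu.-integrable D (EFin \o (fun x => normc (f x) ^+ 2)).
Proof.
move=> [mf lf]; apply/integrableP; split.
  by apply/measurable_EFinP; exact: measurable_sqr_normc.
rewrite (eq_integral (fun x => (normc (f x) ^+ 2)%:E))// => x _ /=.
by rewrite ger0_norm// sqr_ge0.
Qed.

Lemma L2_le f (u : T -> R) : cmeas f -> mu.-integrable D (EFin \o u) ->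
  (forall x, D x -> normc (f x) ^+ 2 <= u x) -> L2 f.
Proof.
move=> mf iu fu; split=> //; rewrite (le_lt_trans _ (integrable_lty mD iu))//.
apply: ge0_le_integral => //.
- by move=> x _; rewrite lee_fin sqr_ge0.
- by apply/measurable_EFinP; exact: measurable_sqr_normc.
- by case/integrableP: iu.
Qed.

Lemma sqr_normcD_le (z w : C) : normc (z + w) ^+ 2 <= 2 * normc z ^+ 2 + 2 * normc w ^+ 2.
Proof.
case: z => a b; case: w => a' b'; rewrite !sqr_normcE /=.
by have := sqr_ge0 (a - a'); have := sqr_ge0 (b - b'); nra.
Qed.

Lemma L2D f g : L2 f -> L2 g -> L2 (fun x => f x + g x).
Proof.
move=> lf lg; apply: (@L2_le _ (fun x => 2 * normc (f x) ^+ 2 + 2 * normc (g x) ^+ 2)).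
- by apply: cmeasD; [case: lf|case: lg].
- by apply: integrableDR; apply: integrableZR; exact: integrable_sqr_normc.
- by move=> x _; exact: sqr_normcD_le.
Qed.

Lemma L2Z (c : C) f : L2 f -> L2 (fun x => c * f x).
Proof.
move=> lf; apply: (@L2_le _ (fun x => normc c ^+ 2 * normc (f x) ^+ 2)).
- by apply: cmeasZ; case: lf.
- by apply: integrableZR; exact: integrable_sqr_normc.
- by move=> x _; rewrite normcM exprMn.
Qed.

Lemma L2B f g : L2 f -> L2 g -> L2 (fun x => f x - g x).
Proof.
move=> lf lg; have -> : (fun x => f x - g x) = (fun x => f x + (-1) * g x).
  by apply/funext => x; rewrite mulN1r.
by apply: L2D => //; exact: L2Z.
Qed.

Lemma L2_0 : L2 (fun=> 0).
Proof.
split; first exact: cmeas_cst.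
rewrite /sqn (eq_integral (cst 0%E)) ?integral0// => x _.
by rewrite normc0 expr0n.
Qed.

Lemma L2_sum I (s : seq I) (F : I -> T -> C) :
  (forall i, L2 (F i)) -> L2 (fun x => \sum_(i <- s) F i x).
Proof.
move=> mF; elim: s => [|i s ih].
  by under eq_fun do rewrite big_nil; exact: L2_0.
by under eq_fun do rewrite big_cons; exact: L2D.
Qed.

Lemma normcMJ_le (z w : C) : normc (z * w^*%C) <= (normc z ^+ 2 + normc w ^+ 2) / 2.
Proof.
rewrite normcM normcJ.
by have := sqr_ge0 (normc z - normc w); nra.
Qed.

Lemma cintegrable_ip f g : L2 f -> L2 g -> cintegrable (fun x => f x * (g x)^*%C).
Proof.
move=> lf lg; apply: (@cintegrable_le _
    (fun x => 2^-1 * (normc (f x) ^+ 2 + normc (g x) ^+ 2))).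
- by apply: cmeasM; [case: lf|apply: cmeasJ; case: lg].
- by apply: integrableZR; apply: integrableDR; exact: integrable_sqr_normc.
- by move=> x _; rewrite [leRHS]mulrC normcMJ_le.
Qed.

Lemma ipDl f g h : L2 f -> L2 g -> L2 h ->
  ip (fun x => f x + g x) h = ip f h + ip g h.
Proof.
move=> lf lg lh; rewrite /ip -cintD; [|exact: cintegrable_ip..].
by apply: eq_cint => x _; rewrite mulrDl.
Qed.

Lemma ipZl (c : C) f g : L2 f -> L2 g -> ip (fun x => c * f x) g = c * ip f g.
Proof.
move=> lf lg; rewrite /ip -cintZ; last exact: cintegrable_ip.
by apply: eq_cint => x _; rewrite mulrA.
Qed.

Lemma ipC f g : L2 f -> L2 g -> ip g f = (ip f g)^*%C.
Proof.
move=> lf lg; rewrite /ip -cintJ; last exact: cintegrable_ip.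
by apply: eq_cint => x _; rewrite conjcM conjcK mulrC.
Qed.

Lemma ipBl f g h : L2 f -> L2 g -> L2 h ->
  ip (fun x => f x - g x) h = ip f h - ip g h.
Proof.
move=> lf lg lh; have -> : (fun x => f x - g x) = (fun x => f x + (-1) * g x).
  by apply/funext => x; rewrite mulN1r.
by rewrite ipDl//; [rewrite ipZl// mulN1r|exact: L2Z].
Qed.

Lemma ip_suml I (s : seq I) (F : I -> T -> C) g : (forall i, L2 (F i)) -> L2 g ->
  ip (fun x => \sum_(i <- s) F i x) g = \sum_(i <- s) ip (F i) g.
Proof.
move=> lF lg; elim: s => [|i s ih].
  rewrite big_nil /ip; under eq_fun do rewrite big_nil mul0r.
  exact: cint0.
rewrite big_cons -ih; under eq_fun do rewrite big_cons.
by rewrite ipDl//; exact: L2_sum.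
Qed.

Lemma ip_self f : L2 f -> ip f f = (nq f)%:C.
Proof. by move=> lf; rewrite /ip; under eq_fun do rewrite mulcJ; rewrite cint_real. Qed.

Lemma nqB f g : L2 f -> L2 g ->
  nq (fun x => f x - g x) = nq f - 2 * complex.Re (ip f g) + nq g.
Proof.
move=> lf lg; have lfg := L2B lf lg; apply: complexI.
have /(congr1 (@complex.Re R)) e : (nq (fun x => f x - g x))%:C
    = (nq f)%:C - ip f g - (ip f g)^*%C + (nq g)%:C.
  rewrite -ip_self// ipBl// (ipC lfg lf) (ipC lfg lg) !ipBl//.
  rewrite (ipC lf lg) (ip_self lf) (ip_self lg); case: (ip f g) => a b.
  by apply/eqP; rewrite eq_complex /=; apply/andP; split; apply/eqP; ring.
congr (_%:C); move: e; rewrite !(ReD, ReN) ReJ /= => ->; ring.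
Qed.

Lemma nqZ (c : C) f : L2 f -> nq (fun x => c * f x) = normc c ^+ 2 * nq f.
Proof.
move=> lf; have lcf := L2Z c lf; apply: complexI.
rewrite -ip_self// ipZl// (ipC lcf lf) ipZl// ip_self// conjcM conjc_real mulrA mulcJ.
exact: esym (rmorphM _ _ _).
Qed.

(** The pointwise bound [|a + b|^2 <= 2 |a|^2 + 2 |b|^2], integrated, serves as
    triangle inequality for squared norms. *)
Lemma nqD_le f g : L2 f -> L2 g ->
  nq (fun x => f x + g x) <= 2 * nq f + 2 * nq g.
Proof.
move=> lf lg; rewrite -lee_fin nqK; last exact: L2D.
rewrite EFinD !EFinM !nqK// /sqn -!ge0_integralZl ?lee_fin//; try by
  [apply/measurable_EFinP; apply: measurable_sqr_normc; case: lf; case: lg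
  |move=> x _; rewrite lee_fin sqr_ge0].
rewrite -ge0_integralD//; try by [apply/measurable_EFinP; apply: measurable_funM => //;
   apply: measurable_sqr_normc; case: lf; case: lg
  |move=> x _; rewrite -EFinM lee_fin mulr_ge0// sqr_ge0].
apply: ge0_le_integral => //.
- by move=> x _; rewrite lee_fin sqr_ge0.
- by apply/measurable_EFinP/measurable_sqr_normc; case: (L2D lf lg).
- apply/measurable_EFinP; apply: measurable_funD; apply: measurable_funM => //;
    by apply: measurable_sqr_normc; case: lf; case: lg.
- by move=> x _; rewrite -!EFinM -EFinD lee_fin sqr_normcD_le.
Qed.

Lemma nq_sub_trans f g h : L2 f -> L2 g -> L2 h ->
  nq (fun x => f x - h x) <= 2 * nq (fun x => f x - g x) + 2 * nq (fun x => g x - h x).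
Proof.
move=> lf lg lh; have := nqD_le (L2B lf lg) (L2B lg lh).
by under eq_fun do rewrite addrA subrK.
Qed.

(** A form of the Cauchy-Schwarz inequality: [2 |f g| <= |f|^2 / t + t |g|^2] is
    integrated, and the parameter [t] stays free to be chosen small. *)
Lemma normc_ip_le f g (t : R) : 0 < t -> L2 f -> L2 g ->
  normc (ip f g) <= t^-1 * nq f + t * nq g.
Proof.
move=> t0 lf lg.
have mfg : cmeas (fun x => f x * (g x)^*%C).
  by apply: cmeasM; [case: lf|apply: cmeasJ; case: lg].
have i2 : mu.-integrable D (EFin \o (fun x => t^-1 * normc (f x) ^+ 2)).
  by apply: integrableZR; exact: integrable_sqr_normc.
have i3 : mu.-integrable D (EFin \o (fun x => t * normc (g x) ^+ 2)).
  by apply: integrableZR; exact: integrable_sqr_normc.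
have := @normc_cint_le _ (fun x => 2^-1 * (t^-1 * normc (f x) ^+ 2 + t * normc (g x) ^+ 2))
   mfg.
rewrite RintegralZl//; last exact: integrableDR.
rewrite RintegralD// !RintegralZl//; [|exact: integrable_sqr_normc..].
rewrite mulrA mulfV// mul1r; apply; first by apply: integrableZR; exact: integrableDR.
move=> x _; rewrite normcM normcJ mulrC.
have := sqr_ge0 (normc (f x) - t * normc (g x)).
rewrite -(pmulr_rge0 _ (_ : 0 < t^-1)) ?invr_gt0//.
have -> : t^-1 * (normc (f x) - t * normc (g x)) ^+ 2 =
  t^-1 * normc (f x) ^+ 2 + t * normc (g x) ^+ 2 - 2 * (normc (g x) * normc (f x)).
  by field; rewrite gt_eqF.
by move=> h; lra.
Qed.

(** Orthogonality to [g] passes to limits: [ip f g = ip (f - h) g], which is small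
    by the previous inequality with a small [t]. *)
Lemma ip_limit_eq0 f g : L2 f -> L2 g ->
  (forall eps : R, 0 < eps -> exists h, [/\ L2 h, ip h g = 0 &
     nq (fun x => f x - h x) < eps]) ->
  ip f g = 0.
Proof.
move=> lf lg H; apply: eq0_normc; apply/eqP; rewrite eq_le normc_ge0 andbT.
apply/ler_addgt0Pr => e e0; rewrite add0r.
have G0 : 0 < 2 * (nq g + 1) by rewrite mulr_gt0// ltr_wpDl// nq_ge0.
pose t := e / (2 * (nq g + 1)).
have t0 : 0 < t by rewrite divr_gt0.
have [h [lh hg fh]] := H (e / 2 * t) (mulr_gt0 (divr_gt0 e0 (ltr0Sn _ _)) t0).
have -> : ip f g = ip (fun x => f x - h x) g by rewrite ipBl// hg subr0.
apply: (le_trans (normc_ip_le t0 (L2B lf lh) lg)).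
have -> : e = t^-1 * (e / 2 * t) + t * (nq g + 1).
  by rewrite /t; field; rewrite !gt_eqF//= ltr_wpDl// nq_ge0.
apply: lerD; first by rewrite ler_pM2l ?invr_gt0// ltW.
by rewrite ler_pM2l// lerDl.
Qed.

Section Orthonormal.
Context (I : choiceType) (e : I -> T -> C).
Hypothesis Le : forall i, L2 (e i).
Hypothesis orth : forall i j, ip (e i) (e j) = (i == j)%:R.

(** Expanding the square splits the distance of [f] to a combination into its
    distance to the projection and the distance between the coefficients. *)
Lemma pythagoras f (s : seq I) (c : I -> C) : L2 f -> uniq s ->
  nq (fun x => f x - \sum_(i <- s) c i * e i x) =
  nq f - \sum_(i <- s) normc (ip f (e i)) ^+ 2
       + \sum_(i <- s) normc (c i - ip f (e i)) ^+ 2.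
Proof.
move=> lf us.
have lce i : L2 (fun x => c i * e i x) by exact: L2Z.
have lS : L2 (fun x => \sum_(i <- s) c i * e i x) by exact: L2_sum.
rewrite nqB//.
have E1 : ip f (fun x => \sum_(i <- s) c i * e i x) = \sum_(i <- s) (c i)^*%C * ip f (e i).
  rewrite (ipC lS lf) ip_suml// conjc_sum; apply: eq_bigr => i _.
  by rewrite ipZl// conjcM (ipC lf (Le i)) conjcK.
have E2 : nq (fun x => \sum_(i <- s) c i * e i x) = \sum_(i <- s) normc (c i) ^+ 2.
  apply: complexI; rewrite -ip_self// ip_suml// realc_sum.
  apply: eq_big_seq => i si; rewrite ipZl// (ipC lS (Le i)) ip_suml// conjc_sum.
  rewrite (bigD1_seq i)// ipZl// orth eqxx mulr1 big1 => [|j ji]; last first.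
    by rewrite ipZl// orth (negbTE ji) mulr0 conjc0.
  by rewrite -mulcJ; congr (_ * _); exact: addr0.
rewrite E1 E2 sum_sqr_normcB; ring.
Qed.

Lemma nq_sub_proj f (s : seq I) : L2 f -> uniq s ->
  nq (fun x => f x - \sum_(i <- s) ip f (e i) * e i x) =
  nq f - \sum_(i <- s) normc (ip f (e i)) ^+ 2.
Proof.
move=> lf us; rewrite pythagoras// [X in _ + X]big1 ?addr0// => i _.
by rewrite subrr normc0 expr0n.
Qed.

Lemma bessel f (s : seq I) : L2 f -> uniq s ->
  \sum_(i <- s) normc (ip f (e i)) ^+ 2 <= nq f.
Proof.
by move=> lf us; rewrite -subr_ge0 -(nq_sub_proj lf us) nq_ge0.
Qed.

Lemma esum_bessel f : L2 f ->
  (\esum_(i in [set: I]) (normc (ip f (e i)) ^+ 2)%:E <= sqn f)%E.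
Proof.
move=> lf; apply: ge_ereal_sup => _ [X [finX _]] <-.
rewrite fsbig_finite//= -nqK// sumEFin lee_fin; exact: bessel.
Qed.

(** Density forces equality in the Bessel inequality: by [pythagoras], the defect of
    a finite sum of squared coefficients is at most the squared distance of [f] to
    any combination with the same indices. *)
Lemma parseval f : L2 f ->
  (forall eps : R, 0 < eps -> exists s c, uniq s /\
    nq (fun x => f x - \sum_(i <- s) c i * e i x) < eps) ->
  (\esum_(i in [set: I]) (normc (ip f (e i)) ^+ 2)%:E = sqn f)%E.
Proof.
move=> lf H; apply/eqP; rewrite eq_le esum_bessel//=.
apply/lee_addgt0Pr => eps eps0; have [s [c [us]]] := H _ eps0.
rewrite pythagoras// => sc.
have {}sc : nq f - \sum_(i <- s) normc (ip f (e i)) ^+ 2 <= eps.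
  by rewrite (le_trans _ (ltW sc))// lerDl sumr_ge0// => i _; rewrite sqr_ge0.
rewrite -nqK// -leeBlDr//; apply: esum_ge; exists [set` s].
  by split => //; exact: finite_seq.
by rewrite -EFinB -fsbig_seq// sumEFin lee_fin lerBlDr addrC -lerBlDr.
Qed.

(** By [nq_sub_proj], the distance of [f] to its projection on [J] is the part of the
    Parseval sum outside [J], which is small as soon as [J] contains a large enough
    finite set. *)
Lemma parseval_fset f : L2 f ->
  (\esum_(i in [set: I]) (normc (ip f (e i)) ^+ 2)%:E = sqn f)%E ->
  forall eps : R, 0 < eps -> exists J0 : {fset I}, forall J : {fset I}, (J0 `<=` J)%fset ->
    nq (fun x => f x - \sum_(i <- J) ip f (e i) * e i x) < eps.
Proof.
move=> lf H eps eps0.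
have : (sqn f - eps%:E < \esum_(i in [set: I]) (normc (ip f (e i)) ^+ 2)%:E)%E.
  by rewrite H -nqK// -EFinB lte_fin ltrBlDr ltrDl.
move=> /ereal_sup_gt[_ [X [finX _] <-]].
rewrite fsbig_finite//= sumEFin -nqK// -EFinB lte_fin => h.
exists (fset_set X) => J XJ; rewrite nq_sub_proj ?fset_uniq//.
rewrite ltrBlDr addrC -ltrBlDr; apply: (lt_le_trans h).
rewrite [leRHS](bigID (fun i => i \in fset_set X)) /= -[leLHS]addr0 lerD//; last first.
  by apply: sumr_ge0 => i _; rewrite sqr_ge0.
rewrite -[leRHS]big_filter.
rewrite (perm_big [seq i <- J | i \in fset_set X])//= uniq_perm ?filter_uniq ?fset_uniq// => i.
rewrite mem_filter; case: (boolP (i \in fset_set X)) => //= iX.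
by rewrite (fsubsetP XJ).
Qed.

End Orthonormal.

End ComplexL2.

(** * Closed spans *)

Section ClosedSpan.
Context d (T : measurableType d) (R : realType) (mu : {measure set T -> \bar R}).
Context (D : set T) (mD : measurable D).
Local Notation C := R[i].
Local Notation L2 := (L2 mu D).
Local Notation nq := (nq mu D).

Inductive lspan (E : set (T -> C)) : (T -> C) -> Prop :=
| lspan_zero : lspan E (fun=> 0)
| lspan_cons c f g : E f -> lspan E g -> lspan E (fun x => c * f x + g x).

Definition clspan (E : set (T -> C)) f : Prop :=
  L2 f /\ forall eps : R, 0 < eps -> exists2 p, lspan E p & nq (fun x => f x - p x) < eps.

Context (E : set (T -> C)) (EL2 : E `<=` L2).

Lemma lspan_L2 p : lspan E p -> L2 p.
Proof.
elim=> [|c f g Ef _ lg]; first exact: L2_0.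
by apply: L2D => //; apply: L2Z => //; exact: EL2.
Qed.

Lemma lspanD p q : lspan E p -> lspan E q -> lspan E (fun x => p x + q x).
Proof.
elim=> [lq|c f g Ef _ ih lq]; first by under eq_fun do rewrite add0r.
by under eq_fun do rewrite -addrA; apply: lspan_cons => //; exact: ih.
Qed.

Lemma lspanZ (c : C) p : lspan E p -> lspan E (fun x => c * p x).
Proof.
elim=> [|c' f g Ef _ ih]; first by under eq_fun do rewrite mulr0; exact: lspan_zero.
by under eq_fun do rewrite mulrDr mulrA; exact: lspan_cons.
Qed.

Lemma clspan_L2 f : clspan E f -> L2 f. Proof. by case. Qed.

Lemma nq_subrr f : nq (fun x => f x - f x) = 0.
Proof.
rewrite /nq /sqn; under eq_integral do rewrite subrr normc0 expr0n.
by rewrite integral0.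
Qed.

Lemma lspan_clspan f : lspan E f -> clspan E f.
Proof.
move=> lf; split; first exact: lspan_L2.
by move=> e e0; exists f; rewrite ?nq_subrr.
Qed.

Lemma sub_clspan f : E f -> clspan E f.
Proof.
move=> Ef; apply: lspan_clspan.
have -> : f = (fun x => 1 * f x + 0) by apply/funext => x; rewrite mul1r addr0.
by apply: lspan_cons => //; exact: lspan_zero.
Qed.

Lemma clspan_limit f : L2 f ->
  (forall eps : R, 0 < eps -> exists2 g, clspan E g & nq (fun x => f x - g x) < eps) ->
  clspan E f.
Proof.
move=> lf H; split=> // e e0.
have e4 : 0 < e / 4 by rewrite divr_gt0.
have [g [lg clg] fg] := H _ e4; have [p lp gp] := clg _ e4.
exists p => //; apply: (le_lt_trans (nq_sub_trans mD lf lg (lspan_L2 lp))).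
by lra.
Qed.

Lemma clspanD f g : clspan E f -> clspan E g -> clspan E (fun x => f x + g x).
Proof.
move=> [lf clf] [lg clg]; split; first exact: L2D.
move=> e e0; have e4 : 0 < e / 4 by rewrite divr_gt0.
have [p lp fp] := clf _ e4; have [q lq gq] := clg _ e4.
exists (fun x => p x + q x); first exact: lspanD.
have -> : (fun x => f x + g x - (p x + q x)) = (fun x => (f x - p x) + (g x - q x)).
  by apply/funext => x; rewrite opprD addrACA.
apply: (le_lt_trans (nqD_le mD (L2B mD lf (lspan_L2 lp)) (L2B mD lg (lspan_L2 lq)))).
by lra.
Qed.

Lemma clspanZ (c : C) f : clspan E f -> clspan E (fun x => c * f x).
Proof.
move=> [lf clf]; split; first exact: L2Z.
move=> e e0; have c0 : 0 < normc c ^+ 2 + 1 by rewrite ltr_wpDl// sqr_ge0.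
have [p lp fp] := clf _ (divr_gt0 e0 c0).
exists (fun x => c * p x); first exact: lspanZ.
under eq_fun do rewrite -mulrBr.
rewrite nqZ//; last by apply: L2B => //; exact: lspan_L2.
apply: (@le_lt_trans _ _ ((normc c ^+ 2 + 1) * nq (fun x => f x - p x))).
  by rewrite ler_wpM2r ?nq_ge0// lerDl.
by rewrite mulrC -ltr_pdivlMr.
Qed.

Lemma clspan0 : clspan E (fun=> 0). Proof. by apply: lspan_clspan; exact: lspan_zero. Qed.

Lemma clspan_sum I (s : seq I) (F : I -> T -> C) :
  (forall i, clspan E (F i)) -> clspan E (fun x => \sum_(i <- s) F i x).
Proof.
move=> mF; elim: s => [|i s ih].
  by under eq_fun do rewrite big_nil; exact: clspan0.
by under eq_fun do rewrite big_cons; exact: clspanD.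
Qed.

(** Pointwise limits under a common square-integrable bound converge in norm, by
    dominated convergence. *)
Lemma clspan_dominated (f_ : nat -> T -> C) (f : T -> C) (G : T -> R) :
  cmeas D f -> (forall k, clspan E (f_ k)) -> mu.-integrable D (EFin \o G) ->
  (forall k x, D x -> normc (f_ k x) ^+ 2 <= G x) ->
  (forall x, D x -> normc (f x) ^+ 2 <= G x) ->
  {ae mu, forall x, D x -> normc (f_ k x - f x) @[k --> \oo] --> (0 : R)} ->
  clspan E f.
Proof.
move=> mf clf iG fG0 fG cvf.
have lf : L2 f by exact: L2_le fG.
apply: clspan_limit => // e e0.
have mh k : measurable_fun D (EFin \o (fun x => normc (f x - f_ k x) ^+ 2)).
  by apply/measurable_EFinP/measurable_sqr_normc/cmeasB => //; case: (clspan_L2 (clf k)).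
have iG4 : mu.-integrable D (fun x => (4%:E * (EFin \o G) x)%E) by exact: integrableZl.
have [||_ _] := @dominated_convergence _ _ _ mu D mD
  (fun k x => (normc (f x - f_ k x) ^+ 2)%:E) (cst 0%E) _ mh (@measurable_cst _ _ _ _ _ _) _ iG4.
- apply: filterS cvf => x H Dx; apply: (@cvg_trans _ ((normc (f_ k x - f x) ^+ 2)%:E @[k --> \oo])).
    by apply: near_eq_cvg; apply: nearW => k; rewrite -normcN opprB.
  apply: cvg_EFin; first exact: nearW.
  have {}H := H Dx; have h := cvgM H H; rewrite mulr0 in h.
  rewrite (_ : fine \o _ = (fun k => normc (f_ k x - f x)) \* (fun k => normc (f_ k x - f x))); first exact: h.
  by apply/funext => k /=; rewrite expr2.
- apply: aeW => x k Dx; rewrite -EFinM lee_fin /= ger0_norm ?sqr_ge0//.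
  apply: (le_trans (sqr_normcD_le _ _)); rewrite normcN.
  by have := fG _ Dx; have := fG0 k _ Dx; lra.
rewrite /= integral0 => /fine_cvg /= cv.
have [k _ /(_ k (leqnn k))] : \forall k \near \oo, nq (fun x => f x - f_ k x) < e.
  exact: (cvgr_lt (0 : R) cv).
by exists (f_ k).
Qed.

End ClosedSpan.

Section ParsevalSpan.
Context d (T : measurableType d) (R : realType) (mu : {measure set T -> \bar R}).
Context (D : set T) (mD : measurable D).
Local Notation C := R[i].
Context (I : choiceType) (e : I -> T -> C).
Hypothesis Le : forall i, L2 mu D (e i).
Hypothesis orth : forall i j, ip mu D (e i) (e j) = (i == j)%:R.

(** The coefficients of an element met several times are added up, so that the
    indices become distinct, as [pythagoras] requires. *)
Lemma lspan_range p : lspan (range e) p ->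
  exists s c, uniq s /\ p = (fun x => \sum_(i <- s) c i * e i x).
Proof.
elim=> [|c f g [i _ <-] _ [s [b [us ->]]]].
  by exists [::], (fun=> 0); split => //; apply/funext => x; rewrite big_nil.
have [si|si] := boolP (i \in s).
  exists s, (fun j => if j == i then c + b i else b j); split => //.
  apply/funext => x; rewrite (bigD1_seq i)//= [in RHS](bigD1_seq i)//= eqxx addrA -mulrDl.
  by congr (_ + _); apply: eq_bigr => j /negbTE ->.
exists (i :: s), (fun j => if j == i then c else b j); split; first by rewrite /= si.
apply/funext => x; rewrite big_cons eqxx; congr (_ + _).
by apply: eq_big_seq => j sj; case: eqP => // ji; rewrite -ji sj in si.
Qed.

Lemma parseval_clspan f : clspan mu D (range e) f ->
  (\esum_(i in [set: I]) (normc (ip mu D f (e i)) ^+ 2)%:E = sqn mu D f)%E.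
Proof.
move=> [lf clf]; apply: parseval => // eps eps0; have [p lp fp] := clf _ eps0.
by have [s [c [us pE]]] := lspan_range lp; subst p; exists s, c.
Qed.

End ParsevalSpan.

(** * Density of weighted exponentials on the line *)

Section Smoothstep.
Context {R : realType}.
Implicit Types (t u : R).

(** The map [u |-> (3 u - u^3) / 2] is odd, sends the interval from -1 to 1 into
    itself and attracts every positive point to 1: its iterates are polynomials that
    stay bounded by 1 and converge to the sign function. *)
Definition smooth (k : nat) : {poly R} :=
  iter k (fun p => (3 / 2) *: p - (1 / 2) *: p ^+ 3) 'X.

Lemma smooth0 t : (smooth 0).[t] = t.
Proof. exact: hornerX. Qed.

Lemma smoothS k t :
  (smooth k.+1).[t] = 3 / 2 * (smooth k).[t] - 1 / 2 * (smooth k).[t] ^+ 3.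
Proof. by rewrite /= !(hornerD, hornerN, hornerZ, horner_exp). Qed.

Lemma smoothN k t : (smooth k).[- t] = - (smooth k).[t].
Proof. by elim: k => [|k ih]; rewrite ?smooth0// !smoothS ih; ring. Qed.

(** If [u >= t] is the previous iterate, the new distance to 1 is
    [(1 - u) (1 - u (1 + u) / 2)], and the last factor is at most [1 - t / 2]. *)
Lemma smooth_pos k t : 0 < t <= 1 ->
  [/\ t <= (smooth k).[t], (smooth k).[t] <= 1 &
      1 - (smooth k).[t] <= (1 - t / 2) ^+ k].
Proof.
move=> /andP[t0 t1]; elim: k => [|k [h1 h2 h3]].
  by rewrite smooth0 expr0; split => //; lra.
rewrite smoothS; move: h1 h2 h3; set u := (smooth k).[t] => h1 h2 h3.
have u0 : 0 <= u by lra.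
split.
- have : 0 <= u * (1 - u) * (1 + u) by rewrite !mulr_ge0//; lra.
  by nra.
- have : 0 <= (1 - u) ^+ 2 * (2 + u) by rewrite mulr_ge0// ?sqr_ge0//; lra.
  by nra.
- rewrite [leRHS]exprS; apply: (@le_trans _ _ ((1 - t / 2) * (1 - u))); last first.
    by rewrite ler_wpM2l//; lra.
  have : 0 <= (1 - u) * (u * (1 + u) / 2 - t / 2).
    by rewrite mulr_ge0//; [lra|nra].
  by nra.
Qed.

Lemma smooth_cvg t : `|t| <= 1 -> (smooth k).[t] @[k --> \oo] --> Num.sg t.
Proof.
have pos u : 0 < u <= 1 -> (smooth k).[u] @[k --> \oo] --> (1 : R).
  move=> u01; have /andP[u0 u1] := u01.
  have cv : (1 - (1 - u / 2) ^+ k : R) @[k --> \oo] --> (1 : R).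
    rewrite -[X in _ --> X](subr0 (1 : R)); apply: cvgB; first exact: cvg_cst.
    by apply: cvg_expr; rewrite ger0_norm; lra.
  apply: (squeeze_cvgr _ cv (cvg_cst (1 : R))).
  by apply: nearW => k; have [_ ? ?] := smooth_pos k u01; apply/andP; split => //; lra.
move=> /ler_normlP[h1 h2]; case: (ltgtP t 0) => t0.
- have t01 : 0 < - t <= 1 by rewrite oppr_gt0 t0.
  rewrite ltr0_sg// (_ : (fun k => _) = - (fun k => (smooth k).[- t])).
    by apply: cvgN; exact: pos.
  by apply/funext => k; rewrite fctE smoothN opprK.
- by rewrite gtr0_sg//; apply: pos; rewrite t0.
- rewrite t0 sgr0; have -> : (fun k => (smooth k).[0]) = cst (0 : R).
    by apply/funext => k /=; elim: k => [|k ih]; rewrite ?smooth0// smoothS ih; ring.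
  exact: cvg_cst.
Qed.

Lemma smooth_le1 k t : `|t| <= 1 -> `|(smooth k).[t]| <= 1.
Proof.
move=> t1; elim: k => [|k]; first by rewrite smooth0.
rewrite smoothS; set u := (smooth k).[t]; rewrite !ler_norml => /andP[h1 h2].
have : 0 <= (1 - u) ^+ 2 * (2 + u) by rewrite mulr_ge0// ?sqr_ge0//; lra.
have : 0 <= (1 + u) ^+ 2 * (2 - u) by rewrite mulr_ge0// ?sqr_ge0//; lra.
by move=> h3 h4; apply/andP; split; nra.
Qed.

End Smoothstep.

Section Cis.
Context {R : realType}.
Local Notation C := R[i].
Implicit Types (s t : R).

Definition cis t : C := cos t +i* sin t.

Lemma cis0 : cis 0 = 1. Proof. by rewrite /cis cos0 sin0. Qed.

Lemma cisD s t : cis (s + t) = cis s * cis t.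
Proof.
by rewrite /cis cosD sinD; apply/eqP; rewrite eq_complex /=; apply/andP; split; apply/eqP; ring.
Qed.

Lemma cisN t : cis (- t) = (cis t)^*%C.
Proof. by rewrite /cis cosN sinN. Qed.

Lemma normc_cis t : normc (cis t) = 1.
Proof.
apply/eqP; rewrite -(@eqrXn2 _ 2) ?normc_ge0//; apply/eqP.
by rewrite expr1n sqr_normcE /= cos2Dsin2.
Qed.

Lemma cosE_cis t : (cos t)%:C = 2^-1 * (cis t + cis (- t)).
Proof.
rewrite /cis cosN sinN; apply/eqP; rewrite -(inj_eq (mulfI (_ : 2 != 0 :> C))) ?pnatr_eq0//.
by rewrite mulrA mulfV ?pnatr_eq0// mul1r eq_complex /=; apply/andP; split; apply/eqP; ring.
Qed.

End Cis.

Section TrigDensity.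
Context {R : realType}.
Local Notation C := R[i].
Local Notation T := (measurableTypeR R).
Local Notation mu := (@lebesgue_measure R).
Context (D : set T) (mD : measurable D) (w : T -> R).
Hypothesis mw : measurable_fun D w.
Hypothesis iw : mu.-integrable D (EFin \o (fun x => w x ^+ 2)).
Context (E : set (T -> C)) (EL2 : E `<=` L2 mu D).
Context (Om : set R).
Hypothesis Om0 : Om 0.
Hypothesis OmD : forall a b, Om a -> Om b -> Om (a + b).
Hypothesis OmN : forall a, Om a -> Om (- a).

Lemma cmeas_cis_lin (D' : set T) (a b : R) : cmeas D' (fun x : T => cis (a * x + b)).
Proof.
have m : measurable_fun D' (fun x : T => a * x + b).
  by apply: measurable_funTS; exact: measurable_funD.
split; rewrite /cis /=; apply: measurableT_comp => //.
- by apply: continuous_measurable_fun; exact: continuous_cos.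
- by apply: continuous_measurable_fun; exact: continuous_sin.
Qed.

(** Quantifying over all the frequencies of the group [Om] makes this class of
    functions stable under multiplication by cosines with frequency in [Om], hence
    by polynomials in such cosines. *)
Definition multipliers (b : T -> R) : Prop := forall om, Om om ->
  clspan mu D E (fun x => (b x)%:C * cis (om * x) * (w x)%:C).

Local Notation A := multipliers.

Lemma eq_multipliers b b' : (forall x, b x = b' x) -> A b -> A b'.
Proof. by move=> /funext ->. Qed.

Lemma multipliersD b b' : A b -> A b' -> A (fun x => b x + b' x).
Proof.
move=> hb hb' om Hom; have -> : (fun x => (b x + b' x)%:C * cis (om * x) * (w x)%:C) =
  (fun x => (b x)%:C * cis (om * x) * (w x)%:C + (b' x)%:C * cis (om * x) * (w x)%:C).
  by apply/funext => x; rewrite rmorphD /= !mulrDl.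
by apply: clspanD => //; [exact: hb|exact: hb'].
Qed.

Lemma multipliersZ c b : A b -> A (fun x => c * b x).
Proof.
move=> hb om Hom; have -> : (fun x => (c * b x)%:C * cis (om * x) * (w x)%:C) =
  (fun x => c%:C * ((b x)%:C * cis (om * x) * (w x)%:C)).
  by apply/funext => x; rewrite rmorphM /= !mulrA.
by apply: clspanZ => //; exact: hb.
Qed.

(** By the Euler formula, multiplication by the cosine shifts the frequency by [om]
    in both directions. *)
Lemma multipliers_cos b om a : Om om -> A b -> A (fun x => b x * cos (om * (x - a))).
Proof.
move=> Hom hb om' Hom'.
have -> : (fun x => (b x * cos (om * (x - a)))%:C * cis (om' * x) * (w x)%:C) =
  (fun x => (2^-1 * cis (- (om * a))) * ((b x)%:C * cis ((om' + om) * x) * (w x)%:C) +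
            (2^-1 * cis (om * a)) * ((b x)%:C * cis ((om' - om) * x) * (w x)%:C)).
  apply/funext => x; rewrite rmorphM /= cosE_cis.
  have -> : cis (om * (x - a)) = cis (om * x) * cis (- (om * a)).
    by rewrite -cisD; congr cis; ring.
  have -> : cis (- (om * (x - a))) = cis (- (om * x)) * cis (om * a).
    by rewrite -cisD; congr cis; ring.
  have -> : cis ((om' + om) * x) = cis (om' * x) * cis (om * x).
    by rewrite -cisD; congr cis; ring.
  have -> : cis ((om' - om) * x) = cis (om' * x) * cis (- (om * x)).
    by rewrite -cisD; congr cis; ring.
  by ring.
exact: (clspanD mD EL2 (clspanZ mD EL2 _ (hb _ (OmD Hom' Hom))) (clspanZ mD EL2 _ (hb _ (OmD Hom' (OmN Hom))))).
Qed.

Lemma multipliers_poly (p : {poly R}) om a c : Om om -> A (fun=> 1) ->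
  A (fun x => p.[(cos (om * (x - a)) - c) / 2]).
Proof.
move=> Hom A1; elim/poly_ind: p => [|p k ih].
  have := multipliersZ 0 A1; apply: eq_multipliers => x.
  by rewrite horner0 mul0r.
have h1 := multipliersZ (1 / 2) (multipliers_cos a Hom ih).
have h2 := multipliersD h1 (multipliersD (multipliersZ (- (c / 2)) ih) (multipliersZ k A1)).
by apply: eq_multipliers h2 => x; rewrite hornerMXaddC; field.
Qed.

(** Dominated convergence, with the square-integrable bound [M w]. *)
Lemma multipliers_limit (b_ : nat -> T -> R) (b : T -> R) (M : R) :
  measurable_fun D b -> (forall k, A (b_ k)) ->
  (forall k x, D x -> `|b_ k x| <= M) -> (forall x, D x -> `|b x| <= M) ->
  {ae mu, forall x, D x -> b_ k x @[k --> \oo] --> b x} -> A b.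
Proof.
move=> mb hb bM bM' cv om Hom.
have bd (y x : R) : `|y| <= M -> normc (y%:C * cis (om * x) * (w x)%:C) ^+ 2 <= M ^+ 2 * w x ^+ 2.
  move=> yM; rewrite !normcM normc_cis mulr1 !normc_real exprMn real_normK ?num_real//.
  by rewrite real_normK ?num_real// ler_wpM2r ?sqr_ge0// -ler_sqrt ?sqr_ge0// !sqrtr_sqr (le_trans yM)// ler_norm.
apply: (@clspan_dominated _ _ _ _ _ mD _ EL2 (fun k x => (b_ k x)%:C * cis (om * x) * (w x)%:C) _
  (fun x => M ^+ 2 * w x ^+ 2)).
- apply: cmeasM; last exact: cmeas_real.
  apply: cmeasM; first exact: cmeas_real.
  by have := cmeas_cis_lin D om 0; under eq_fun do rewrite addr0.
- by move=> k; exact: hb.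
- exact: integrableZR.
- by move=> k x Dx; apply: bd; exact: bM.
- by move=> x Dx; apply: bd; exact: bM'.
- apply: filterS cv => x h Dx; have {}h := h Dx.
  have -> : (fun k => normc ((b_ k x)%:C * cis (om * x) * (w x)%:C -
       (b x)%:C * cis (om * x) * (w x)%:C)) = (fun k => `|b_ k x - b x| * `|w x|).
    apply/funext => k; rewrite -!mulrBl -rmorphB /= !normcM normc_cis mulr1.
    by rewrite !normc_real.
  rewrite -(mul0r `|w x|); apply: cvgMl; rewrite -(normr0 R); apply: cvg_norm.
  by rewrite -(subrr (b x)); apply: cvgB => //; exact: cvg_cst.
Qed.

(** Composing [smooth k] with [(cos (om (x - a)) - c') / 2] gives polynomials in a
    cosine that converge boundedly to a sign, that is, to the indicator of an arc
    with value 1/2 at its end points; letting [c'] decrease to [c] gives the value 0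
    there. *)
Lemma multipliers_arc om a c : Om om -> A (fun=> 1) -> -1 <= c < 1 ->
  A (fun x => (c < cos (om * (x - a)))%R%:R).
Proof.
move=> Hom A1 /andP[c1 c2].
have mcos : measurable_fun D (fun x : T => cos (om * (x - a))).
  apply: measurable_funTS.
  apply: continuous_measurable_fun => x; apply: continuous_comp; last exact: continuous_cos.
  by apply: cvgM; [exact: cvg_cst|apply: cvgB; [exact: cvg_id|exact: cvg_cst]].
have mlt c' : measurable_fun D (fun x : T => (c' < cos (om * (x - a)))%R%:R : R).
  apply: measurableT_comp => //; apply: measurable_fun_ltr => //.
have step c' : -1 <= c' <= 1 ->
    A (fun x => 1 / 2 * (1 + Num.sg ((cos (om * (x - a)) - c') / 2))).
  move=> /andP[h1 h2].
  have bnd x : `|(cos (om * (x - a)) - c') / 2| <= 1.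
    have := cos_max (om * (x - a)).
    by rewrite !ler_norml => /andP[? ?]; apply/andP; split; lra.
  have sgle (y : R) : `|Num.sg y| <= 1 by rewrite normr_sg; case: eqP.
  have half (y : R) : `|y| <= 1 -> `|1 / 2 * (1 + y)| <= 1.
    by rewrite !ler_norml => /andP[? ?]; apply/andP; split; lra.
  apply: (@multipliers_limit (fun k x => 1 / 2 * (1 + (smooth k).[(cos (om * (x - a)) - c') / 2]))
     _ 1).
  - apply: measurable_funM => //; apply: measurable_funD => //.
    have -> : (fun x : T => Num.sg ((cos (om * (x - a)) - c') / 2)) =
      (fun x : T => (c' < cos (om * (x - a)))%R%:R - (cos (om * (x - a)) < c')%R%:R).
      apply/funext => x; rewrite sgrM (gtr0_sg (_ : 0 < 2^-1)) ?invr_gt0// mulr1.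
      case: (ltgtP c' (cos (om * (x - a)))) => h.
      - by rewrite gtr0_sg ?subr_gt0// subr0.
      - by rewrite ltr0_sg ?subr_lt0// sub0r.
      - by rewrite h subrr sgr0 subrr.
    apply: measurable_funB => //; apply: measurableT_comp => //.
    exact: measurable_fun_ltr.
  - move=> k; apply: multipliersZ; apply: multipliersD => //; exact: multipliers_poly.
  - by move=> k x _; apply: half; exact: smooth_le1.
  - by move=> x _; apply: half.
  - apply: aeW => x _; apply: cvgMr; apply: cvgD; first exact: cvg_cst.
    exact: smooth_cvg.
pose c_ k := c + (1 - c) / k.+2%:R.
have c_bd k : c < c_ k < 1.
  rewrite /c_ ltrDl divr_gt0 ?subr_gt0//= -ltrBrDl ltr_pdivrMr// ltr_pMr ?subr_gt0//.
  by rewrite ltr1n.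
apply: (@multipliers_limit (fun k x => 1 / 2 * (1 + Num.sg ((cos (om * (x - a)) - c_ k) / 2))) _ 1) => //.
- move=> k; apply: step; have /andP[? ?] := c_bd k; apply/andP; split; lra.
- move=> k x _; have : `|Num.sg ((cos (om * (x - a)) - c_ k) / 2)| <= 1 by rewrite normr_sg; case: eqP.
  by rewrite !ler_norml => /andP[? ?]; apply/andP; split; lra.
- by move=> x _; case: (_ < _); rewrite ?normr1 ?normr0.
apply: aeW => x _; case: ltP => h.
- have cvc : c_ k @[k --> \oo] --> c.
    rewrite -[X in _ --> X]addr0; apply: cvgD; first exact: cvg_cst.
    rewrite -(mulr0 (1 - c)); apply: cvgMr.
    have := @cvg_harmonic R; rewrite -(cvg_shiftS (@harmonic R)).
    by apply: cvg_trans; apply: near_eq_cvg; apply: nearW => k.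
  apply: cvg_near_cst; near=> k.
  have hk : c_ k < cos (om * (x - a)) by near: k; exact: (cvgr_lt c cvc _ h).
  by rewrite gtr0_sg ?mulr1n; lra.
- apply: cvg_near_cst; apply: nearW => k; have /andP[? ?] := c_bd k.
  by rewrite ltr0_sg ?mulr0n; lra.
Unshelve. all: by end_near. Qed.

Hypothesis A1 : A (fun=> 1).
Hypothesis Aray : forall r : R, A (fun x => (r < x)%R%:R).

(** The rays form a pi-system that generates the Borel sets, and the sets whose
    indicator is a multiplier form a lambda-system. *)
Lemma multipliers_borel (B : set T) : measurable B -> A (\1_B).
Proof.
pose H := [set B : set T | measurable B /\ A (\1_B)].
suff : (measurable : set (set T)) `<=` H by move=> sub mB; case: (sub _ mB).
have -> : (measurable : set (set T)) = <<s (@RGenOInfty.G R) >>.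
  exact: RGenOInfty.measurableE.
apply: lambda_system_subset.
- move=> _ _ [x ->] [y ->]; exists (Num.max x y); apply/seteqP; split => z /=.
  + by rewrite !in_itv/= !andbT => -[xz yz]; rewrite gt_max xz yz.
  + by rewrite !in_itv/= !andbT gt_max => /andP[].
- split.
  + by [].
  + split; first exact: measurableT.
    by apply: eq_multipliers A1 => x; rewrite indicT.
  + move=> B1 B2 B21 [mB1 AB1] [mB2 AB2]; split; first exact: measurableD.
    have := multipliersD AB1 (multipliersZ (-1) AB2); apply: eq_multipliers => x.
    rewrite !indicE in_setD.
    have [xB2|xB2] := boolP (x \in B2); last by rewrite mulr0 addr0 andbT.
    by rewrite (mem_set (B21 _ (set_mem xB2))) /=; ring.
  + move=> F ndF HF; have mU : measurable (\bigcup_i F i).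
      by apply: bigcupT_measurable => i; case: (HF i).
    split => //; apply: (@multipliers_limit (fun k => \1_(F k)) _ 1).
    * exact: measurable_indic.
    * by move=> k; case: (HF k).
    * by move=> k x _; rewrite indicE; case: (_ \in _); rewrite ?normr1 ?normr0.
    * by move=> x _; rewrite indicE; case: (_ \in _); rewrite ?normr1 ?normr0.
    * apply: aeW => x _; apply: cvg_near_cst.
      have [xU|xU] := pselect ((\bigcup_i F i) x).
        have [i _ Fix] := xU; exists i => // k /= ik.
        rewrite !indicE (mem_set xU) mem_set//.
        by have /subsetPset := ndF _ _ ik; apply.
      apply: nearW => k; rewrite !indicE (memNset xU) memNset// => Fk.
      by apply: xU; exists k.
- move=> _ [x ->]; split; first exact: measurable_itv.
  by apply: eq_multipliers (Aray x) => y; rewrite indicE mem_setE in_itv /= andbT.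
- by [].
Qed.

Import HBNNSimple.
Hypothesis w0 : forall x, D x -> 0 < w x.

(** The quotient [u / w] is an increasing limit of simple functions, which are
    multipliers by [multipliers_borel]. *)
Lemma density_ge0 (u : T -> R) : measurable_fun D u -> (forall x, D x -> 0 <= u x) ->
  mu.-integrable D (EFin \o (fun x => u x ^+ 2)) -> clspan mu D E (fun x => (u x)%:C).
Proof.
move=> mu_ u0 iu.
pose g : T -> \bar R := EFin \o (fun x => u x / w x).
have mg : measurable_fun D g.
  apply/measurable_EFinP; apply: measurable_funM => //.
  have : measurable_fun D (fun x => (w x) `^ (-1)).
    exact: (measurableT_comp (measurable_powR (-1)) mw).
  apply: eq_measurable_fun => x /set_mem Dx.
  by rewrite powRN powRr1// ltW// w0.
have g0 x : D x -> (0 <= g x)%E.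
  by move=> Dx; rewrite lee_fin divr_ge0 ?u0// ltW// w0.
pose s := nnsfun_approx mD mg.
have sle k x : D x -> s k x <= u x / w x.
  move=> Dx; have cv : (s k x) @[k --> \oo] --> u x / w x.
    by have /fine_cvg := cvg_nnsfun_approx mD mg g0 Dx.
  rewrite -(cvg_lim _ cv)//; apply: (@nondecreasing_cvgn_le _ (fun k => s k x)).
    by move=> m n mn; have /lefP := nd_nnsfun_approx mD mg mn; apply.
  by apply/cvg_ex; eexists; exact: cv.
have cls k : clspan mu D E (fun x => (s k x)%:C * (w x)%:C).
  have -> : (fun x => (s k x)%:C * (w x)%:C) = (fun x => \sum_(y <- fset_set (range (s k)))
     y%:C * ((\1_(s k @^-1` [set y]) x)%:C * cis (0 * x) * (w x)%:C)).
    apply/funext => x; rewrite fimfunE fsbig_finite//= realc_sum mulr_suml.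
    by apply: eq_bigr => y _; rewrite mul0r cis0 mulr1 rmorphM /= mulrA.
  apply: clspan_sum => // y; apply: clspanZ => //.
  by apply: multipliers_borel.
apply: (@clspan_dominated _ _ _ _ _ mD _ EL2 (fun k x => (s k x)%:C * (w x)%:C) _
  (fun x => u x ^+ 2)) => //.
- move=> k x Dx; rewrite normcM !normc_real -normrM real_normK ?num_real//.
  rewrite -ler_sqrt ?sqr_ge0// !sqrtr_sqr !ger0_norm ?u0//; last first.
    by rewrite mulr_ge0// ?ltW ?w0//; exact: fun_ge0.
  by rewrite -ler_pdivlMr ?w0// sle.
- by move=> x Dx; rewrite normc_real real_normK ?num_real.
- apply: aeW => x Dx.
  have := cvg_nnsfun_approx mD mg g0 Dx => /fine_cvg /= cv.
  have -> : (fun k => normc ((s k x)%:C * (w x)%:C - (u x)%:C)) =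
    (fun k => `|s k x * w x - u x|).
    by apply/funext => k; rewrite -rmorphM -rmorphB /= normc_real.
  rewrite -(normr0 R); apply: cvg_norm; rewrite -(subrr (u x)); apply: cvgB; last exact: cvg_cst.
  rewrite -[X in _ --> X](@divfK _ (w x)) ?gt_eqF ?w0//.
  by apply: cvgMl.
Qed.

Lemma density f : L2 mu D f -> clspan mu D E f.
Proof.
move=> lf; have [[f1 f2] _] := lf.
have real (u : T -> R) : measurable_fun D u -> (forall x, D x -> u x ^+ 2 <= normc (f x) ^+ 2) ->
    clspan mu D E (fun x => (u x)%:C).
  move=> mu_ uf.
  have half (v : T -> R) : measurable_fun D v -> (forall x, D x -> 0 <= v x) ->
      (forall x, D x -> v x ^+ 2 <= u x ^+ 2) -> clspan mu D E (fun x => (v x)%:C).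
    move=> mv v0 vu; apply: density_ge0 => //.
    apply: (le_integrable mD _ _ (integrable_sqr_normc lf)).
      by apply/measurable_EFinP; exact: measurable_funX.
    move=> x Dx; rewrite lee_fin !ger0_norm ?sqr_ge0//.
    by apply: (le_trans (vu _ Dx)); exact: uf.
  have -> : (fun x => (u x)%:C) =
      (fun x => (Num.max (u x) 0)%:C + (-1) * (Num.max (- u x) 0)%:C).
    apply/funext => x; rewrite mulN1r -rmorphB /=; congr (_%:C).
    by case: (leP 0 (u x)) => h; [rewrite max_r; lra|rewrite max_l; lra].
  apply: clspanD => //; [|apply: clspanZ => //]; apply: half.
  - exact: measurable_maxr.
  - by move=> x _; rewrite le_max lexx orbT.
  - by move=> x _; case: (leP (u x) 0) => _; nra.
  - by apply: measurable_maxr => //; exact: measurableT_comp.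
  - by move=> x _; rewrite le_max lexx orbT.
  - by move=> x _; case: (leP (- u x) 0) => _; nra.
have -> : f = (fun x => (complex.Re (f x))%:C + 'i%C * (complex.Im (f x))%:C).
  by apply/funext => x; rewrite -complexE.
by apply: clspanD => //; [|apply: clspanZ => //]; apply: real => // x _;
  rewrite sqr_normcE ?lerDl ?lerDr sqr_ge0.
Qed.

End TrigDensity.

(** * Fourier series on the unit interval *)

Section RealCalculus.
Context {R : realType}.
Local Notation mu := (@lebesgue_measure R).

Lemma continuous_integrable_itv (f : R -> R) (a b : R) : continuous f ->
  mu.-integrable `[a, b] (EFin \o f).
Proof.
move=> cf; apply: continuous_compact_integrable; first exact: segment_compact.
exact: continuous_subspaceT.
Qed.

Lemma Rintegral_FTC (f F : R -> R) (a b : R) : a < b -> continuous f ->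
  (forall x : R, is_derive x (1 : R) F (f x)) -> \int[mu]_(x in `[a, b]) f x = F b - F a.
Proof.
move=> ab cf dF; rewrite /Rintegral (@continuous_FTC2 _ f F)//.
- exact: continuous_subspaceT.
- have cF x : {for x, continuous F}.
    by apply: differentiable_continuous; apply/derivable1_diffP; case: (dF x).
  split.
  + by move=> x _; case: (dF x).
  + by apply: cvg_at_right_filter; exact: cF.
  + by apply: cvg_at_left_filter; exact: cF.
- by move=> x _; rewrite derive1E; case: (dF x).
Qed.

Lemma is_derive_sin_lin (k x : R) : is_derive x (1 : R) (fun y : R => sin (k * y)) (k * cos (k * x)).
Proof.
have h : is_derive x (1 : R) (fun y : R => k * y) k.
  have := is_deriveZ k (is_derive_id x (1 : R)).
  by rewrite /GRing.scale /= mulr1.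
by have := is_derive1_comp (is_derive_sin (k * x)) h; rewrite mulrC.
Qed.

Lemma is_derive_cos_lin (k x : R) : is_derive x (1 : R) (fun y : R => cos (k * y)) (- (k * sin (k * x))).
Proof.
have h : is_derive x (1 : R) (fun y : R => k * y) k.
  have := is_deriveZ k (is_derive_id x (1 : R)).
  by rewrite /GRing.scale /= mulr1.
by have := is_derive1_comp (is_derive_cos (k * x)) h; rewrite mulrC mulrN.
Qed.

Lemma cos_2pi_int (n : int) : cos (2 * pi * n%:~R) = 1 :> R.
Proof.
have nat (k : nat) : cos (2 * pi * k%:R) = 1 :> R.
  elim: k => [|k ih]; first by rewrite mulr0 cos0.
  have -> : 2 * pi * k.+1%:R = 2 * pi * k%:R + pi *+ 2 :> R by rewrite -natr1; ring.
  by rewrite cosD2pi.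
by case: n => k; rewrite ?NegzE ?mulrNz ?mulrN ?cosN -pmulrn nat.
Qed.

Lemma sin_2pi_int (n : int) : sin (2 * pi * n%:~R) = 0 :> R.
Proof. by apply: cos1sin0; rewrite cos_2pi_int normr1. Qed.

Lemma cis_2pi_int (n : int) : cis (2 * pi * n%:~R) = 1 :> R[i].
Proof. by rewrite /cis cos_2pi_int sin_2pi_int. Qed.

(** Cosine decreases from 0 to [pi] and is symmetric about [pi]; as long as [th] stays
    away from the neighbouring arcs, centred at the other multiples of [2 pi], the
    inequality cuts out the arc of half-width [rho] around 0. *)
Lemma ltr_cos_arc (rho th : R) : 0 <= rho <= pi -> `|th| < 2 * pi - rho ->
  (cos rho < cos th) = (`|th| < rho).
Proof.
move=> /andP[r0 rpi]; rewrite -(cos_norm th); have := normr_ge0 th.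
set t := `|th|; move=> t0 ht.
have [tpi|tpi] := leP t pi.
  by rewrite ltr_cos// in_itv /= ?r0 ?t0.
have -> : cos t = cos (2 * pi - t).
  by rewrite -[in RHS]cosN -[in RHS]cosD2pi; congr cos; ring.
rewrite ltr_cos ?in_itv /= ?r0//; last by apply/andP; split; lra.
by apply/idP/idP => h; exfalso; lra.
Qed.

End RealCalculus.

Section Fourier.
Context {R : realType}.
Local Notation C := R[i].
Local Notation T := (measurableTypeR R).
Local Notation mu := (@lebesgue_measure R).
Local Notation I01 := (`[0, 1]%classic : set T).

Lemma measurable_I01 : measurable I01. Proof. exact: measurable_itv. Qed.

Definition fmode (n : int) (x : T) : C := cis (2 * pi * n%:~R * x).

Lemma cmeas_fmode D n : cmeas D (fmode n).
Proof. by have := cmeas_cis_lin D (2 * pi * n%:~R : R) 0; under eq_fun do rewrite addr0. Qed.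

Lemma integrable_cst01 (c : R) : mu.-integrable I01 (EFin \o (fun=> c)).
Proof. by apply: continuous_integrable_itv; exact: cst_continuous. Qed.

Lemma L2_fmode n : L2 mu I01 (fmode n).
Proof.
apply: (L2_le measurable_I01 (u := fun=> 1)).
- exact: cmeas_fmode.
- exact: integrable_cst01.
- by move=> x _; rewrite normc_cis expr1n.
Qed.

Lemma Rintegral_cst01 (c : R) : \int[mu]_(x in I01) c = c.
Proof.
rewrite Rintegral_cst//= lebesgue_measure_itv/= lte_fin ltr01.
by rewrite oppr0 adde0 mulr1.
Qed.

Lemma cint_fmode n : cint mu I01 (fmode n) = (n == 0)%:R.
Proof.
rewrite /cint /fmode /=; have [->|n0] := eqVneq n 0.
  under eq_Rintegral do rewrite mulr0 mul0r cos0.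
  under [X in _ +i* X]eq_Rintegral do rewrite mulr0 mul0r sin0.
  by rewrite !Rintegral_cst01.
set k := 2 * pi * n%:~R; have k0 : k != 0 by rewrite !mulf_neq0 ?intr_eq0// gt_eqF// pi_gt0.
have d1 (x : R) : is_derive x (1 : R) (fun y : R => k^-1 * sin (k * y)) (cos (k * x)).
  have := is_deriveZ k^-1 (is_derive_sin_lin k x).
  by rewrite /GRing.scale /= mulrA mulVf// mul1r.
have d2 (x : R) : is_derive x (1 : R) (fun y : R => - k^-1 * cos (k * y)) (sin (k * x)).
  have := is_deriveZ (- k^-1) (is_derive_cos_lin k x).
  by rewrite /GRing.scale /= mulrNN mulrA mulVf// mul1r.
have c1 : continuous (fun y : R => cos (k * y)).
  move=> x; apply: continuous_comp; last exact: continuous_cos.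
  by apply: cvgM; [exact: cvg_cst|exact: cvg_id].
have c2 : continuous (fun y : R => sin (k * y)).
  move=> x; apply: continuous_comp; last exact: continuous_sin.
  by apply: cvgM; [exact: cvg_cst|exact: cvg_id].
rewrite (Rintegral_FTC ltr01 c1 d1) (Rintegral_FTC ltr01 c2 d2).
rewrite !mulr1 !mulr0 sin0 cos0 sin_2pi_int cos_2pi_int.
by apply/eqP; rewrite eq_complex /= !mulr0 !subrr !eqxx.
Qed.

Lemma fmodeMJ n m x : fmode n x * (fmode m x)^*%C = fmode (n - m) x.
Proof. by rewrite /fmode -cisN -cisD rmorphB /=; congr cis; ring. Qed.

Lemma fmode_orthonormal n m : ip mu I01 (fmode n) (fmode m) = (n == m)%:R.
Proof.
rewrite /ip (@eq_cint _ _ _ _ _ _ (fmode (n - m))); last by move=> x _; exact: fmodeMJ.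
by rewrite cint_fmode subr_eq0.
Qed.

(** For [r] between 0 and 1, the part of the ray above [r] inside the unit interval is
    an arc of the circle: its centre is [(r + 1) / 2] and its angular half-width is
    [pi (1 - r)]. Arc and ray may differ at the end points 0 and 1, a null set. *)
Lemma fourier_density f : L2 mu I01 f -> clspan mu I01 (range fmode) f.
Proof.
have m01 := measurable_I01.
have EL2 : range fmode `<=` L2 mu I01 by move=> _ [n _ <-]; exact: L2_fmode.
pose Om : set R := [set om | exists n : int, om = 2 * pi * n%:~R].
have A1 : multipliers I01 (fun=> 1) (range fmode) Om (fun=> 1).
  move=> _ [n ->]; apply: sub_clspan => //; exists n => //.
  by apply/funext => x; rewrite mulr1 mul1r.
have mw : measurable_fun I01 (fun=> 1 : R) by exact: measurable_cst.
have iw : mu.-integrable I01 (EFin \o (fun x : T => (1 : R) ^+ 2)) by exact: integrable_cst01.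
have Om0 : Om 0 by exists 0; rewrite mulr0.
have OmD a b : Om a -> Om b -> Om (a + b).
  by move=> [n ->] [m ->]; exists (n + m); rewrite intrD; ring.
have OmN a : Om a -> Om (- a).
  by move=> [n ->]; exists (- n); rewrite mulrNz mulrN.
have nullE : {ae mu, forall x : T, x != 0 /\ x != 1}.
  exists [set 0; 1]; split; first by apply: measurableU; exact: measurable_set1.
    by apply: countable_lebesgue_measure0; apply: finite_set_countable; rewrite finite_setU; split; exact: finite_set1.
  move=> x /= /not_andP[] /negP; rewrite negbK => /eqP ->; [by left|by right].
have aeA (b b' : T -> R) : measurable_fun I01 b' -> (forall x, `|b x| <= 1) -> (forall x, `|b' x| <= 1) ->
    (forall x, 0 < x < 1 -> b x = b' x) -> multipliers I01 (fun=> 1) (range fmode) Om b ->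
    multipliers I01 (fun=> 1) (range fmode) Om b'.
  move=> mb' b1 b1' bb' Ab; apply: (multipliers_limit m01 mw iw EL2 (b_ := fun=> b) (M := 1)) => //.
  apply: filterS nullE => x [x0 x1]; rewrite /= in_itv /= => /andP[x0' x1'].
  by rewrite bb' ?lt_neqAle ?x0' ?x1' ?x1 1?eq_sym ?x0//; exact: cvg_cst.
apply: (density m01 mw iw EL2 Om0 A1) => // r.
have mr : measurable_fun I01 (fun x : T => (r < x)%R%:R : R).
  by apply: measurableT_comp => //; apply: measurable_fun_ltr.
have b1 (b : bool) : `|b%:R : R| <= 1 by case: b; rewrite ?normr1 ?normr0.
have [r0|r0] := ltP r 0.
  apply: (aeA (fun=> 1)) => // x; first by rewrite normr1.
  by move=> /andP[x0 _]; rewrite (lt_trans r0 x0).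
have [r1|r1] := leP 1 r.
  apply: (aeA (fun=> 0)) => //; first by move=> x; rewrite normr0.
    by move=> x /andP[_ x1]; rewrite ltNge (ltW (lt_le_trans x1 r1)).
  by have := multipliersZ m01 EL2 0 A1; apply: eq_multipliers => x; rewrite mul0r.
have pi0 := pi_gt0 R.
apply: (aeA (fun x => (cos (pi * (1 - r)) < cos (2 * pi * (x - (r + 1) / 2)))%R%:R)) => //.
  move=> x /andP[x0 x1]; congr ((nat_of_bool _)%:R); rewrite ltr_cos_arc.
  - apply/idP/idP => [/ltr_normlP[h _]|h].
      by rewrite -(ltr_pM2l pi0); lra.
    have h1 : pi * r < pi * x by rewrite ltr_pM2l.
    have h2 : pi * x < pi * 1 by rewrite ltr_pM2l.
    by apply/ltr_normlP; split; lra.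
  - by apply/andP; split; nra.
  - have h1 : 0 < pi * x by rewrite mulr_gt0.
    have h2 : pi * x < pi * 1 by rewrite ltr_pM2l.
    have h3 : pi * r < pi * 1 by rewrite ltr_pM2l.
    have h4 : 0 <= pi * r by rewrite mulr_ge0// ltW.
    by apply/ltr_normlP; split; lra.
apply: (multipliers_arc m01 mw iw EL2 OmD OmN) => //.
- by exists 1; rewrite mulr1.
- have pr : 0 < pi * (1 - r) by rewrite mulr_gt0// subr_gt0.
  have h4 : 0 <= pi * r by rewrite mulr_ge0// ltW.
  have m1 : 0 \in `[0, pi : R] by rewrite in_itv /= lexx ltW.
  have m2 : pi * (1 - r) \in `[0, pi : R] by rewrite in_itv /=; apply/andP; split; lra.
  by rewrite cos_geN1/= -[ltRHS](cos0 R) ltr_cos.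
Qed.

Lemma fourier_parseval f : L2 mu I01 f ->
  (\esum_(n in [set: int]) (normc (ip mu I01 f (fmode n)) ^+ 2)%:E = sqn mu I01 f)%E.
Proof.
move=> lf; apply: parseval_clspan.
- exact: measurable_itv.
- exact: L2_fmode.
- exact: fmode_orthonormal.
- exact: fourier_density.
Qed.

End Fourier.

(** * Hermite polynomials *)

Section HermitePolynomials.
Context {R : realType}.
Implicit Types (p q : {poly R}) (x t : R).

(** The recurrence obtained by differentiating [H_m(t) e^{-t^2}]. *)
Fixpoint hpoly (m : nat) : {poly R} :=
  if m is k.+1 then 2 *: ('X * hpoly k) - (hpoly k)^`() else 1.

Lemma coef_hpoly m j : ((hpoly m)`_m = 2 ^+ m) /\ ((m < j)%N -> (hpoly m)`_j = 0).
Proof.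
elim: m j => [|m ih] j; first by rewrite coef1 expr0; split => //; rewrite coef1; case: j.
rewrite /= !coefB !coefZ !coefXM !coef_deriv /=; split.
  by rewrite (ih m).1 (ih m.+2).2// mul0rn subr0 -exprS.
case: j => // j; rewrite ltnS => mj; rewrite (ih j).2// (ih j.+2).2; last by rewrite ltnW// ltnS ltnW.
by rewrite mulr0 mul0rn subr0.
Qed.

(** The leading coefficients [2^m] are invertible, so that the Hermite polynomials
    span all the polynomials; this is stated as an induction principle. *)
Lemma hpoly_size_ind (P : {poly R} -> Prop) : P 0 -> (forall m, P (hpoly m)) ->
  (forall c p q, P p -> P q -> P (c *: p + q)) -> forall p, P p.
Proof.
move=> P0 PH PD p; have [n] := ubnP (size p); elim: n p => // n ih p.
rewrite ltnS => sp; pose c := p`_n.-1 / 2 ^+ n.-1; pose q := p - c *: hpoly n.-1.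
have -> : p = c *: hpoly n.-1 + q by rewrite /q addrC subrK.
case: n => [|n] in ih sp c q *.
  by move: sp; rewrite leqn0 size_poly_eq0 => /eqP p0; rewrite /q /c p0 coef0 mul0r !scale0r subr0 addr0.
apply: PD; first exact: PH.
apply: ih; rewrite ltnS; apply/leq_sizeP => j; rewrite /q /c /= leq_eqVlt => /orP[/eqP <-|nj].
  by rewrite coefB coefZ (coef_hpoly _ 0).1 divfK ?subrr// expf_neq0// pnatr_eq0.
rewrite coefB coefZ (coef_hpoly _ _).2// mulr0 subr0.
by rewrite nth_default// (leq_trans sp).
Qed.

Lemma derivn_hpoly m k : (m <= k)%N -> (hpoly m)^`(k) = ((m == k)%:R * (2 ^+ m * m`!%:R))%:P.
Proof.
move=> mk; apply/polyP => i; rewrite coef_derivn coefC.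
case: i => [|i] /=; last by rewrite (coef_hpoly _ _).2 ?mul0rn// addnS ltnS (leq_trans mk)// leq_addr.
rewrite addn0; move: mk; rewrite leq_eqVlt => /orP[/eqP <-|mk].
  by rewrite eqxx mul1r (coef_hpoly _ 0).1 ffactnn mulr_natr.
by rewrite (coef_hpoly _ _).2// mul0rn (ltn_eqF mk) mul0r.
Qed.

Lemma is_derive_horner p x : is_derive x (1 : R) (horner p) p^`().[x].
Proof.
by apply: DeriveDef; [exact: derivable_horner|rewrite -derive1E derivE].
Qed.

Lemma is_derive_gauss x : is_derive x (1 : R) (fun t : R => expR (- t ^+ 2)) (- (2 * x) * expR (- x ^+ 2)).
Proof.
have h : is_derive x (1 : R) (fun t : R => - t ^+ 2) (- (2 * x)).
  have := is_deriveN (is_deriveX 2 (is_derive_id x (1 : R))).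
  by rewrite /GRing.scale /= expr1 mulr1.
have := @is_derive1_comp _ expR (fun t : R => - t ^+ 2) x _ _ (is_derive_expR (- x ^+ 2)) h.
by rewrite mulrC.
Qed.

Lemma is_derive_poly_gauss p x :
  is_derive x (1 : R) (fun t : R => p.[t] * expR (- t ^+ 2))
    ((p^`() - 2 *: ('X * p)).[x] * expR (- x ^+ 2)).
Proof.
have := is_deriveM (is_derive_horner p x) (is_derive_gauss x).
rewrite /GRing.scale /=; congr is_derive.
by rewrite !(hornerD, hornerN, hornerZ, hornerM, hornerX); ring.
Qed.

(** Induction on the order of the derivative, from
    [(p e^{-t^2})' = (p' - 2 t p) e^{-t^2}]. *)
Lemma hermiteE m x : hermite m x = (hpoly m).[x].
Proof.
have key k : derive1n k (fun t : R => expR (- t ^+ 2)) =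
    (fun t => ((-1) ^+ k *: hpoly k).[t] * expR (- t ^+ 2)).
  elim: k => [|k ih].
    by apply/funext => t; rewrite derive1n0 expr0 scale1r hornerC mul1r.
  rewrite derive1nS ih; apply/funext => t.
  have := is_derive_poly_gauss ((-1) ^+ k *: hpoly k) t.
  rewrite derive1E => h; rewrite (@derive_val _ _ _ _ _ _ _ h); congr (_ * _).
  by rewrite /= !(derivZ, hornerD, hornerN, hornerZ, hornerM, hornerX) exprS; ring.
rewrite /hermite key hornerZ mulrACA -expRD subrr expR0 mulr1.
by rewrite mulrA -exprD -signr_odd oddD addbb expr0 mul1r.
Qed.

(** Monomials are bounded through [|t|^i / i! <= e^|t|] and [|t| <= (1 + t^2) / 2]. *)
Lemma poly_bound p : exists2 K : R, 0 <= K & forall t, `|p.[t]| <= K * expR (t ^+ 2 / 2).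
Proof.
have mono i : exists2 K : R, 0 <= K & forall t, `|t| ^+ i <= K * expR (t ^+ 2 / 2).
  exists (i`!%:R * expR (1 / 2)); first by rewrite mulr_ge0// expR_ge0.
  move=> t; rewrite -mulrA -expRD.
  apply: (@le_trans _ _ (i`!%:R * expR `|t|)).
    case: i => [|i]; first by rewrite expr0 fact0 mul1r -expR0 ler_expR.
    have := expR_ge1Dxn i (normr_ge0 t) => h.
    by rewrite mulrC -ler_pdivrMr ?ltr0n ?fact_gt0// (le_trans _ h)// lerDr.
  rewrite ler_wpM2l// ler_expR -[t ^+ 2]real_normK ?num_real//.
  by have := sqr_ge0 (`|t| - 1); nra.
elim/poly_ind: p => [|p c _].
  by exists 0 => // t; rewrite horner0 normr0 mul0r.
move: (p * 'X + c%:P) => {c}p.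
have [K K0 HK] : exists2 K : nat -> R, (forall i, 0 <= K i) &
   forall i t, `|t| ^+ i <= K i * expR (t ^+ 2 / 2).
  have /choice [K HK] : forall i, exists K : R, 0 <= K /\ forall t, `|t| ^+ i <= K * expR (t ^+ 2 / 2).
    by move=> i; have [K ? ?] := mono i; exists K.
  by exists K => i; case: (HK i).
exists (\sum_(i < size p) `|p`_i| * K i).
  by apply: sumr_ge0 => i _; rewrite mulr_ge0.
move=> t; rewrite horner_coef (le_trans (ler_norm_sum _ _ _))// mulr_suml.
apply: ler_sum => i _; by rewrite normrM normrX -mulrA ler_wpM2l.
Qed.

End HermitePolynomials.

(** * Hermite functions *)

Section HermiteFunctions.
Context {R : realType}.
Local Notation C := R[i].
Local Notation T := (measurableTypeR R).
Local Notation mu := (@lebesgue_measure R).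
Context (s b : R) (s0 : 0 < s).

Definition affine (y : R) : R := s * y + b.

Local Notation xi := affine.

Lemma is_derive_affine (y : R) : is_derive y (1 : R) xi s.
Proof.
have := is_deriveD (is_deriveZ s (is_derive_id y (1 : R))) (is_derive_cst b y (1 : R)).
by rewrite /GRing.scale /= mulr1 addr0.
Qed.

Lemma continuous_affine : continuous xi.
Proof.
move=> y; apply: cvgD; last exact: cvg_cst.
by apply: cvgM; [exact: cvg_cst|exact: cvg_id].
Qed.

Lemma continuous_gauss_scale (c : R) : continuous (fun t : R => expR (- (c * t ^+ 2))).
Proof.
move=> t; apply: continuous_comp; last exact: continuous_expR.
apply: cvgN; apply: cvgM; first exact: cvg_cst.
exact: exprn_continuous.
Qed.

Lemma continuous_affine_gauss (p : {poly R}) (c : R) :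
  continuous (fun y => p.[xi y] * expR (- (c * xi y ^+ 2))).
Proof.
move=> y; apply: cvgM.
  by apply: continuous_comp; [exact: continuous_affine|exact: continuous_horner].
apply: (@continuous_comp _ _ _ xi (fun t => expR (- (c * t ^+ 2)))).
  exact: continuous_affine.
exact: continuous_gauss_scale.
Qed.

Lemma continuous_affine_gauss1 (p : {poly R}) :
  continuous (fun y => p.[xi y] * expR (- xi y ^+ 2)).
Proof.
have -> : (fun y => p.[xi y] * expR (- xi y ^+ 2)) =
    (fun y => p.[xi y] * expR (- (1 * xi y ^+ 2))).
  by apply/funext => y; rewrite mul1r.
exact: continuous_affine_gauss.
Qed.

(** Up to its peak, [e^{-c (s y + b)^2}] is the density of the normal law of mean
    [- b / s] and standard deviation [1 / (s sqrt (2 c))]. *)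
Lemma gauss_affine (c : R) : 0 < c ->
  mu.-integrable [set: T] (EFin \o (fun y => expR (- (c * xi y ^+ 2)))) /\
  \int[mu]_y expR (- (c * xi y ^+ 2)) = Num.sqrt (pi / c) / s.
Proof.
move=> c0; pose sg := (Num.sqrt (2 * c) * s)^-1.
have c20 : 0 < Num.sqrt (2 * c) by rewrite sqrtr_gt0 mulr_gt0.
have sg0 : 0 < sg by rewrite invr_gt0 mulr_gt0.
have sgn0 : sg != 0 by rewrite gt_eqF.
have sg2 : (sg ^+ 2 *+ 2)^-1 = c * s ^+ 2.
  rewrite /sg -mulr_natr exprVn exprMn sqr_sqrtr ?mulr_ge0// ?ltW//.
  by field; rewrite !gt_eqF.
have pk : (normal_peak sg)^-1 = Num.sqrt (pi / c) / s.
  rewrite /normal_peak invrK.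
  have -> : sg ^+ 2 * pi *+ 2 = (pi / c) * s^-1 ^+ 2.
    rewrite /sg -mulr_natr exprVn exprMn sqr_sqrtr ?mulr_ge0// ?ltW//.
    by field; rewrite !gt_eqF.
  rewrite sqrtrM ?divr_ge0 ?pi_ge0// ?ltW// sqrtr_sqr ger0_norm// invr_ge0 ltW//.
have E : (fun y => expR (- (c * xi y ^+ 2))) =
    (fun y => (normal_peak sg)^-1 * normal_pdf (- (b / s)) sg y).
  apply/funext => y; rewrite normal_pdfE// mulrA mulVf ?gt_eqF ?normal_peak_gt0// mul1r.
  congr expR; rewrite /normal_fun sg2 /affine; field; by rewrite gt_eqF.
have ii := @integrable_normal_pdf _ (- (b / s)) sg.
rewrite E; split; first exact: integrableZR.
by rewrite RintegralZl// /Rintegral integral_normal_pdf mulr1 pk.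
Qed.

Lemma integrable_poly_gauss (p : {poly R}) :
  mu.-integrable [set: T] (EFin \o (fun y => p.[xi y] * expR (- xi y ^+ 2))).
Proof.
have [K K0 HK] := poly_bound p.
have h2 : 0 < 1 / 2 :> R by rewrite divr_gt0.
have [ii _] := gauss_affine h2.
have i2 := integrableZR measurableT K ii.
apply: (le_integrable measurableT _ _ i2).
  apply/measurable_EFinP; apply: continuous_measurable_fun.
  exact: continuous_affine_gauss1.
move=> y _; rewrite /= lee_fin normrM (ger0_norm (expR_ge0 _)) [leRHS]ger0_norm ?mulr_ge0 ?expR_ge0//.
apply: (@le_trans _ _ (K * expR (xi y ^+ 2 / 2) * expR (- xi y ^+ 2))).
  by rewrite ler_wpM2r ?expR_ge0.
rewrite -mulrA -expRD ler_wpM2l// ler_expR.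
by lra.
Qed.

(** The Gaussian moments in the variable [xi = s y + b]; integrating over [y] all
    along avoids changes of variables. *)
Definition gint (p : {poly R}) : R := \int[mu]_y (p.[xi y] * expR (- xi y ^+ 2)).

Lemma gintD p q : gint (p + q) = gint p + gint q.
Proof.
rewrite /gint -RintegralD//; [|exact: integrable_poly_gauss..].
by apply: eq_Rintegral => y _; rewrite hornerD mulrDl.
Qed.

Lemma gintZ c p : gint (c *: p) = c * gint p.
Proof.
rewrite /gint -RintegralZl//; last exact: integrable_poly_gauss.
by apply: eq_Rintegral => y _; rewrite hornerZ mulrA.
Qed.

Lemma gint1 : gint 1 = Num.sqrt pi / s.
Proof.
rewrite /gint; have [_] := gauss_affine (ltr01 : 0 < 1); rewrite divr1 => <-.
by apply: eq_Rintegral => y _; rewrite hornerC !mul1r.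
Qed.

(** The integrals over symmetric intervals are [F n - F (- n)], and they converge to
    the integral over the line by dominated convergence. *)
Lemma Rintegral_derivative_eq0 (f F : R -> R) : continuous f ->
  (forall y : R, is_derive y (1 : R) F (f y)) ->
  mu.-integrable [set: T] (EFin \o f) ->
  F n%:R @[n --> \oo] --> (0 : R) -> F (- n%:R) @[n --> \oo] --> (0 : R) ->
  \int[mu]_y f y = 0.
Proof.
move=> cf dF intf cv1 cv2.
pose In (n : nat) : set T := `[- n.+1%:R, n.+1%:R]%classic.
have mI n : measurable (In n) by exact: measurable_itv.
have mf : measurable_fun [set: T] f by exact: continuous_measurable_fun.
have mEf : measurable_fun [set: T] (EFin \o f) by exact/measurable_EFinP.
pose f_ (n : nat) (y : T) : \bar R := ((f y) * \1_(In n) y)%:E.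
have mf_ n : measurable_fun [set: T] (f_ n).
  by apply/measurable_EFinP; apply: measurable_funM => //; exact: measurable_indic.
have [||_ _] := @dominated_convergence _ _ _ mu setT measurableT f_ (EFin \o f) (abse \o (EFin \o f))
  mf_ mEf _ (integrable_abse intf).
- apply: aeW => y _; apply: cvg_near_cst.
  near=> n; rewrite /f_ indicE mem_set ?mulr1//.
  rewrite /In /= in_itv /= -ler_norml (@le_trans _ _ n%:R)//; last by rewrite ler_nat.
  by near: n; exact: nbhs_infty_ger.
- apply: aeW => y n _; rewrite /f_ /= lee_fin normrM indicE.
  by case: (_ \in _); rewrite ?normr1 ?normr0 ?mulr1 ?mulr0.
move=> /= cv.
have E n : (\int[mu]_x f_ n x)%E = (F n.+1%:R - F (- n.+1%:R))%:E.
  have -> : (\int[mu]_x f_ n x)%E = (\int[mu]_(x in In n) (f x)%:E)%E.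
    rewrite [RHS]integral_mkcond; apply: eq_integral => y _.
    by rewrite /f_ patchE indicE; case: ifP => _; rewrite ?mulr1 ?mulr0.
  rewrite -[LHS]fineK; last first.
    by apply: integrable_fin_num => //; exact: continuous_integrable_itv.
  congr (_%:E); rewrite -(@Rintegral_FTC _ f F)//.
  by rewrite (lt_trans (_ : _ < 0)) ?oppr_lt0 ?ltr0n.
have cv0 : (\int[mu]_x f_ n x)%E @[n --> \oo] --> 0%E.
  rewrite (_ : (fun n => _) = EFin \o (fun n => F n.+1%:R - F (- n.+1%:R))); last first.
    by apply/funext => n; exact: E.
  apply: cvg_EFin; first exact: nearW.
  rewrite -(subrr (0 : R)); apply: cvgB.
    by rewrite (cvg_shiftS (fun n => F n%:R)).
  by rewrite (cvg_shiftS (fun n => F (- n%:R))).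
by rewrite /Rintegral (cvg_unique _ cv cv0).
Unshelve. all: by end_near. Qed.

Lemma cvg_poly_gauss (p : {poly R}) (u : nat -> R) : (forall n, s * n%:R - `|b| <= `|xi (u n)|) ->
  p.[xi (u n)] * expR (- xi (u n) ^+ 2) @[n --> \oo] --> (0 : R).
Proof.
move=> hu; have [K K0 HK] := poly_bound p.
pose g (n : nat) : R := K * expR (1 / 2 + `|b|) * expR (- s) ^+ n.
have cg : g n @[n --> \oo] --> (0 : R).
  rewrite /g -(mulr0 (K * expR (1 / 2 + `|b|))); apply: cvgMr.
  by apply: cvg_expr; rewrite ger0_norm ?expR_ge0// expR_lt1 oppr_lt0.
apply: (@squeeze_cvgr _ _ _ _ (fun n => - g n) g) => //; last first.
  by rewrite -(@oppr0 R); exact: cvgN.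
apply: nearW => n; rewrite -ler_norml normrM (ger0_norm (expR_ge0 _)).
apply: (@le_trans _ _ (K * expR (xi (u n) ^+ 2 / 2) * expR (- xi (u n) ^+ 2))).
  by rewrite ler_wpM2r ?expR_ge0.
rewrite /g -expRM_natl -!mulrA -!expRD ler_wpM2l// ler_expR.
have := hu n; have := sqr_ge0 (`|xi (u n)| - 1).
have := real_normK (num_real (xi (u n))); rewrite mulr_natl.
by nra.
Qed.

(** This is the integral of the derivative of [p(xi) e^{-xi^2}], up to the factor [s]. *)
Lemma gint_ibp p : gint (p^`() - 2 *: ('X * p)) = 0.
Proof.
have E : s * gint (p^`() - 2 *: ('X * p)) = 0.
  rewrite /gint -RintegralZl//; last exact: integrable_poly_gauss.
  apply: (@Rintegral_derivative_eq0
    (fun y => s * ((p^`() - 2 *: ('X * p)).[xi y] * expR (- xi y ^+ 2)))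
    (fun y => p.[xi y] * expR (- xi y ^+ 2))).
  - move=> y; apply: cvgM; first exact: cvg_cst.
    exact: continuous_affine_gauss1.
  - move=> y.
    have := @is_derive1_comp _ (fun t => p.[t] * expR (- t ^+ 2)) xi y _ _
      (is_derive_poly_gauss p (xi y)) (is_derive_affine y).
    by rewrite mulrC.
  - by apply: integrableZR => //; exact: integrable_poly_gauss.
  - apply: cvg_poly_gauss => n; rewrite /affine.
    by have := ler_normB (s * n%:R + b) b; rewrite addrK; have := ler_norm (s * n%:R); lra.
  - apply: cvg_poly_gauss => n; rewrite /affine.
    have := ler_normB (s * - n%:R + b) b; rewrite addrK mulrN normrN.
    by have := ler_norm (s * n%:R); lra.
by move/eqP: E; rewrite mulf_eq0 gt_eqF//= => /eqP.
Qed.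

(** Integration by parts moves the derivatives one at a time from the Gaussian to [q]. *)
Lemma gint_hpoly m q : gint (hpoly m * q) = gint q^`(m).
Proof.
elim: m q => [|m ih] q; first by rewrite mul1r.
rewrite derivSn -ih; apply/eqP; rewrite -subr_eq0 -mulN1r -gintZ -gintD; apply/eqP.
rewrite (_ : _ + _ = (-1) *: ((hpoly m * q)^`() - 2 *: ('X * (hpoly m * q)))).
  by rewrite gintZ gint_ibp mulr0.
by rewrite derivM /= -!mul_polyC; ring.
Qed.

(** By [gint_hpoly] the larger of the two degrees counts derivatives of the other
    polynomial, which vanish unless the degrees agree. *)
Lemma gint_hpolyM m k : gint (hpoly m * hpoly k) = (m == k)%:R * (2 ^+ m * m`!%:R * (Num.sqrt pi / s)).
Proof.
wlog mk : m k / (k <= m)%N.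
  move=> H; have [|/ltnW] := leqP k m; first exact: H.
  move=> mk; rewrite mulrC H// eq_sym; case: eqP => [->//|_]; by rewrite !mul0r.
rewrite gint_hpoly derivn_hpoly// -[X in gint X]mulr1 mul_polyC gintZ gint1.
by rewrite eq_sym; case: eqP => [->|_]; rewrite ?mul0r// !mul1r.
Qed.

Definition hnorm (m : nat) : R := Num.sqrt (s / (Num.sqrt pi * (2 ^+ m * m`!%:R))).

Definition hfun (m : nat) (y : R) : R :=
  hnorm m * ((hpoly m).[xi y] * expR (- (1 / 2 * xi y ^+ 2))).

Lemma hnorm_gt0 m : 0 < hnorm m.
Proof.
by rewrite sqrtr_gt0 divr_gt0// mulr_gt0 ?sqrtr_gt0 ?pi_gt0// mulr_gt0 ?exprn_gt0// ltr0n fact_gt0.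
Qed.

Lemma sqr_hnorm m : hnorm m ^+ 2 = (2 ^+ m * m`!%:R * (Num.sqrt pi / s))^-1.
Proof.
have h1 : 0 < Num.sqrt pi :> R by rewrite sqrtr_gt0 pi_gt0.
have h2 : 0 < 2 ^+ m :> R by rewrite exprn_gt0.
have h3 : 0 < m`!%:R :> R by rewrite ltr0n fact_gt0.
rewrite sqr_sqrtr ?divr_ge0 ?mulr_ge0 ?ltW//.
by field; rewrite !gt_eqF.
Qed.

Lemma measurable_affine_gauss (p : {poly R}) c :
  measurable_fun [set: T] (fun y => p.[xi y] * expR (- (c * xi y ^+ 2))).
Proof. by apply: continuous_measurable_fun; exact: continuous_affine_gauss. Qed.

Lemma L2_poly_gauss (p : {poly R}) :
  L2 mu [set: T] (fun y => (p.[xi y] * expR (- (1 / 2 * xi y ^+ 2)))%:C).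
Proof.
apply: (@L2_le _ T R mu setT measurableT _ (fun y => (p * p).[xi y] * expR (- xi y ^+ 2))).
- by apply: cmeas_real; exact: measurable_affine_gauss.
- exact: integrable_poly_gauss.
- move=> y _; rewrite normc_real real_normK ?num_real// exprMn hornerM -expr2.
  by rewrite ler_wpM2l ?sqr_ge0// -expRM_natl ler_expR; lra.
Qed.

Lemma ip_poly_gauss (p q : {poly R}) :
  ip mu [set: T] (fun y => (p.[xi y] * expR (- (1 / 2 * xi y ^+ 2)))%:C)
    (fun y => (q.[xi y] * expR (- (1 / 2 * xi y ^+ 2)))%:C) = (gint (p * q))%:C.
Proof.
rewrite /ip /gint -cint_real; last exact: measurableT.
apply: eq_cint => y _; rewrite conjc_real -rmorphM; congr (_%:C).
rewrite hornerM mulrACA -expRD; congr (_ * expR _).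
by lra.
Qed.

Lemma L2_hfun m : L2 mu [set: T] (fun y => (hfun m y)%:C).
Proof.
have -> : (fun y => (hfun m y)%:C) = (fun y => (hnorm m)%:C *
    ((hpoly m).[xi y] * expR (- (1 / 2 * xi y ^+ 2)))%:C).
  by apply/funext => y; rewrite -rmorphM.
by apply: L2Z => //; exact: L2_poly_gauss.
Qed.

Lemma hfun_orthonormal m k :
  ip mu [set: T] (fun y => (hfun m y)%:C) (fun y => (hfun k y)%:C) = (m == k)%:R.
Proof.
have E j : (fun y : T => (hfun j y)%:C) = (fun y : T =>
    ((hnorm j *: hpoly j).[xi y] * expR (- (1 / 2 * xi y ^+ 2)))%:C).
  by apply/funext => y; rewrite hornerZ -mulrA.
rewrite !E ip_poly_gauss -scalerAl -scalerAr !gintZ gint_hpolyM.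
case: eqP => [<-|_]; last by rewrite mul0r !mulr0.
rewrite mul1r mulrA -expr2 sqr_hnorm mulVf// gt_eqF//.
by rewrite mulr_gt0 ?divr_gt0 ?sqrtr_gt0 ?pi_gt0// mulr_gt0 ?exprn_gt0// ltr0n fact_gt0.
Qed.

Let w (y : T) : R := expR (- (1 / 2 * xi y ^+ 2)).

Let E : set (T -> C) := range (fun m (y : T) => (hfun m y)%:C).

Let EL2 : E `<=` L2 mu [set: T].
Proof. by move=> _ [m _ <-]; exact: L2_hfun. Qed.

Lemma clspan_poly_gauss (p : {poly R}) : clspan mu setT E (fun y => (p.[xi y] * w y)%:C).
Proof.
move: p; apply: (@hpoly_size_ind R (fun p => clspan mu setT E (fun y : T => (p.[xi y] * w y)%:C)))
  => [|m|c p q hp hq].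
- have -> : (fun y : T => ((0 : {poly R}).[xi y] * w y)%:C) = (fun=> 0).
    by apply/funext => y; rewrite horner0 mul0r.
  exact: clspan0.
- have -> : (fun y : T => ((hpoly m).[xi y] * w y)%:C) =
      (fun y : T => (hnorm m)^-1%:C * (hfun m y)%:C).
    apply/funext => y; rewrite -rmorphM; congr (_%:C); rewrite /hfun mulrA mulVf ?[RHS]mul1r//.
    by rewrite gt_eqF// hnorm_gt0.
  by apply: clspanZ => //; apply: sub_clspan => //; exists m.
- have -> : (fun y : T => ((c *: p + q).[xi y] * w y)%:C) =
      (fun y : T => c%:C * (p.[xi y] * w y)%:C + (q.[xi y] * w y)%:C).
    by apply/funext => y; rewrite hornerD hornerZ -rmorphM -rmorphD mulrDl mulrA.
  by apply: clspanD => //; exact: clspanZ.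
Qed.

Lemma measurable_w : measurable_fun [set: T] w.
Proof.
have := measurable_affine_gauss 1 (1 / 2).
by apply: eq_measurable_fun => y _; rewrite hornerC [LHS]mul1r.
Qed.

(** Completing the square: [2 k |xi| - xi^2 <= 2 k^2 - xi^2 / 2]. *)
Lemma integrable_w_exp (k : R) :
  mu.-integrable [set: T] (EFin \o (fun y => expR (k * `|xi y|) ^+ 2 * w y ^+ 2)).
Proof.
have h2 : 0 < 1 / 2 :> R by rewrite divr_gt0.
have [ii _] := gauss_affine h2.
apply: (le_integrable measurableT _ _ (integrableZR measurableT (expR (2 * k ^+ 2)) ii)).
  apply/measurable_EFinP; apply: measurable_funM; apply: measurable_funX; last exact: measurable_w.
  apply: measurableT_comp => //; apply: measurable_funM => //.
  apply: measurableT_comp => //.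
  by apply: continuous_measurable_fun; exact: continuous_affine.
move=> y _; rewrite /= lee_fin [leLHS]ger0_norm ?mulr_ge0 ?exprn_ge0 ?expR_ge0//.
rewrite [leRHS]ger0_norm ?mulr_ge0 ?expR_ge0//.
rewrite /w -!expRM_natl -!expRD ler_expR.
have := real_normK (num_real (xi y)); have := sqr_ge0 (`|xi y| - 2 * k).
by nra.
Qed.

Lemma integrable_w2 : mu.-integrable [set: T] (EFin \o (fun y => w y ^+ 2)).
Proof.
have := integrable_w_exp 0; apply: eq_integrable => // y _.
by rewrite /= mul0r expR0 expr1n mul1r.
Qed.

Lemma series_exp_coeff_le (x : R) n : 0 <= x -> series (exp_coeff x) n <= expR x.
Proof.
move=> x0; rewrite /expR; apply: nondecreasing_cvgn_le; last exact: is_cvg_series_exp_coeff.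
apply/nondecreasing_seqP => k; rewrite /series /= big_nat_recr//= lerDl /exp_coeff /=.
by rewrite mulr_ge0// exprn_ge0.
Qed.

Lemma taylor_cos_le (x : R) n : `|series (cos_coeff x) n| <= expR `|x|.
Proof.
apply: (@le_trans _ _ (series (exp_coeff `|x|) n)).
  rewrite /series /= (le_trans (ler_norm_sum _ _ _))//; apply: ler_sum => i _.
  rewrite /cos_coeff /exp_coeff /= normrM [X in _ * X]ger0_norm ?invr_ge0// ler_wpM2r ?invr_ge0//.
  rewrite normrM normrX ler_piMl ?exprn_ge0// normrM; case: (odd i) => /=; first by rewrite normr0 mul0r.
  by rewrite normr1 mul1r ?exprnP normrX normrN1 expr1n.
exact: series_exp_coeff_le.
Qed.

Lemma taylor_sin_le (x : R) n : `|series (sin_coeff x) n| <= expR `|x|.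
Proof.
apply: (@le_trans _ _ (series (exp_coeff `|x|) n)).
  rewrite /series /= (le_trans (ler_norm_sum _ _ _))//; apply: ler_sum => i _.
  rewrite /sin_coeff /exp_coeff /= normrM [X in _ * X]ger0_norm ?invr_ge0// ler_wpM2r ?invr_ge0//.
  rewrite normrM normrX ler_piMl ?exprn_ge0// normrM; case: (odd i) => /=; last by rewrite normr0 mul0r.
  by rewrite normr1 mul1r ?exprnP normrX normrN1 expr1n.
exact: series_exp_coeff_le.
Qed.

(** The Taylor sums at [k xi] are polynomials in [xi], dominated by [e^{|k xi|}], which
    is square integrable against the Gaussian. *)
Lemma clspan_taylor (k : R) (f : R -> R) (c : nat -> R) :
  continuous f ->
  (forall x n, `|\sum_(i < n) c i * x ^+ i| <= expR `|x|) ->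
  (forall x, (\sum_(i < n) c i * x ^+ i) @[n --> \oo] --> f x) ->
  clspan mu setT E (fun y => (f (k * xi y) * w y)%:C).
Proof.
move=> cf bd cv.
have fbd x : `|f x| <= expR `|x|.
  have cn : `|\sum_(i < n) c i * x ^+ i| @[n --> \oo] --> `|f x| by exact: cvg_norm.
  rewrite -(cvg_lim _ cn)//; apply: limr_le; first by apply/cvg_ex; eexists; exact: cn.
  by apply: nearW => n; exact: bd.
apply: (@clspan_dominated _ _ _ _ _ measurableT _ EL2
   (fun n y => ((\sum_(i < n) c i * (k * xi y) ^+ i) * w y)%:C) _
   (fun y => expR (`|k| * `|xi y|) ^+ 2 * w y ^+ 2)).
- apply: cmeas_real; apply: measurable_funM; last exact: measurable_w.
  apply: continuous_measurable_fun => y; apply: (@continuous_comp _ _ _ (fun y => k * xi y)).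
    by apply: cvgM; [exact: cvg_cst|exact: continuous_affine].
  exact: cf.
- move=> n; have := clspan_poly_gauss (\sum_(i < n) (c i * k ^+ i) *: 'X^i).
  set g := (X in clspan _ _ _ X -> _); set h := (X in _ -> clspan _ _ _ X).
  suff -> : h = g by [].
  apply/funext => y; rewrite /g /h horner_sum; congr ((_ * _)%:C).
  by apply: eq_bigr => i _; rewrite hornerZ hornerXn exprMn mulrA.
- exact: integrable_w_exp.
- move=> n y _; rewrite normc_real real_normK ?num_real// exprMn ler_wpM2r ?sqr_ge0//.
  by rewrite -[leLHS]real_normK ?num_real// lerXn2r ?nnegrE ?expR_ge0// -normrM.
- move=> y _; rewrite normc_real real_normK ?num_real// exprMn ler_wpM2r ?sqr_ge0//.
  by rewrite -[leLHS]real_normK ?num_real// lerXn2r ?nnegrE ?expR_ge0// -normrM.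
- apply: aeW => y _.
  have -> : (fun n => normc (((\sum_(i < n) c i * (k * xi y) ^+ i) * w y)%:C -
      (f (k * xi y) * w y)%:C)) =
      (fun n => `|\sum_(i < n) c i * (k * xi y) ^+ i - f (k * xi y)| * `|w y|).
    by apply/funext => n; rewrite -rmorphB -mulrBl normc_real normrM.
  rewrite -[X in _ --> X](mul0r `|w y|); apply: cvgMl.
  rewrite -[X in _ --> X](normr0 R); apply: cvg_norm.
  by rewrite -[X in _ --> X](subrr (f (k * xi y))); apply: cvgB => //; exact: cvg_cst.
Qed.

Lemma clspan_cos_gauss (k : R) : clspan mu setT E (fun y => (cos (k * xi y) * w y)%:C).
Proof.
pose c i : R := (~~ odd i)%:R * (-1)^i./2 / i`!%:R.
have Ec x n : \sum_(i < n) c i * x ^+ i = series (cos_coeff x) n.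
  rewrite /series /= big_mkord; apply: eq_bigr => i _.
  by rewrite /c /cos_coeff /=; ring.
apply: (@clspan_taylor k _ c); first exact: continuous_cos.
  by move=> x n; rewrite Ec; exact: taylor_cos_le.
move=> x; under eq_fun do rewrite Ec.
by rewrite cos.unlock; exact: is_cvg_series_cos_coeff.
Qed.

Lemma clspan_sin_gauss (k : R) : clspan mu setT E (fun y => (sin (k * xi y) * w y)%:C).
Proof.
pose c i : R := (odd i)%:R * (-1)^+(i.-1./2) / i`!%:R.
have Ec x n : \sum_(i < n) c i * x ^+ i = series (sin_coeff x) n.
  rewrite /series /= big_mkord; apply: eq_bigr => i _.
  by rewrite /c /sin_coeff /=; ring.
apply: (@clspan_taylor k _ c); first exact: continuous_sin.
  by move=> x n; rewrite Ec; exact: taylor_sin_le.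
move=> x; under eq_fun do rewrite Ec.
by rewrite sin.unlock; exact: is_cvg_series_sin_coeff.
Qed.

(** Taylor series of cosine and sine put every exponential [e^{i om y} w] in the closed
    span. All real frequencies being available, a bounded interval is the limit of
    the periodic sets of period [L k] that coincide with it near its centre, and a
    ray is an increasing union of intervals. *)
Lemma hermite_density f : L2 mu [set: T] f -> clspan mu setT E f.
Proof.
have iw := integrable_w2; have mw := measurable_w.
pose Om : set R := setT.
have A1 : multipliers setT w E Om (fun=> 1).
  move=> om _.
  have -> : (fun y : T => 1%:C * cis (om * y) * (w y)%:C) =
    (fun y : T => cis (- (om / s) * b) * ((cos (om / s * xi y) * w y)%:C +
                                 'i%C * (sin (om / s * xi y) * w y)%:C)).
    apply/funext => y; rewrite mul1r.
    have -> : om * y = - (om / s) * b + om / s * xi y.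
      by rewrite /affine; field; rewrite gt_eqF.
    rewrite cisD -mulrA; congr (_ * _); rewrite /cis; apply/eqP; rewrite eq_complex /=.
    by apply/andP; split; apply/eqP; ring.
  apply: clspanZ => //; apply: clspanD => //; first exact: clspan_cos_gauss.
  by apply: clspanZ => //; exact: clspan_sin_gauss.
have pi0 := pi_gt0 R.
have bnat (c : bool) : `|c%:R : R| <= 1 by case: c; rewrite ?normr1 ?normr0.
have mlt (D : set T) (g h : T -> R) : measurable_fun D g -> measurable_fun D h ->
    measurable_fun D (fun x : T => (g x < h x)%R%:R : R).
  by move=> mg mh; apply: measurableT_comp => //; exact: measurable_fun_ltr.
have Aint (p q : R) : p < q -> multipliers setT w E Om (fun x => ((p < x) && (x < q))%:R).
  move=> pq; pose a := (p + q) / 2; pose d := (q - p) / 2.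
  have d0 : 0 < d by rewrite divr_gt0// subr_gt0.
  pose L (k : nat) := 2 * d + k.+1%:R.
  have L0 k : 0 < L k by rewrite addr_gt0// mulr_gt0.
  have dL k : 2 * d / L k <= 1 by rewrite ler_pdivrMr// mul1r lerDl.
  have dL0 k : 0 < 2 * d / L k by rewrite divr_gt0// mulr_gt0.
  have rho k : 0 <= pi * (2 * d / L k) <= pi by apply/andP; split; [rewrite mulr_ge0// ltW|rewrite ler_piMr// ltW].
  apply: (@multipliers_limit _ setT measurableT w mw iw E EL2 Om
     (fun k x => (cos (pi * (2 * d / L k)) < cos (2 * pi / L k * (x - a)))%R%:R) _ 1).
  - have -> : (fun x : T => ((p < x) && (x < q))%:R : R) =
      (fun x : T => (p < x)%R%:R * (x < q)%R%:R).
      by apply/funext => x; rewrite -natrM mulnb.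
    by apply: measurable_funM; apply: mlt.
  - move=> k; apply: multipliers_arc => //.
    have m1 : 0 \in `[0, pi : R] by rewrite in_itv /= lexx ltW.
    have m2 : pi * (2 * d / L k) \in `[0, pi : R] by rewrite in_itv /=; exact: rho.
    by rewrite cos_geN1/= -[ltRHS](cos0 R) ltr_cos// mulr_gt0.
  - by move=> k x _; exact: bnat.
  - by move=> x _; exact: bnat.
  - apply: aeW => x _; apply: cvg_near_cst; near=> k.
    rewrite ltr_cos_arc//; last first.
      rewrite normrM (ger0_norm (_ : 0 <= 2 * pi / L k)); last by rewrite divr_ge0 ?mulr_ge0// ltW.
      have -> : 2 * pi - pi * (2 * d / L k) = 2 * pi / L k * (L k - d).
        by field; rewrite gt_eqF.
      rewrite ltr_pM2l ?divr_gt0 ?mulr_gt0// /L.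
      have : `|x - a| < k%:R by near: k; exact: nbhs_infty_gtr.
      by rewrite -natr1; lra.
    congr ((nat_of_bool _)%:R).
    rewrite normrM (ger0_norm (_ : 0 <= 2 * pi / L k)); last by rewrite divr_ge0 ?mulr_ge0// ltW.
    have -> : pi * (2 * d / L k) = 2 * pi / L k * d by field; rewrite gt_eqF.
    rewrite ltr_pM2l ?divr_gt0 ?mulr_gt0// ltr_norml /a /d.
    by apply/andP/andP => -[h1 h2]; split; lra.
apply: (density measurableT mw iw EL2 (Om := Om)) => //.
  move=> r; apply: (@multipliers_limit _ setT measurableT w mw iw E EL2 Om
    (fun k x => ((r < x) && (x < r + k.+1%:R))%:R) _ 1).
  - by apply: mlt.
  - by move=> k; apply: Aint; rewrite ltrDl.
  - by move=> k x _; exact: bnat.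
  - by move=> x _; exact: bnat.
  - apply: aeW => x _; apply: cvg_near_cst; near=> k.
    suff -> : x < r + k.+1%:R by rewrite andbT.
    have : x - r < k%:R by near: k; exact: nbhs_infty_gtr.
    by rewrite -natr1; lra.
by move=> x _; exact: expR_gt0.
Unshelve. all: by end_near. Qed.

Lemma hermite_parseval f : L2 mu [set: T] f ->
  (\esum_(m in [set: nat]) (normc (ip mu setT f (fun y => (hfun m y)%:C)) ^+ 2)%:E
   = sqn mu setT f)%E.
Proof.
move=> lf; apply: (parseval_clspan measurableT (e := fun m (y : T) => (hfun m y)%:C)).
- exact: L2_hfun.
- exact: hfun_orthonormal.
- exact: hermite_density.
Qed.

End HermiteFunctions.

(** * Integration over the strip *)

Section StripIntegrals.
Context {R : realType}.
Local Notation C := R[i].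
Local Notation T := (measurableTypeR R).
Local Notation mu := (@lebesgue_measure R).
Local Notation I01 := (`[0, 1]%classic : set T).
Local Notation lam2 := (@lebesgue_measure R \x @lebesgue_measure R)%E.
Local Notation S := (@strip R : set (T * T)).

Lemma measurable_strip : measurable S.
Proof. by apply: measurableX; [exact: measurable_itv|exact: measurableT]. Qed.

Lemma patch_strip (F : T * T -> \bar R) x y :
  (F \_ S) (x, y) = ((fun x => F (x, y)) \_ I01) x.
Proof.
rewrite !patchE; congr (if _ then _ else _); apply/idP/idP => /set_mem.
  by move=> [? _]; exact/mem_set.
by move=> ?; apply/mem_set; split.
Qed.

Lemma tonelli_strip (F : T * T -> \bar R) : measurable_fun setT F ->
  (forall p, (0 <= F p)%E) ->
  (\int[lam2]_(p in S) F p = \int[mu]_y \int[mu]_(x in I01) F (x, y))%E.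
Proof.
move=> mF F0; rewrite integral_mkcond fubini_tonelli2.
- apply: eq_integral => y _; rewrite /fubini_G [RHS]integral_mkcond.
  by apply: eq_integral => x _; rewrite patch_strip.
- exact: (proj1 (measurable_restrictT F measurable_strip) (measurable_funTS mF)).
- by move=> p; rewrite patchE; case: ifP.
Qed.

Lemma measurable_slice_ge0 (F : T * T -> \bar R) : measurable_fun setT F ->
  (forall p, (0 <= F p)%E) ->
  measurable_fun [set: T] (fun y => (\int[mu]_(x in I01) F (x, y))%E).
Proof.
move=> mF F0.
have h := @measurable_fun_fubini_tonelli_G _ _ T T R mu (F \_ S).
have -> : (fun y => (\int[mu]_(x in I01) F (x, y))%E) = fubini_G mu (F \_ S).
  apply/funext => y; rewrite /fubini_G [LHS]integral_mkcond.
  by apply: eq_integral => x _; rewrite patch_strip.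
apply: h.
- exact: (proj1 (measurable_restrictT F measurable_strip) (measurable_funTS mF)).
- by move=> p; rewrite patchE; case: ifP.
Qed.

Lemma measurable_slice_fun (h : T * T -> R) (y : T) : measurable_fun setT h ->
  measurable_fun [set: T] (fun x => h (x, y)).
Proof. by move=> mh; apply: measurableT_comp => //; exact: measurable_fun_pair. Qed.

Lemma measurable_Rslice (h : T * T -> R) : measurable_fun setT h ->
  measurable_fun [set: T] (fun y => \int[mu]_(x in I01) h (x, y)).
Proof.
move=> mh; have mEh : measurable_fun setT (EFin \o h) by exact/measurable_EFinP.
rewrite /Rintegral; apply: measurableT_comp => //.
under eq_fun do rewrite integralE.
apply: emeasurable_funB.
- have := measurable_slice_ge0 (measurable_funepos mEh) (fun p => funepos_ge0 (EFin \o h) p).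
  by congr measurable_fun; apply/funext => y; apply: eq_integral => x _; rewrite !funeposE.
- have := measurable_slice_ge0 (measurable_funeneg mEh) (fun p => funeneg_ge0 (EFin \o h) p).
  by congr measurable_fun; apply/funext => y; apply: eq_integral => x _; rewrite !funenegE.
Qed.

Lemma ae_integrable_slice (h : T * T -> R) : measurable_fun setT h ->
  lam2.-integrable S (EFin \o h) ->
  {ae mu, forall y, mu.-integrable I01 (EFin \o (fun x => h (x, y)))}.
Proof.
move=> mh /integrableP[_ ih].
have mEh : measurable_fun setT (abse \o (EFin \o h)).
  by apply: measurableT_comp => //; exact/measurable_EFinP.
have m1 := measurable_slice_ge0 mEh (fun=> abse_ge0 _).
rewrite (tonelli_strip mEh (fun=> abse_ge0 _)) in ih.
have : mu.-integrable [set: T] (fun y => \int[mu]_(x in I01) (abse \o (EFin \o h)) (x, y))%E.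
  apply/integrableP; split => //; apply: le_lt_trans ih.
  rewrite [leLHS](eq_integral (fun y =>
    (\int[mu]_(x in I01) (abse \o (EFin \o h)) (x, y))%E))// => y _.
  by rewrite gee0_abs//; apply: integral_ge0 => x _; exact: abse_ge0.
move/(integrable_ae measurableT); apply: filterS => y /(_ I).
rewrite ge0_fin_numE; last by apply: integral_ge0 => x _; exact: abse_ge0.
move=> hy; apply/integrableP; split.
  by apply/measurable_EFinP; apply: measurable_funTS; exact: measurable_slice_fun.
exact: hy.
Qed.

Lemma fubini_strip (h : T * T -> R) : measurable_fun setT h ->
  lam2.-integrable S (EFin \o h) ->
  \int[lam2]_(p in S) h p = \int[mu]_y (\int[mu]_(x in I01) h (x, y)).
Proof.
move=> mh ih; rewrite /Rintegral; congr fine.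
rewrite integral_mkcond -integral21_prod_meas1; last first.
  by rewrite -integrable_mkcond//; exact: measurable_strip.
have E y : fubini_G mu ((EFin \o h) \_ S) y = (\int[mu]_(x in I01) (h (x, y))%:E)%E.
  rewrite /fubini_G [RHS]integral_mkcond.
  by apply: eq_integral => x _; rewrite patch_strip.
have mE : measurable_fun [set: T] (fun y => (\int[mu]_(x in I01) (h (x, y))%:E)%E).
  have -> : (fun y => (\int[mu]_(x in I01) (h (x, y))%:E)%E) =
    fubini_G mu ((EFin \o h) \_ S) by apply/funext => y; rewrite E.
  apply: (@measurable_fubini_G _ _ _ _ _ mu mu).
  by rewrite -integrable_mkcond//; exact: measurable_strip.
rewrite (eq_integral _ _ (fun y _ => E y)); apply: ae_eq_integral => //.
  by apply/measurable_EFinP; exact: measurable_Rslice.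
apply: filterS (ae_integrable_slice mh ih) => y iy _.
by rewrite fineK//; apply: integrable_fin_num => //; exact: measurable_itv.
Qed.

Lemma cmeas_sub (D : set (T * T)) (h : T * T -> C) : cmeas setT h -> cmeas D h.
Proof. by move=> [? ?]; split; exact: measurable_funTS. Qed.

Lemma cmeas_slice (h : T * T -> C) (y : T) : cmeas setT h ->
  cmeas setT (fun x => h (x, y)).
Proof.
move=> [h1 h2]; split.
- exact: (@measurable_slice_fun (fun p => complex.Re (h p))).
- exact: (@measurable_slice_fun (fun p => complex.Im (h p))).
Qed.

Lemma cmeas_cint_slice (h : T * T -> C) : cmeas setT h ->
  cmeas [set: T] (fun y => cint mu I01 (fun x => h (x, y))).
Proof.
move=> [h1 h2]; split; rewrite /cint /=.
- exact: (@measurable_Rslice (fun p => complex.Re (h p))).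
- exact: (@measurable_Rslice (fun p => complex.Im (h p))).
Qed.

Lemma cfubini_strip (h : T * T -> C) : cmeas setT h -> cintegrable lam2 S h ->
  cint lam2 S h = cint mu setT (fun y => cint mu I01 (fun x => h (x, y))).
Proof.
move=> [h1 h2] [i1 i2]; rewrite /cint /=; congr (_ +i* _).
- exact: (@fubini_strip (fun p => complex.Re (h p))).
- exact: (@fubini_strip (fun p => complex.Im (h p))).
Qed.

Lemma sqn_strip (u : T * T -> C) : cmeas setT u ->
  (sqn lam2 S u = \int[mu]_y sqn mu I01 (fun x => u (x, y)))%E.
Proof.
move=> mu_; rewrite /sqn tonelli_strip//.
- by apply/measurable_EFinP; exact: measurable_sqr_normc.
- by move=> p; rewrite lee_fin sqr_ge0.
Qed.

Lemma measurable_sqn_slice (u : T * T -> C) : cmeas setT u ->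
  measurable_fun [set: T] (fun y => sqn mu I01 (fun x => u (x, y))).
Proof.
move=> mu_; apply: (@measurable_slice_ge0 (fun p => (normc (u p) ^+ 2)%:E)).
- by apply/measurable_EFinP; exact: measurable_sqr_normc.
- by move=> p; rewrite lee_fin sqr_ge0.
Qed.

Lemma ae_L2_slice (u : T * T -> C) : cmeas setT u -> L2 lam2 S u ->
  {ae mu, forall y, L2 mu I01 (fun x => u (x, y))}.
Proof.
move=> mu_ [_]; rewrite sqn_strip// => lu.
have : mu.-integrable [set: T] (fun y => sqn mu I01 (fun x => u (x, y))).
  apply/integrableP; split; first exact: measurable_sqn_slice.
  rewrite (eq_integral (fun y => sqn mu I01 (fun x => u (x, y))))// => y _.
  by rewrite gee0_abs// sqn_ge0.
move/(integrable_ae measurableT); apply: filterS => y /(_ I).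
rewrite ge0_fin_numE ?sqn_ge0// => hy; split => //.
by have [? ?] := cmeas_slice y mu_; split; exact: measurable_funTS.
Qed.

Lemma ae_eq_cint (f g : T -> C) : cmeas setT f -> cmeas setT g ->
  {ae mu, forall y, f y = g y} -> cint mu setT f = cint mu setT g.
Proof.
move=> [f1 f2] [g1 g2] fg; rewrite /cint /Rintegral; congr (fine _ +i* fine _);
  (apply: ae_eq_integral => //; try exact/measurable_EFinP);
  by apply: filterS fg => y -> _.
Qed.

(** Sums over the integers as two one-sided series, to which the theorems on
    monotone convergence of series apply. *)
Lemma esum_int (a : int -> \bar R) : (forall n, (0 <= a n)%E) ->
  (\esum_(n in [set: int]) a n =
   \sum_(k <oo) a (Posz k) + \sum_(k <oo) a (Negz k))%E.
Proof.
move=> a0; rewrite (esumID (range Posz)) => [|n _]; last exact: a0.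
rewrite !setTI; congr (_ + _)%E.
- by rewrite nneseries_esumT// (esum_image setT Posz)// => x y _ _ [].
- have -> : ~` range Posz = range Negz.
    apply/seteqP; split => [[k|k]|_ [k _ <-]] /=.
    + by move=> H; exfalso; apply: H; exists k.
    + by move=> _; exists k.
    + by move=> [j _].
  by rewrite nneseries_esumT// (esum_image setT Negz)// => x y _ _ [].
Qed.

Lemma integral_esum_int (a : int -> T -> \bar R) :
  (forall n, measurable_fun [set: T] (a n)) -> (forall n y, (0 <= a n y)%E) ->
  (\int[mu]_y (\esum_(n in [set: int]) a n y) = \esum_(n in [set: int]) (\int[mu]_y a n y))%E.
Proof.
move=> ma a0; rewrite esum_int; last by move=> n; exact: integral_ge0.
under eq_integral do rewrite esum_int//.
rewrite ge0_integralD//.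
- by rewrite !integral_nneseries.
- by move=> y _; exact: nneseries_ge0.
- exact: ge0_emeasurable_sum.
- by move=> y _; exact: nneseries_ge0.
- exact: ge0_emeasurable_sum.
Qed.

End StripIntegrals.

(** * Fourier expansion in x, orthonormal expansion in y *)

Section StripExpansion.
Context {R : realType}.
Local Notation C := R[i].
Local Notation T := (measurableTypeR R).
Local Notation mu := (@lebesgue_measure R).
Local Notation I01 := (`[0, 1]%classic : set T).
Local Notation lam2 := (@lebesgue_measure R \x @lebesgue_measure R)%E.
Local Notation S := (@strip R : set (T * T)).
Context (phs : T * T -> C) (h : int -> nat -> T -> R).
Hypothesis mphs : cmeas setT phs.
Hypothesis normc_phs : forall p, normc (phs p) = 1.
Hypothesis Lh : forall n m, L2 mu setT (fun y => (h n m y)%:C).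
Hypothesis oh : forall n m k,
  ip mu setT (fun y => (h n m y)%:C) (fun y => (h n k y)%:C) = (m == k)%:R.
Hypothesis ph : forall n v, L2 mu setT v ->
  (\esum_(m in [set: nat]) (normc (ip mu setT v (fun y => (h n m y)%:C)) ^+ 2)%:E
   = sqn mu setT v)%E.

Let mS : measurable S. Proof. exact: measurable_strip. Qed.
Let mI : measurable I01. Proof. exact: measurable_I01. Qed.

(** A function of [y] carried by a Fourier mode in [x]; the phase [phs] has modulus 1. *)
Definition mode (n : int) (v : T -> R) (p : T * T) : C :=
  phs p * fmode n p.1 * (v p.2)%:C.

(** Fourier coefficient in [x], at height [y], once the phase is removed. *)
Definition coef (n : int) (u : T * T -> C) (y : T) : C :=
  ip mu I01 (fun x => u (x, y) * (phs (x, y))^*%C) (fmode n).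

Lemma cmeas_mode n v : measurable_fun [set: T] v -> cmeas setT (mode n v).
Proof.
move=> mv; apply: cmeasM.
  apply: cmeasM => //; have [e1 e2] := cmeas_fmode (setT : set T) n.
  by split; [exact: (measurableT_comp e1 measurable_fst)|exact: (measurableT_comp e2 measurable_fst)].
by apply: cmeas_real; exact: (measurableT_comp mv measurable_snd).
Qed.

Lemma cmeas_unwound u : cmeas setT u -> cmeas setT (fun p => u p * (phs p)^*%C).
Proof. by move=> ?; apply: cmeasM => //; exact: cmeasJ. Qed.

Lemma measurable_h n m : measurable_fun [set: T] (h n m).
Proof. by case: (Lh n m) => -[]. Qed.

Lemma cmeas_coef n u : cmeas setT u -> cmeas setT (coef n u).
Proof.
move=> mu_; apply: (@cmeas_cint_slice _ (fun p => u p * (phs p)^*%C * (fmode n p.1)^*%C)).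
apply: cmeasM; first exact: cmeas_unwound.
apply: cmeasJ; have [e1 e2] := cmeas_fmode (setT : set T) n.
by split; [exact: (measurableT_comp e1 measurable_fst)|exact: (measurableT_comp e2 measurable_fst)].
Qed.

Lemma sqn_unwound u y : sqn mu I01 (fun x => u (x, y) * (phs (x, y))^*%C) =
  sqn mu I01 (fun x => u (x, y)).
Proof.
by apply: eq_integral => x _; rewrite normcM normcJ normc_phs mulr1.
Qed.

Lemma L2_unwound u y : cmeas setT u -> L2 mu I01 (fun x => u (x, y)) ->
  L2 mu I01 (fun x => u (x, y) * (phs (x, y))^*%C).
Proof.
move=> mu_ [_ lu]; split; last by rewrite sqn_unwound.
have [m1 m2] := cmeas_slice y (cmeas_unwound mu_).
by split; exact: measurable_funTS.
Qed.

(** The Bessel inequality holds on almost every horizontal segment of the strip, and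
    is then integrated in [y]. *)
Lemma L2_coef n u : cmeas setT u -> L2 lam2 S u -> L2 mu setT (coef n u).
Proof.
move=> mu_ lu; split; first exact: cmeas_coef.
have [_] := lu; rewrite sqn_strip//; apply: le_lt_trans.
apply: ae_ge0_le_integral => //.
- by move=> y _; rewrite lee_fin sqr_ge0.
- by apply/measurable_EFinP; apply: measurable_sqr_normc; exact: cmeas_coef.
- by move=> y _; exact: sqn_ge0.
- exact: measurable_sqn_slice.
apply: filterS (ae_L2_slice mu_ lu) => y ly _.
have lv := L2_unwound mu_ ly.
rewrite -sqn_unwound -nqK// lee_fin.
have := bessel mI (@L2_fmode R) (@fmode_orthonormal R) lv (_ : uniq [:: n]).
by rewrite big_seq1; apply.
Qed.

Lemma normc_mode n v p : normc (mode n v p) ^+ 2 = v p.2 ^+ 2.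
Proof.
by rewrite /mode !normcM normc_phs normc_cis !mul1r normc_real real_normK// num_real.
Qed.

Lemma L2_mode n v : L2 mu setT (fun y => (v y)%:C) -> L2 lam2 S (mode n v).
Proof.
move=> [mv lv]; have mv1 : measurable_fun [set: T] v by case: mv.
split; first by apply: cmeas_sub; exact: cmeas_mode.
rewrite sqn_strip; last exact: cmeas_mode.
rewrite (eq_integral (fun y => (normc (v y)%:C ^+ 2)%:E))// => y _.
rewrite /sqn (eq_integral (fun=> ((v y) ^+ 2)%:E)); last by move=> x _; rewrite normc_mode.
rewrite integral_cst//= normc_real real_normK ?num_real//.
by rewrite lebesgue_measure_itv/= lte_fin ltr01 oppr0 adde0 mule1.
Qed.

(** The theorem of Fubini: projecting on a mode amounts to projecting, in the variable
    [y], the corresponding Fourier coefficient. *)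
Lemma ip_mode n u v : cmeas setT u -> L2 lam2 S u -> L2 mu setT (fun y => (v y)%:C) ->
  ip lam2 S u (mode n v) = ip mu setT (coef n u) (fun y => (v y)%:C).
Proof.
move=> mu_ lu lv; have mv : measurable_fun [set: T] v by case: lv => -[].
have lmode := L2_mode n lv; have mmode := cmeas_mode n mv.
rewrite /ip cfubini_strip; first last.
- exact: cintegrable_ip.
- exact: (cmeasM mu_ (cmeasJ mmode)).
apply: ae_eq_cint.
- apply: (@cmeas_cint_slice _ (fun p => u p * (mode n v p)^*%C)).
  exact: (cmeasM mu_ (cmeasJ mmode)).
- by apply: cmeasM; [exact: cmeas_coef|apply: cmeasJ; exact: cmeas_real].
apply: filterS (ae_L2_slice mu_ lu) => y ly.
have lw := L2_unwound mu_ ly.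
rewrite conjc_real mulrC /coef /ip -cintZ//; last first.
  by apply: cintegrable_ip => //; exact: L2_fmode.
by apply: eq_cint => x _; rewrite /mode !conjcM conjc_real -[(x, y).1]/x -[(x, y).2]/y; ring.
Qed.

Lemma coef_mode n k v y : coef n (mode k v) y = (n == k)%:R * (v y)%:C.
Proof.
rewrite /coef /ip (@eq_cint _ _ _ _ _ _ (fun x => (v y)%:C * fmode (k - n) x)).
  rewrite cintZ//; first by rewrite cint_fmode subr_eq0 eq_sym mulrC.
  split; apply: continuous_integrable_itv.
  - move=> x; apply: (@continuous_comp _ _ _ (fun x => 2 * pi * (k - n)%:~R * x) cos); last exact: continuous_cos.
    by apply: cvgM; [exact: cvg_cst|exact: cvg_id].
  - move=> x; apply: (@continuous_comp _ _ _ (fun x => 2 * pi * (k - n)%:~R * x) sin); last exact: continuous_sin.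
    by apply: cvgM; [exact: cvg_cst|exact: cvg_id].
move=> x _; rewrite -fmodeMJ /mode /=.
have -> : phs (x, y) * fmode k x * (v y)%:C * (phs (x, y))^*%C * (fmode n x)^*%C =
  phs (x, y) * (phs (x, y))^*%C * ((v y)%:C * (fmode k x * (fmode n x)^*%C)) by ring.
by rewrite mulcJ normc_phs expr1n mul1r.
Qed.

Definition basis (i : nat * int) : T * T -> C := mode i.2 (h i.2 i.1).

Lemma cmeas_basis i : cmeas setT (basis i).
Proof. by apply: cmeas_mode; exact: measurable_h. Qed.

Lemma L2_basis i : L2 lam2 S (basis i).
Proof. exact: L2_mode. Qed.

Lemma basis_orthonormal i j : ip lam2 S (basis i) (basis j) = (i == j)%:R.
Proof.
case: i j => [m n] [k l]; rewrite ip_mode; [|exact: cmeas_basis|exact: L2_basis|exact: Lh].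
rewrite xpair_eqE; case: (eqVneq n l) => [<-|nl] /=.
  have -> : coef n (basis (m, n)) = (fun y => (h n m y)%:C).
    by apply/funext => y; rewrite coef_mode eqxx mul1r.
  by rewrite oh andbT.
rewrite andbF /ip (@eq_cint _ _ _ _ _ _ (fun=> 0)) ?cint0// => y _.
by rewrite coef_mode eq_sym (negbTE nl) !mul0r.
Qed.

(** The Parseval identity is applied in [x] on almost every horizontal segment, then
    in [y] to each Fourier coefficient. *)
Lemma basis_parseval u : cmeas setT u -> L2 lam2 S u ->
  (\esum_(i in [set: nat * int]) (normc (ip lam2 S u (basis i)) ^+ 2)%:E = sqn lam2 S u)%E.
Proof.
move=> mu_ lu; rewrite sqn_strip//.
have E : (\int[mu]_y sqn mu I01 (fun x => u (x, y)) =
    \int[mu]_y (\esum_(n in [set: int]) (normc (coef n u y) ^+ 2)%:E))%E.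
  apply: ae_eq_integral => //; first exact: measurable_sqn_slice.
    have -> : (fun y : T => (\esum_(n in [set: int]) (normc (coef n u y) ^+ 2)%:E)%E) =
      (fun y : T => (\sum_(k <oo) (normc (coef (Posz k) u y) ^+ 2)%:E +
                     \sum_(k <oo) (normc (coef (Negz k) u y) ^+ 2)%:E)%E).
      by apply/funext => y; apply: esum_int => n; rewrite lee_fin sqr_ge0.
    apply: emeasurable_funD; (apply: ge0_emeasurable_sum => [k y _ _|k _]; first by rewrite lee_fin sqr_ge0);
      by apply/measurable_EFinP; apply: measurable_sqr_normc; exact: cmeas_coef.
  apply: filterS (ae_L2_slice mu_ lu) => y ly _.
  by rewrite -sqn_unwound -fourier_parseval//; exact: L2_unwound.
rewrite E integral_esum_int; first last.
- by move=> n y; rewrite lee_fin sqr_ge0.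
- by move=> n; apply/measurable_EFinP; apply: measurable_sqr_normc; exact: cmeas_coef.
transitivity (\esum_(n in [set: int]) \esum_(m in [set: nat])
    (normc (ip lam2 S u (basis (m, n))) ^+ 2)%:E)%E; last first.
  apply: eq_esum => n _.
  transitivity (sqn mu setT (coef n u)); last by [].
  rewrite -(ph n); last exact: L2_coef.
  by apply: eq_esum => m _; rewrite ip_mode.
rewrite (@esum_esum R int nat setT (fun=> setT)
  (fun n m => (normc (ip lam2 S u (basis (m, n))) ^+ 2)%:E)); last first.
  by move=> n m _ _; rewrite lee_fin sqr_ge0.
apply: (@reindex_esum R _ _ _ _ (fun k : int * nat => (k.2, k.1))).
split=> //.
- by move=> [a b] [c d] _ _ [-> ->].
- by move=> [a b] _; exists (b, a).
Qed.

End StripExpansion.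

(** * The weighted functions psi *)

Section ComplexExponential.
Context {R : realType}.
Local Notation C := R[i].
Implicit Types z w : C.

Lemma cexpE z : cexp z = (expR (complex.Re z))%:C * cis (complex.Im z).
Proof.
by apply/eqP; rewrite eq_complex /=; apply/andP; split; apply/eqP; ring.
Qed.

Lemma cexpD z w : cexp (z + w) = cexp z * cexp w.
Proof.
rewrite !cexpE ReD ImD expRD cisD rmorphM /=; ring.
Qed.

Lemma cexp0 : cexp 0 = 1 :> C.
Proof. by rewrite cexpE /= expR0 cis0 mulr1. Qed.

Lemma normc_cexp z : normc (cexp z) = expR (complex.Re z).
Proof. by rewrite cexpE normcM normc_cis mulr1 normc_real ger0_norm// expR_ge0. Qed.

Lemma cexp_neq0 z : cexp z != 0.
Proof.
apply/eqP => /(congr1 (@normc R)); rewrite normc_cexp normc0 => h.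
by have := expR_gt0 (complex.Re z); rewrite h ltxx.
Qed.

Lemma intrC (m : int) : m%:~R = (m%:~R : R)%:C :> C.
Proof. by rewrite rmorph_int. Qed.

Lemma cexp_2pi_int (m : int) : cexp (2 * 'i%C * pi%:C * m%:~R) = 1 :> C.
Proof.
rewrite intrC (_ : 2 * 'i%C * pi%:C * (m%:~R)%:C = 0 +i* (2 * pi * m%:~R)); last first.
  by apply/eqP; rewrite eq_complex !(ReM, ImM) /=; apply/andP; split; apply/eqP; ring.
by rewrite cexpE /= expR0 mul1r cis_2pi_int.
Qed.

End ComplexExponential.

Section WeightedSpace.
Context {R : realType} (nu alpha : R) (nu0 : 0 < nu).
Local Notation C := R[i].
Local Notation T := (measurableTypeR R).
Local Notation mu := (@lebesgue_measure R).
Local Notation lam2 := (@lebesgue_measure R \x @lebesgue_measure R)%E.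
Local Notation S := (@strip R : set (T * T)).
Implicit Types (f g : C -> C).

(** Multiplication by the square root of [gauss nu], which carries the weighted norm
    to the unweighted one. *)
Definition weighted f (p : T * T) : C :=
  f (of_coords p) * (expR (- (nu / 2 * normc (of_coords p) ^+ 2)))%:C.

Lemma sqr_normc_weighted f p :
  normc (weighted f p) ^+ 2 = normc (f (of_coords p)) ^+ 2 * gauss nu (of_coords p).
Proof.
rewrite normcM normc_real exprMn real_normK ?num_real//; congr (_ * _).
by rewrite /gauss -expRM_natl; congr expR; field.
Qed.

Lemma sqnormE f : sqnorm nu f = sqn lam2 S (weighted f).
Proof. by apply: eq_integral => p _; rewrite sqr_normc_weighted. Qed.

Lemma innerE f g : inner nu f g = ip lam2 S (weighted f) (weighted g).
Proof.
apply: eq_cint => p _; rewrite /weighted conjcM conjc_real.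
have -> : gauss nu (of_coords p) = expR (- (nu / 2 * normc (of_coords p) ^+ 2)) *
    expR (- (nu / 2 * normc (of_coords p) ^+ 2)).
  by rewrite -expRD /gauss; congr expR; field.
by rewrite rmorphM /=; ring.
Qed.

Lemma measurable_sqr_coords :
  measurable_fun [set: T * T] (fun p : T * T => normc (of_coords p) ^+ 2 : R).
Proof.
have -> : (fun p : T * T => normc (of_coords p) ^+ 2) = (fun p : T * T => p.1 ^+ 2 + p.2 ^+ 2).
  by apply/funext => p; rewrite sqr_normcE.
apply: measurable_funD; apply: measurable_funX.
  exact: measurable_fst.
exact: measurable_snd.
Qed.

Lemma cmeas_expR_sqr (c : R) :
  cmeas setT (fun p : T * T => (expR (c * normc (of_coords p) ^+ 2))%:C : C).
Proof.
apply: cmeas_real; apply: measurableT_comp => //; apply: measurable_funM => //.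
exact: measurable_sqr_coords.
Qed.

Lemma cmeas_weighted f : cmeasurable f -> cmeas setT (weighted f).
Proof.
move=> mf; apply: (@cmeasM _ _ _ _ (fun p => f (of_coords p))); first exact: mf.
by have := cmeas_expR_sqr (- (nu / 2)); under eq_fun do rewrite mulNr.
Qed.

Lemma cmeasurable_weighted f : cmeas setT (weighted f) -> cmeasurable f.
Proof.
move=> mf; have := cmeasM mf (cmeas_expR_sqr (nu / 2)).
have -> // : (fun p => weighted f p * (expR (nu / 2 * normc (of_coords p) ^+ 2))%:C) =
  (fun p => f (of_coords p)).
apply/funext => p; rewrite /weighted -mulrA -rmorphM /= -expRD addNr expR0.
by rewrite mulr1.
Qed.

Lemma L2_weighted f : L2space nu alpha f -> L2 lam2 S (weighted f).
Proof.
move=> [mf _ lf]; split; first by apply: cmeas_sub; exact: cmeas_weighted.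
by rewrite -sqnormE.
Qed.

Lemma cmeas_L2space f : L2space nu alpha f -> cmeas setT (weighted f).
Proof. by move=> [mf _ _]; exact: cmeas_weighted. Qed.

Lemma weightedD (c : C) f g :
  weighted (fun z => c * f z + g z) = (fun p => c * weighted f p + weighted g p).
Proof. by apply/funext => p; rewrite /weighted mulrDl mulrA. Qed.

Lemma weightedB f g : weighted (fun z => f z - g z) = (fun p => weighted f p - weighted g p).
Proof. by apply/funext => p; rewrite /weighted mulrBl. Qed.

Lemma lnormE f : L2 lam2 S (weighted f) ->
  lnorm nu f = (Num.sqrt (nq lam2 S (weighted f)))%:E.
Proof. by move=> lf; rewrite /lnorm sqnormE -nqK. Qed.

Lemma lnorm_lt f (eps : R) : 0 < eps -> L2 lam2 S (weighted f) ->
  (lnorm nu f < eps%:E)%E = (nq lam2 S (weighted f) < eps ^+ 2).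
Proof.
move=> e0 lf; rewrite lnormE// lte_fin -[in LHS](gtr0_norm e0) -sqrtr_sqr.
by rewrite ltr_sqrt// exprn_gt0.
Qed.

Lemma ae_lam2_filter : Filter (almost_everywhere lam2).
Proof. exact: (@ae_filter_ringOfSetsType _ _ _ lam2). Qed.

Lemma L2space_lin (c : C) f g : L2space nu alpha f -> L2space nu alpha g ->
  L2space nu alpha (fun z => c * f z + g z).
Proof.
move=> Lf Lg; have [mf ef lf] := Lf; have [mg eg lg] := Lg; split.
- exact: (cmeasD (cmeasZ c (f := fun p => f (of_coords p)) mf) mg).
- apply: (@filterS2 _ _ ae_lam2_filter) ef eg => p hf hg m.
  by rewrite hf hg; ring.
- rewrite sqnormE weightedD.
  have [] // := L2D measurable_strip (L2Z measurable_strip c (L2_weighted Lf)) (L2_weighted Lg).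
Qed.

Lemma L2space0 : L2space nu alpha (fun=> 0).
Proof.
split.
- exact: (@cmeas_cst _ _ _ _ 0).
- by apply: aeW => p m; rewrite mulr0.
- rewrite sqnormE (_ : weighted _ = fun=> 0); last by apply/funext => p; rewrite /weighted mul0r.
  by have [] := @L2_0 _ _ R lam2 S.
Qed.

(** The factor of modulus 1 in [cexp (nu / 2 * z^2 + 2 i pi alpha z)], which is common
    to all the functions [psi]. *)
Definition phase (p : T * T) : C := cis (nu * p.1 * p.2 + 2 * pi * alpha * p.1).

Lemma normc_phase p : normc (phase p) = 1. Proof. exact: normc_cis. Qed.

Lemma cmeas_phase : cmeas setT phase.
Proof.
have m : measurable_fun setT (fun p : T * T => nu * p.1 * p.2 + 2 * pi * alpha * p.1).
  apply: measurable_funD; last by apply: measurable_funM => //; exact: measurable_fst.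
  apply: measurable_funM; last exact: measurable_snd.
  by apply: measurable_funM => //; exact: measurable_fst.
split; rewrite /phase /cis /=; apply: measurableT_comp m.
- by apply: continuous_measurable_fun; exact: continuous_cos.
- by apply: continuous_measurable_fun; exact: continuous_sin.
Qed.

Definition freq : R := Num.sqrt (2 * nu).
Definition center (n : int) : R := Num.sqrt (2 / nu) * pi * (n%:~R + alpha).

Lemma freq_gt0 : 0 < freq. Proof. by rewrite sqrtr_gt0 mulr_gt0. Qed.

Definition hfuns (n : int) (m : nat) : T -> R := hfun freq (center n) m.

Definition weighted_basis : nat * int -> T * T -> C := basis phase hfuns.

(** The argument of the Hermite functions is the one that completes the square in the
    modulus of the weighted functions [psi]. *)
Lemma sqr_affine n y : 1 / 2 * affine freq (center n) y ^+ 2 =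
  nu * y ^+ 2 + 2 * pi * (alpha + n%:~R) * y + pi ^+ 2 / nu * (alpha + n%:~R) ^+ 2.
Proof.
rewrite /affine /center /freq.
have h1 : Num.sqrt (2 * nu) ^+ 2 = 2 * nu by rewrite sqr_sqrtr// mulr_ge0// ltW.
have h2 : Num.sqrt (2 / nu) ^+ 2 = 2 / nu by rewrite sqr_sqrtr// divr_ge0// ltW.
have h3 : Num.sqrt (2 * nu) * Num.sqrt (2 / nu) = 2.
  rewrite -sqrtrM ?mulr_ge0// ?ltW// (_ : 2 * nu * (2 / nu) = 2 ^+ 2); last by field; rewrite gt_eqF.
  by rewrite sqrtr_sqr ger0_norm.
set a := Num.sqrt (2 * nu) in h1 h3 *; set b := Num.sqrt (2 / nu) in h2 h3 *.
have -> : 1 / 2 * (a * y + b * pi * (n%:~R + alpha)) ^+ 2 =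
  1 / 2 * (a ^+ 2) * y ^+ 2 + a * b * pi * (alpha + n%:~R) * y + 1 / 2 * b ^+ 2 * pi ^+ 2 * (alpha + n%:~R) ^+ 2.
  by field.
by rewrite h1 h2 h3; field; rewrite gt_eqF.
Qed.

Lemma psi_coefE m : (2 ^+ m * m`!%:R) `^ (- 2^-1) * (2 * nu / pi) `^ (4^-1) = hnorm freq m :> R.
Proof.
have h2 : 0 < 2 ^+ m * m`!%:R :> R by rewrite mulr_gt0 ?exprn_gt0// ltr0n fact_gt0.
have h3 : 0 < 2 * nu / pi by rewrite divr_gt0 ?mulr_gt0// pi_gt0.
apply/eqP; rewrite -(@eqrXn2 _ 2)//; last 2 first.
- by rewrite mulr_ge0// powR_ge0.
- by rewrite ltW// hnorm_gt0// freq_gt0.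
rewrite sqr_hnorm ?freq_gt0// exprMn -!powR_mulrn ?powR_ge0// -!powRrM.
have -> : - 2^-1 * 2%:R = -1 :> R by field.
have -> : 4^-1 * 2%:R = 2^-1 :> R by field.
rewrite powRN powRr1 ?ltW// powR12_sqrt ?ltW// sqrtrM ?mulr_ge0 ?ltW// sqrtrV ?pi_ge0//.
rewrite /freq; apply/eqP; field.
by rewrite !gt_eqF ?sqrtr_gt0 ?pi_gt0 ?mulr_gt0.
Qed.

(** The real part of the exponent, the constant factor of [psi] and the weight combine
    to [exp (- xi^2 / 2)] by [sqr_affine]; the imaginary part of the exponent gives
    the phase and the Fourier mode. *)
Lemma weighted_psi m n p : weighted (psi nu alpha m n) p = weighted_basis (m, n) p.
Proof.
case: p => x y; rewrite /weighted /psi psi_coefE hermiteE /weighted_basis /basis /mode /hfuns /hfun.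
rewrite -[(x, y).1]/x -[(x, y).2]/y -[(m, n).1]/m -[(m, n).2]/n cexpE.
set E := (nu / 2)%:C * _ + _.
have -> : E = (nu / 2 * (x ^+ 2 - y ^+ 2) - 2 * pi * (alpha + n%:~R) * y) +i*
    ((nu * x * y + 2 * pi * alpha * x) + 2 * pi * n%:~R * x).
  rewrite /E expr2; apply/eqP; rewrite eq_complex /=.
  by apply/andP; split; apply/eqP; field.
rewrite [complex.Re _]/= [complex.Im _]/= cisD /phase /fmode -[(x, y).1]/x -[(x, y).2]/y.
set P := cis (nu * x * y + _); set Q := cis (2 * pi * n%:~R * x).
have -> : complex.Im (of_coords (x, y)) = y by [].
rewrite sqr_normcE [complex.Re _]/= [complex.Im _]/= sqr_affine.
rewrite -/freq -/(center n) -/(affine freq (center n) y).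
set H := (hpoly m).[_]; set k := hnorm _ _.
have -> : expR (- (nu * y ^+ 2 + 2 * pi * (alpha + n%:~R) * y +
   pi ^+ 2 / nu * (alpha + n%:~R) ^+ 2)) = expR (- (pi ^+ 2 / nu) * (alpha + n%:~R) ^+ 2) *
   expR (nu / 2 * (x ^+ 2 - y ^+ 2) - 2 * pi * (alpha + n%:~R) * y) * expR (- (nu / 2 * (x ^+ 2 + y ^+ 2))).
  by rewrite -!expRD; congr expR; field; rewrite gt_eqF.
by rewrite !rmorphM /=; ring.
Qed.

Lemma L2_weighted_basis i : L2 lam2 S (weighted_basis i).
Proof.
by apply: L2_basis; [exact: cmeas_phase|exact: normc_phase|move=> n m; apply: L2_hfun; exact: freq_gt0].
Qed.

Lemma weighted_basis_orthonormal i j : ip lam2 S (weighted_basis i) (weighted_basis j) = (i == j)%:R.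
Proof.
apply: basis_orthonormal.
- exact: cmeas_phase.
- exact: normc_phase.
- by move=> n m; apply: L2_hfun; exact: freq_gt0.
- by move=> n m k; apply: hfun_orthonormal; exact: freq_gt0.
Qed.

Lemma weighted_basis_parseval u : cmeas setT u -> L2 lam2 S u ->
  (\esum_(i in [set: nat * int]) (normc (ip lam2 S u (weighted_basis i)) ^+ 2)%:E = sqn lam2 S u)%E.
Proof.
apply: basis_parseval.
- exact: cmeas_phase.
- exact: normc_phase.
- by move=> n m; apply: L2_hfun; exact: freq_gt0.
- by move=> n v lv; apply: hermite_parseval => //; exact: freq_gt0.
Qed.

Lemma psi_quasiperiodic m n (k : int) z :
  psi nu alpha m n (z + k%:~R) = multiplier nu alpha k z * psi nu alpha m n z.
Proof.
rewrite /psi /multiplier -cexpD.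
have -> : complex.Im (z + k%:~R) = complex.Im z by rewrite ImD intrC addr0.
set A := (_ * _ * _)%:C; set H := (hermite _ _)%:C.
suff -> : cexp ((nu / 2)%:C * (z + k%:~R) ^+ 2 + 2 * 'i%C * pi%:C * (alpha + n%:~R)%:C * (z + k%:~R)) =
  cexp (2 * 'i%C * pi%:C * alpha%:C * k%:~R + nu%:C * (z + k%:~R / 2) * k%:~R) *
  cexp ((nu / 2)%:C * z ^+ 2 + 2 * 'i%C * pi%:C * (alpha + n%:~R)%:C * z) by ring.
have E : (nu / 2)%:C * (z + k%:~R) ^+ 2 + 2 * 'i%C * pi%:C * (alpha + n%:~R)%:C * (z + k%:~R) =
  (2 * 'i%C * pi%:C * alpha%:C * k%:~R + nu%:C * (z + k%:~R / 2) * k%:~R +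
   ((nu / 2)%:C * z ^+ 2 + 2 * 'i%C * pi%:C * (alpha + n%:~R)%:C * z)) +
  2 * 'i%C * pi%:C * (n * k)%:~R :> C.
  have h2 : (nu / 2)%:C = nu%:C / 2 :> C by rewrite rmorphM fmorphV rmorph_nat.
  have h3 : (alpha + n%:~R)%:C = alpha%:C + n%:~R :> C by rewrite rmorphD rmorph_int.
  by rewrite h2 h3 intrM; field.
by rewrite E -cexpD [LHS]cexpD cexp_2pi_int mulr1.
Qed.

Lemma psi_L2space m n : L2space nu alpha (psi nu alpha m n).
Proof.
have E : weighted (psi nu alpha m n) = weighted_basis (m, n) by apply/funext => p; exact: weighted_psi.
split.
- apply: cmeasurable_weighted; rewrite E; apply: cmeas_basis; first exact: cmeas_phase.
  by move=> k j; apply: L2_hfun; exact: freq_gt0.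
- by apply: aeW => p k; exact: psi_quasiperiodic.
- by rewrite sqnormE E; have [] := L2_weighted_basis (m, n).
Qed.

End WeightedSpace.

(** * Complex differentiability *)

Section ComplexDerivative.
Context {R : realType}.
Local Notation C := R[i].
Implicit Types (f g : C -> C) (z w h : C).

(** Complex differentiability in terms of real bounds, the form used for the bisection
    argument and for the differentiation of series. *)
Definition cderiv f z (c : C) : Prop := forall eps : R, 0 < eps ->
  exists2 del : R, 0 < del & forall h, normc h < del ->
    normc (f (z + h) - f z - c * h) <= eps * normc h.

Lemma normC_normc z : `|z| = (normc z)%:C. Proof. by []. Qed.

Lemma posC (e : C) : 0 < e -> exists2 r : R, 0 < r & e = r%:C.
Proof.
by case: e => a b; rewrite ltcE /= => /andP[/eqP -> a0]; exists a.
Qed.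

Lemma derivable_cderiv f z : derivable (f : C^o -> C^o) z 1 <-> exists c, cderiv f z c.
Proof.
split.
- move=> /cvg_ex[/= c]; rewrite /= => /cvgrPdist_lt H; exists c => eps eps0.
  have e0 : 0 < eps%:C :> C by rewrite ltcR.
  have := H _ e0; rewrite /= /dnbhs /within /= nearE => /nbhs_ballP[/= d /posC[del del0 ->] Hd].
  exists del => // h hdel.
  have [->|h0] := eqVneq h 0; first by rewrite addr0 subrr mulr0 subrr normc0 mulr0.
  have := Hd h; rewrite /ball /= sub0r normrN normC_normc ltcR => /(_ hdel h0).
  rewrite normC_normc ltcR /GRing.scale /= mulr1 => /ltW hle.
  have hn : 0 < normc h.
    by rewrite lt_neqAle normc_ge0 andbT eq_sym; apply/eqP => /eq0_normc/eqP; exact/negP.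
  have -> : f (z + h) - f z - c * h = - (h * (c - h^-1 * (f (h + z) - f z))).
    by rewrite (addrC h z); field.
  by rewrite normcN normcM mulrC ler_wpM2r// normc_ge0.
- move=> [c Hc]; apply/cvg_ex; exists c; apply/cvgrPdist_le => e /posC[eps eps0 ->].
  have [del del0 Hd] := Hc _ eps0.
  rewrite /= /dnbhs /within /= nearE; apply/nbhs_ballP; exists del%:C => /=; first by rewrite ltcR.
  move=> h; rewrite /ball /= sub0r normrN normC_normc ltcR => hdel h0.
  rewrite normC_normc lecR /GRing.scale /= mulr1.
  have hn : 0 < normc h.
    by rewrite lt_neqAle normc_ge0 andbT eq_sym; apply/eqP => /eq0_normc/eqP; exact/negP.
  have -> : c - h^-1 * (f (h + z) - f z) = - (h^-1 * (f (z + h) - f z - c * h)).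
    by rewrite (addrC h z); field.
  by rewrite normcN normcM normcV mulrC ler_pdivrMr// Hd.
Qed.

Definition ccont f z : Prop := forall eps : R, 0 < eps ->
  exists2 del : R, 0 < del & forall h, normc h < del -> normc (f (z + h) - f z) < eps.

Lemma cderiv_bound f z c : cderiv f z c -> exists2 del : R, 0 < del &
  forall h, normc h < del -> normc (f (z + h) - f z) <= (normc c + 1) * normc h.
Proof.
move=> /(_ _ ltr01)[del del0 H]; exists del => // h /H hh.
rewrite -[f (z + h) - f z](subrK (c * h)) (le_trans (le_normcD _ _))//.
by rewrite normcM; lra.
Qed.

Lemma cderiv_ccont f z c : cderiv f z c -> ccont f z.
Proof.
move=> /cderiv_bound[del del0 H] eps eps0.
have c0 : 0 < normc c + 1 by rewrite ltr_wpDl// normc_ge0.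
exists (Num.min del (eps / (normc c + 1))); first by rewrite lt_min del0 divr_gt0.
move=> h; rewrite lt_min => /andP[/H hd he]; apply: (le_lt_trans hd).
by rewrite mulrC -ltr_pdivlMr.
Qed.

Lemma ccont_line f (x0 dx : C) : (forall z, ccont f z) -> normc dx = 1 ->
  continuous (fun t : R => complex.Re (f (x0 + t%:C * dx))) /\
  continuous (fun t : R => complex.Im (f (x0 + t%:C * dx))).
Proof.
move=> Hf d1; split => t; apply/cvgrPdist_lt => eps eps0;
  have [del del0 Hd] := Hf (x0 + t%:C * dx) _ eps0;
  near=> s;
  (have hs : normc ((s - t)%:C * dx) < del
    by rewrite normcM d1 mulr1 normc_real distrC; near: s; exact: cvgr_dist_lt);
  have := Hd _ hs;
  (have -> : x0 + t%:C * dx + (s - t)%:C * dx = x0 + s%:C * dx by rewrite rmorphB /=; ring);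
  apply: le_lt_trans; rewrite distrC -?ReN -?ImN -?ReD -?ImD.
- exact: normc_ge_Re.
- exact: normc_ge_Im.
Unshelve. all: by end_near. Qed.

End ComplexDerivative.

(** * The theorem of Goursat for rectangles *)

Section Goursat.
Context {R : realType}.
Local Notation C := R[i].
Local Notation mu := (@lebesgue_measure R).

Lemma nested_intervals (u v : nat -> R) : (forall n, u n <= u n.+1) ->
  (forall n, v n.+1 <= v n) -> (forall n, u n <= v n) ->
  exists x, forall n, u n <= x <= v n.
Proof.
move=> hu hv uv.
have um m n : (m <= n)%N -> u m <= u n.
  by move=> mn; have /nondecreasing_seqP := hu; apply.
have vm m n : (m <= n)%N -> v n <= v m.
  by move=> mn; have /nonincreasing_seqP := hv; apply.
have ub m n : u m <= v n.
  have [mn|nm] := leqP m n; first exact: (le_trans (um _ _ mn)).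
  by apply: (le_trans (uv m)); apply: vm; exact: ltnW.
exists (sup (range u)) => n; apply/andP; split.
- by apply: ub_le_sup; [exists (v 0%N) => _ [m _ <-]|exists n].
- by apply: ge_sup; [exists (u 0%N), 0%N|move=> _ [m _ <-]].
Qed.

(** The argument of Goursat, for any additive function [Phi x y s] of the rectangles
    of sides [s] and [rho s]: one of the quarters keeps at least a quarter of the modulus, and
    the nested rectangles shrink to a point around which [Phi] would not be small
    compared to the area. *)
Lemma bisection (rho : R) (Phi : R -> R -> R -> C) : 0 < rho ->
  (forall x y s, 0 < s -> Phi x y (s + s) = Phi x y s + Phi (x + s) y s +
     (Phi x (y + rho * s) s + Phi (x + s) (y + rho * s) s)) ->
  (forall a b (eps : R), 0 < eps -> exists2 del : R, 0 < del & forall x y s,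
     0 < s < del -> x <= a <= x + s -> y <= b <= y + rho * s ->
     normc (Phi x y s) <= eps * s ^+ 2) ->
  forall x y s, 0 < s -> Phi x y s = 0.
Proof.
move=> rho0 Hadd Hloc x y s s0; apply: eq0_normc.
apply/eqP; rewrite eq_le normc_ge0 andbT leNgt; apply/negP => N0.
have step (n : nat) (p : R * R) : exists q : R * R,
    [/\ p.1 <= q.1 <= p.1 + s / 2 ^+ n.+1, p.2 <= q.2 <= p.2 + rho * (s / 2 ^+ n.+1) &
     normc (Phi p.1 p.2 (s / 2 ^+ n)) <= 4 * normc (Phi q.1 q.2 (s / 2 ^+ n.+1))].
  set t := s / 2 ^+ n.+1.
  have t0 : 0 < t by rewrite divr_gt0// exprn_gt0.
  have rt0 : 0 < rho * t by rewrite mulr_gt0.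
  have -> : s / 2 ^+ n = t + t by rewrite /t exprS; field; rewrite expf_neq0.
  rewrite Hadd//.
  set A := Phi _ _ _; set B := Phi (_ + _) p.2 _; set A' := Phi p.1 _ _; set B' := Phi _ _ _.
  have [hA|hA] := leP (normc (A + B + (A' + B'))) (4 * normc A).
    by exists p; rewrite !lexx !lerDl (ltW t0) (ltW rt0).
  have [hB|hB] := leP (normc (A + B + (A' + B'))) (4 * normc B).
    by exists (p.1 + t, p.2); rewrite /= !lexx !lerDl (ltW t0) (ltW rt0).
  have [hA'|hA'] := leP (normc (A + B + (A' + B'))) (4 * normc A').
    by exists (p.1, p.2 + rho * t); rewrite /= !lexx !lerDl (ltW t0) (ltW rt0).
  exists (p.1 + t, p.2 + rho * t); rewrite /= !lexx !lerDl (ltW t0) (ltW rt0); split => //.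
  have := le_normcD (A + B) (A' + B'); have := le_normcD A B; have := le_normcD A' B'.
  rewrite -/B'; lra.
have /choice[F HF] : forall np : nat * (R * R), exists q : R * R,
    [/\ np.2.1 <= q.1 <= np.2.1 + s / 2 ^+ np.1.+1, np.2.2 <= q.2 <= np.2.2 + rho * (s / 2 ^+ np.1.+1) &
     normc (Phi np.2.1 np.2.2 (s / 2 ^+ np.1)) <= 4 * normc (Phi q.1 q.2 (s / 2 ^+ np.1.+1))].
  by move=> [n p]; exact: step.
pose P := fix P n := if n is k.+1 then F (k, P k) else (x, y).
have half n : s / 2 ^+ n = s / 2 ^+ n.+1 + s / 2 ^+ n.+1.
  by rewrite exprS; field; rewrite expf_neq0.
have t0 n : 0 < s / 2 ^+ n by rewrite divr_gt0// exprn_gt0.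
have [n|n|n|a Ha] := @nested_intervals (fun n => (P n).1) (fun n => (P n).1 + s / 2 ^+ n).
- by have [/= /andP[]] := HF (n, P n).
- by have [/= /andP[_ h]] := HF (n, P n) => _ _; rewrite (half n) addrA lerD2r.
- by rewrite lerDl ltW.
have [n|n|n|b Hb] := @nested_intervals (fun n => (P n).2) (fun n => (P n).2 + rho * (s / 2 ^+ n)).
- by have [_ /= /andP[]] := HF (n, P n).
- by have [_ /= /andP[_ h]] := HF (n, P n) => _; rewrite [X in _ <= _ + rho * X](half n) mulrDr addrA lerD2r.
- by rewrite lerDl mulr_ge0// ltW.
pose N := normc (Phi x y s).
have grow n : N <= 4 ^+ n * normc (Phi (P n).1 (P n).2 (s / 2 ^+ n)).
  elim: n => [|n ih]; first by rewrite !expr0 mul1r divr1.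
  apply: (le_trans ih); rewrite exprSr -mulrA ler_wpM2l ?exprn_ge0//.
  by have [] := HF (n, P n).
have e0 : 0 < N / 2 / s ^+ 2 by rewrite !divr_gt0// exprn_gt0.
have [del del0 Hd] := Hloc a b _ e0.
have [n sn] : exists n, s / 2 ^+ n < del.
  have cv : s * (2^-1) ^+ n @[n --> \oo] --> (0 : R).
    rewrite -[X in _ --> X](mulr0 s); apply: cvgMr; apply: cvg_expr.
    by rewrite ger0_norm ?invr_ge0// invf_lt1 ?ltr1n.
  have [n _ /(_ n (leqnn n))] := cvgr_lt (0 : R) cv _ del0.
  by rewrite /= exprVn => h; exists n.
have := Hd (P n).1 (P n).2 (s / 2 ^+ n); rewrite t0 sn => /(_ isT (Ha n) (Hb n)) hn.
have := grow n; rewrite leNgt => /negP; apply.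
apply: (@le_lt_trans _ _ (4 ^+ n * (N / 2 / s ^+ 2 * (s / 2 ^+ n) ^+ 2))).
  by rewrite ler_wpM2l// exprn_ge0.
have -> : 4 ^+ n * (N / 2 / s ^+ 2 * (s / 2 ^+ n) ^+ 2) = N / 2.
  have -> : 4 ^+ n = (2 ^+ n) ^+ 2 :> R by rewrite -exprM mulnC exprM; congr (_ ^+ n); ring.
  by field; rewrite expf_neq0//= gt_eqF.
by rewrite ltr_pdivrMr// ltr_pMr// ltr1n.
Qed.

Definition segint (f : R -> C) (a b : R) : C := cint mu `[a, b]%classic f.

Definition ccontinuous (f : R -> C) : Prop :=
  continuous (fun t => complex.Re (f t)) /\ continuous (fun t => complex.Im (f t)).

Lemma ccontinuous_integrable f a b : ccontinuous f -> cintegrable mu `[a, b]%classic f.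
Proof. by move=> [f1 f2]; split; exact: continuous_integrable_itv. Qed.

Lemma ccontinuous_cmeas f (D : set (measurableTypeR R)) : ccontinuous f -> cmeas D f.
Proof.
by move=> [f1 f2]; split; apply: measurable_funTS; exact: continuous_measurable_fun.
Qed.

Let Rintegral_cat (f : R -> R) (a b c : R) : a <= b -> b <= c -> continuous f ->
  \int[mu]_(x in `[a, c]) f x = \int[mu]_(x in `[a, b]) f x + \int[mu]_(x in `[b, c]) f x.
Proof.
move=> ab bc cf.
have i1 := @continuous_integrable_itv R f a c cf.
have := @Rintegral_itvB R f (BLeft a) (BRight c) b i1.
rewrite !bnd_simp => /(_ ab bc) h.
rewrite -[LHS](subrK (\int[mu]_(x in `[a, b]) f x)) h addrC; congr (_ + _).
rewrite Rintegral_itv_obnd_cbnd//.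
apply: integrableS (@continuous_integrable_itv R f b c cf) => //.
exact: subset_itv_oc_cc.
Qed.

Lemma segint_cat f a b c : a <= b -> b <= c -> ccontinuous f ->
  segint f a c = segint f a b + segint f b c.
Proof.
move=> ab bc [f1 f2]; rewrite /segint /cint (Rintegral_cat ab bc f1) (Rintegral_cat ab bc f2).
by [].
Qed.

Lemma normc_segint_le f a b (M : R) : a <= b -> ccontinuous f ->
  (forall t, a <= t <= b -> normc (f t) <= M) -> normc (segint f a b) <= 2 * (M * (b - a)).
Proof.
move=> ab cf fM.
have mab : measurable (`[a, b]%classic : set (measurableTypeR R)) by exact: measurable_itv.
have := @normc_cint_le _ _ _ mu _ mab f (fun=> M) (ccontinuous_cmeas _ cf).
rewrite Rintegral_cst//= lebesgue_measure_itv/= lte_fin.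
have -> : fine (if a < b then (b%:E - a%:E)%E else 0%E) = b - a.
  by case: ltgtP ab => // -> _; rewrite subrr.
apply; first by apply: continuous_integrable_itv; exact: cst_continuous.
by move=> t; rewrite /= in_itv /=; exact: fM.
Qed.

Lemma segintD f g a b : ccontinuous f -> ccontinuous g ->
  segint (fun t => f t + g t) a b = segint f a b + segint g a b.
Proof. by move=> cf cg; apply: cintD => //; exact: ccontinuous_integrable. Qed.

Lemma ccontinuousB f g : ccontinuous f -> ccontinuous g -> ccontinuous (fun t => f t - g t).
Proof.
move=> [f1 f2] [g1 g2]; split.
- have -> : (fun t => complex.Re (f t - g t)) = (fun t => complex.Re (f t) - complex.Re (g t)).
    by apply/funext => t; rewrite ReD ReN.
  by move=> t; apply: cvgB; [exact: f1|exact: g1].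
- have -> : (fun t => complex.Im (f t - g t)) = (fun t => complex.Im (f t) - complex.Im (g t)).
    by apply/funext => t; rewrite ImD ImN.
  by move=> t; apply: cvgB; [exact: f2|exact: g2].
Qed.

Lemma ccontinuous_lin (A B : C) : ccontinuous (fun t => A + t%:C * B).
Proof.
split.
- have -> : (fun t => complex.Re (A + t%:C * B)) = (fun t => complex.Re A + t * complex.Re B).
    by apply/funext => t; rewrite ReD ReM /= mul0r subr0.
  by move=> t; apply: cvgD; [exact: cvg_cst|apply: cvgM; [exact: cvg_id|exact: cvg_cst]].
- have -> : (fun t => complex.Im (A + t%:C * B)) = (fun t => complex.Im A + t * complex.Im B).
    by apply/funext => t; rewrite ImD ImM /= mul0r addr0.
  by move=> t; apply: cvgD; [exact: cvg_cst|apply: cvgM; [exact: cvg_id|exact: cvg_cst]].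
Qed.

Let Rint_lin (a b p q : R) : a < b ->
  \int[mu]_(t in `[a, b]) (p + t * q) = p * (b - a) + q * (b ^+ 2 - a ^+ 2) / 2.
Proof.
move=> ab.
have d (x : R) : is_derive x (1 : R) (fun t : R => ((q / 2) *: 'X^2 + p *: 'X).[t]) (p + x * q).
  have := is_derive_horner ((q / 2) *: 'X^2 + p *: 'X) x; congr is_derive.
  by rewrite derivD !derivZ derivXn derivX !(hornerD, hornerZ, hornerMn, hornerX, hornerXn, hornerC) expr1; field.
have c : continuous (fun t : R => p + t * q).
  by move=> t; apply: cvgD; [exact: cvg_cst|apply: cvgM; [exact: cvg_id|exact: cvg_cst]].
by rewrite (Rintegral_FTC ab c d) !(hornerD, hornerZ, hornerX, hornerXn); field.
Qed.

Lemma segint_lin (A B : C) a b : a < b ->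
  segint (fun t => A + t%:C * B) a b = (b - a)%:C * A + ((b ^+ 2 - a ^+ 2) / 2)%:C * B.
Proof.
move=> ab; rewrite /segint /cint.
have -> : (fun t => complex.Re (A + t%:C * B)) = (fun t => complex.Re A + t * complex.Re B).
  by apply/funext => t; rewrite ReD ReM /= mul0r subr0.
have -> : (fun t => complex.Im (A + t%:C * B)) = (fun t => complex.Im A + t * complex.Im B).
  by apply/funext => t; rewrite ImD ImM /= mul0r addr0.
rewrite !Rint_lin//; apply/eqP; rewrite eq_complex !(ReD, ImD, ReM, ImM) /=.
by apply/andP; split; apply/eqP; field.
Qed.

(** The integral of [f] along the boundary of the rectangle of sides [s] and [t] with
    lower left corner [(x, y)]. All four sides are written [z1 + u dz], so that one
    computation handles them. *)
Definition rectint (f : C -> C) (x y s t : R) : C :=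
  segint (fun u => f ((0 +i* y) + u%:C * 1)) x (x + s)
  - segint (fun u => f ((0 +i* (y + t)) + u%:C * 1)) x (x + s)
  + 'i%C * (segint (fun u => f ((x + s)%:C + u%:C * 'i%C)) y (y + t)
            - segint (fun u => f (x%:C + u%:C * 'i%C)) y (y + t)).

Section RectangleIntegral.
Context (f : C -> C) (Df : forall z, exists c, cderiv f z c).

Let contf z : ccont f z.
Proof. by have [c hc] := Df z; exact: cderiv_ccont hc. Qed.

Let hcont y : ccontinuous (fun u => f ((0 +i* y) + u%:C * 1)).
Proof. by have [] := ccont_line (0 +i* y) contf (normc1 R). Qed.

Let normci : normc ('i%C : C) = 1.
Proof. by rewrite /normc /= expr0n expr1n add0r sqrtr1. Qed.

Let vcont x : ccontinuous (fun u => f (x%:C + u%:C * 'i%C)).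
Proof. by have [] := ccont_line x%:C contf normci. Qed.

Lemma rectint_add x y s t : 0 < s -> 0 < t ->
  rectint f x y (s + s) (t + t) = rectint f x y s t + rectint f (x + s) y s t +
    (rectint f x (y + t) s t + rectint f (x + s) (y + t) s t).
Proof.
move=> s0 t0; rewrite /rectint.
have x1 : x <= x + s by rewrite lerDl ltW.
have x2 : x + s <= x + s + s by rewrite lerDl ltW.
have y1 : y <= y + t by rewrite lerDl ltW.
have y2 : y + t <= y + t + t by rewrite lerDl ltW.
rewrite (addrA x s s) (addrA y t t).
rewrite (segint_cat x1 x2 (hcont y)) (segint_cat x1 x2 (hcont (y + t + t))).
rewrite (segint_cat y1 y2 (vcont x)) (segint_cat y1 y2 (vcont (x + s + s))).
by do 12?[move: (segint _ _ _) => ?]; ring.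
Qed.

(** The affine part of [f] at [z0] contributes 0, and the remainder is small compared
    to the diameter of the rectangle. *)
Lemma rectint_local (z0 : C) (eps rho : R) : 0 < eps -> 0 < rho ->
  exists2 del : R, 0 < del & forall x y s, 0 < s < del ->
    x <= complex.Re z0 <= x + s -> y <= complex.Im z0 <= y + rho * s ->
    normc (rectint f x y s (rho * s)) <= eps * s ^+ 2.
Proof.
move=> eps0 rho0; have [c Hc] := Df z0.
pose K : R := 1 + rho; have K0 : 0 < K by rewrite addr_gt0.
pose e1 := eps / (4 * K ^+ 2).
have e10 : 0 < e1 by rewrite divr_gt0// mulr_gt0// exprn_gt0.
have [del del0 Hd] := Hc _ e10.
exists (del / K); first by rewrite divr_gt0.
move=> x y s /andP[s0 sdel] /andP[xa xb] /andP[yc yd].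
have Ks : K * s < del by rewrite mulrC -ltr_pdivlMr.
pose A := f z0 - c * z0.
pose r z := f z - (A + c * z).
have rb z : x <= complex.Re z <= x + s -> y <= complex.Im z <= y + rho * s ->
    normc (r z) <= e1 * (K * s).
  move=> /andP[h1 h2] /andP[h3 h4].
  have hn : normc (z - z0) <= K * s.
    apply: (le_trans (normc_le_ReIm _)); rewrite ReD ImD ReN ImN /K mulrDl mul1r.
    by apply: lerD; apply/ler_normlP; split; lra.
  have := Hd (z - z0) (le_lt_trans hn Ks).
  have -> : z0 + (z - z0) = z by ring.
  have -> : f z - f z0 - c * (z - z0) = r z by rewrite /r /A; ring.
  by move=> h; apply: (le_trans h); rewrite ler_wpM2l// ltW.
have rs0 : 0 < rho * s by rewrite mulr_gt0.
have xs : x < x + s by rewrite ltrDl.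
have ys : y < y + rho * s by rewrite ltrDl.
(* on each side, the affine part is integrated exactly and the remainder is kept *)
have side (z1 dz : C) a b : a < b ->
    ccontinuous (fun u => f (z1 + u%:C * dz)) ->
    ccontinuous (fun u => r (z1 + u%:C * dz)) /\
    segint (fun u => f (z1 + u%:C * dz)) a b =
      (b - a)%:C * (A + c * z1) + ((b ^+ 2 - a ^+ 2) / 2)%:C * (c * dz) +
      segint (fun u => r (z1 + u%:C * dz)) a b.
  move=> ab cf.
  have clspan := ccontinuous_lin (A + c * z1) (c * dz).
  have cr : ccontinuous (fun u => r (z1 + u%:C * dz)).
    have E u : r (z1 + u%:C * dz) = f (z1 + u%:C * dz) - (A + c * z1 + u%:C * (c * dz)).
      by rewrite /r; ring.
    have -> : (fun u => r (z1 + u%:C * dz)) =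
        (fun u => f (z1 + u%:C * dz) - (A + c * z1 + u%:C * (c * dz))) by exact/funext.
    exact: ccontinuousB.
  split=> //; rewrite -segint_lin// -segintD//; congr segint; apply/funext => u.
  by rewrite /r; ring.
rewrite /rectint.
have [cr1 ->] := side _ _ _ _ xs (hcont y).
have [cr2 ->] := side _ _ _ _ xs (hcont (y + rho * s)).
have [cr3 ->] := side _ _ _ _ ys (vcont (x + s)).
have [cr4 ->] := side _ _ _ _ ys (vcont x).
set i1 := segint _ _ _; set i2 := segint _ _ _; set i3 := segint _ _ _; set i4 := segint _ _ _.
have b1 : normc i1 <= 2 * (e1 * (K * s) * (x + s - x)).
  apply: normc_segint_le => //; first exact: ltW.
  move=> u hu; apply: rb; rewrite !(ReD, ImD, ReM, ImM) /= !(mul0r, mulr0, mulr1, add0r, addr0, subr0)//.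
  by rewrite lexx ltW.
have b2 : normc i2 <= 2 * (e1 * (K * s) * (x + s - x)).
  apply: normc_segint_le => //; first exact: ltW.
  move=> u hu; apply: rb; rewrite !(ReD, ImD, ReM, ImM) /= !(mul0r, mulr0, mulr1, add0r, addr0, subr0)//.
  by rewrite lexx ltW.
have b3 : normc i3 <= 2 * (e1 * (K * s) * (y + rho * s - y)).
  apply: normc_segint_le => //; first exact: ltW.
  move=> u hu; apply: rb; rewrite !(ReD, ImD, ReM, ImM) /= !(mul0r, mulr0, mulr1, add0r, addr0, subr0)//.
  by rewrite lexx ltW.
have b4 : normc i4 <= 2 * (e1 * (K * s) * (y + rho * s - y)).
  apply: normc_segint_le => //; first exact: ltW.
  move=> u hu; apply: rb; rewrite !(ReD, ImD, ReM, ImM) /= !(mul0r, mulr0, mulr1, add0r, addr0, subr0)//.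
  by rewrite lexx ltW.
have -> : (0 +i* (y + rho * s)) = (0 +i* y) + (rho * s)%:C * 'i%C :> C.
  by apply/eqP; rewrite eq_complex /=; apply/andP; split; apply/eqP; ring.
have key (I X S T Y q q' j1 j2 j3 j4 : C) :
   S * (A + c * Y) + q * (c * 1) + j1 - (S * (A + c * (Y + T * I)) + q * (c * 1) + j2) +
   I * (T * (A + c * (X + S)) + q' * (c * I) + j3 - (T * (A + c * X) + q' * (c * I) + j4)) =
   j1 - j2 + I * (j3 - j4) by ring.
have ex : x + s - x = s by ring.
have ey : y + rho * s - y = rho * s by ring.
rewrite ex ey (rmorphD _ x s) key.
have k1 := le_normcD (i1 - i2) ('i%C * (i3 - i4)).
have k2 := le_normcD i1 (- i2); have k3 := le_normcD i3 (- i4).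
rewrite normcM normci mul1r in k1; rewrite !normcN in k2 k3.
apply: (le_trans k1).
have -> : eps * s ^+ 2 = 4 * (e1 * (K * s) * (K * s)).
  by rewrite /e1; field; rewrite gt_eqF.
have -> : 4 * (e1 * (K * s) * (K * s)) =
   2 * (e1 * (K * s) * s) + 2 * (e1 * (K * s) * s) +
   (2 * (e1 * (K * s) * (rho * s)) + 2 * (e1 * (K * s) * (rho * s))).
  by rewrite /K; ring.
rewrite ex in b1 b2; rewrite ey in b3 b4.
exact: (lerD (le_trans k2 (lerD b1 b2)) (le_trans k3 (lerD b3 b4))).
Qed.

Theorem goursat x y s t : 0 < s -> 0 < t -> rectint f x y s t = 0.
Proof.
move=> s0 t0; pose rho := t / s; have rho0 : 0 < rho by rewrite divr_gt0.
have -> : t = rho * s by rewrite /rho divfK// gt_eqF.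
apply: (@bisection rho (fun x y s => rectint f x y s (rho * s))) => //.
- by move=> x' y' s' s'0 /=; rewrite [rho * (s' + s')]mulrDr rectint_add// mulr_gt0.
- by move=> a b eps eps0; exact: (@rectint_local (a +i* b)).
Qed.

(** On the rectangle between the heights [y1] and [y2], the integrals along the two
    vertical sides cancel by periodicity. *)
Lemma periodic_segint_const : (forall z, f (z + 1) = f z) -> forall y1 y2,
  segint (fun u => f (u +i* y1)) 0 1 = segint (fun u => f (u +i* y2)) 0 1.
Proof.
move=> pf; suff H y1 y2 : y1 < y2 ->
    segint (fun u => f (u +i* y1)) 0 1 = segint (fun u => f (u +i* y2)) 0 1.
  move=> y1 y2; case: (ltgtP y1 y2) => [/H//|/H//|->//].
move=> y12; have := @goursat 0 y1 1 (y2 - y1) ltr01; rewrite subr_gt0 => /(_ y12).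
have ey : y1 + (y2 - y1) = y2 by ring.
rewrite /rectint (add0r 1) ey.
have E (y : R) : (fun u => f (0 +i* y + u%:C * 1)) = (fun u => f (u +i* y)).
  apply/funext => u; congr f; apply/eqP.
  by rewrite eq_complex /= !(mul0r, mulr0, mulr1, add0r, addr0, subr0) !eqxx.
have -> : (fun u => f (1%:C + u%:C * 'i%C)) = (fun u => f (0%:C + u%:C * 'i%C)).
  by apply/funext => u; rewrite (addrC 1%:C) pf rmorph0 add0r.
by rewrite subrr mulr0 addr0 !E => /eqP; rewrite subr_eq0 => /eqP.
Qed.

End RectangleIntegral.
End Goursat.

(** * Continuous functions and the complex exponential *)

Section MeasurabilityOfContinuous.
Context {R : realType}.
Local Notation C := R[i].
Local Notation T := (measurableTypeR R).

Let grid (n : nat) (x : R) : R := (Num.floor (x * n.+1%:R))%:~R / n.+1%:R.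

Let grid_near n x : `|grid n x - x| <= n.+1%:R^-1.
Proof.
have n0 : 0 < n.+1%:R :> R by rewrite ltr0n.
have /andP[h1 h2] := floor_itv (x * n.+1%:R).
have -> : grid n x - x = ((Num.floor (x * n.+1%:R))%:~R - x * n.+1%:R) * n.+1%:R^-1.
  by rewrite /grid; field; rewrite gt_eqF.
rewrite normrM (ger0_norm (ltW (_ : 0 < n.+1%:R^-1))) ?invr_gt0//.
apply: ler_piMl; first by rewrite invr_ge0 ltW.
by apply/ler_normlP; rewrite intrD in h2; split; lra.
Qed.

(** Freezing the first variable on a grid of mesh [1 / (n + 1)] gives functions that
    are measurable on each of countably many vertical bands, and which converge to
    [u] by continuity. *)
Lemma measurable_of_continuous2 (u : T * T -> R) :
  (forall p (eps : R), 0 < eps -> exists2 del : R, 0 < del & forall q : T * T,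
     `|q.1 - p.1| < del -> `|q.2 - p.2| < del -> `|u q - u p| < eps) ->
  measurable_fun [set: T * T] u.
Proof.
move=> cu; pose h (n : nat) (p : T * T) : R := u (grid n p.1, p.2).
apply: (@measurable_fun_cvg _ _ _ _ h) => [n|p _].
- pose E (k : int) : set (T * T) := [set p | Num.floor (p.1 * n.+1%:R) = k].
  have mE k : measurable (E k).
    have mm : measurable_fun [set: T * T] (fun p : T * T => p.1 * n.+1%:R : R).
      by apply: measurable_funM => //; exact: measurable_fst.
    have -> : E k = (fun p : T * T => p.1 * n.+1%:R : R) @^-1` `[k%:~R, (k + 1)%:~R[%classic.
      by apply/seteqP; split=> p /=; rewrite in_itv/= /E/=; [move/eqP|move=> ?; apply/eqP]; rewrite floor_eq.
    by rewrite -[X in measurable X]setTI; apply: mm => //; exact: measurable_itv.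
  have -> : [set: T * T] = \bigcup_(j in [set: nat]) (oapp E set0 (choice.unpickle j)).
    apply/seteqP; split=> [p _|p _]; last exact: I.
    exists (choice.pickle (Num.floor (p.1 * n.+1%:R))); first exact: I.
    rewrite choice.pickleK; exact: erefl.
  apply/measurable_fun_bigcup => j; first by case: (choice.unpickle j) => [k|]; [exact: mE|exact: measurable0].
  case: (choice.unpickle j) => [k|]; last exact: measurable_fun_set0.
  apply: (@eq_measurable_fun _ _ _ _ _ (fun p : T * T => u (k%:~R / n.+1%:R, p.2))).
    by move=> p; rewrite inE /E /= /h /grid => ->.
  apply: measurable_funTS.
  apply: (@measurableT_comp _ _ _ _ _ _ (fun y : T => u (k%:~R / n.+1%:R, y))); last exact: measurable_snd.
  apply: continuous_measurable_fun => y; apply/cvgrPdist_lt => eps eps0.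
  have [del del0 Hd] := cu (k%:~R / n.+1%:R, y) _ eps0.
  near=> y'; rewrite distrC; apply: Hd; first by rewrite subrr normr0.
  by rewrite distrC; near: y'; exact: cvgr_dist_lt.
- apply/cvgrPdist_lt => eps eps0; have [del del0 Hd] := cu p _ eps0.
  near=> n; rewrite distrC; apply: Hd => /=; last by rewrite subrr normr0.
  apply: (le_lt_trans (grid_near _ _)); near: n.
  exact: (near_infty_natSinv_lt (PosNum del0)).
Unshelve. all: by end_near. Qed.

Lemma cmeasurable_ccont (f : C -> C) : (forall z, ccont f z) -> cmeasurable f.
Proof.
move=> cf; split; apply: measurable_of_continuous2 => p eps eps0;
  have [del del0 Hd] := cf (of_coords p) _ eps0;
  (exists (del / 2); first by rewrite divr_gt0);
  move=> q h1 h2;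
  (have hn : normc ((q.1 - p.1) +i* (q.2 - p.2)) < del
    by apply: (le_lt_trans (normc_le_ReIm _)); rewrite /=; lra);
  have := Hd _ hn;
  (have -> : of_coords p + ((q.1 - p.1) +i* (q.2 - p.2)) = of_coords q
    by apply/eqP; rewrite eq_complex /=; apply/andP; split; apply/eqP; ring);
  apply: le_lt_trans.
- by rewrite -ReN -ReD; exact: normc_ge_Re.
- by rewrite -ImN -ImD; exact: normc_ge_Im.
Qed.

End MeasurabilityOfContinuous.

Section ExponentialDerivative.
Context {R : realType}.
Local Notation C := R[i].

Lemma expR_sub1_le (a : R) : `|expR a - 1| <= `|a| * expR `|a|.
Proof.
have h1 := expR_ge1Dx a; have h2 := expR_ge1Dx (- a).
have e0 := expR_gt0 a; have e1 : expR a * expR (- a) = 1 by rewrite -expRD subrr expR0.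
have h3 : expR a - 1 <= a * expR a by have := ler_wpM2l (ltW e0) h2; rewrite e1; lra.
have [a0|a0] := leP 0 a.
  by rewrite (ger0_norm a0) ger0_norm; lra.
have m1 : expR 0 <= expR (- a) by rewrite ler_expR; lra.
rewrite expR0 in m1; have := ler_wpM2l (_ : 0 <= - a) m1; rewrite oppr_ge0 (ltW a0) => /(_ isT) m2.
have m3 : 0 < - a * expR a by rewrite mulr_gt0// oppr_gt0.
by rewrite (ltr0_norm a0) ler0_norm; lra.
Qed.

Lemma expR_sub1D_le (a : R) : `|expR a - 1 - a| <= `|a| ^+ 2 * expR `|a|.
Proof.
have h1 := expR_ge1Dx a; have h2 := expR_ge1Dx (- a).
have e0 := expR_gt0 a; have e1 : expR a * expR (- a) = 1 by rewrite -expRD subrr expR0.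
have h3 : expR a - 1 <= a * expR a by have := ler_wpM2l (ltW e0) h2; rewrite e1; lra.
rewrite ger0_norm; last lra.
apply: (@le_trans _ _ (a * (expR a - 1))); first lra.
rewrite expr2 -mulrA; apply: (le_trans (ler_norm _)); rewrite normrM ler_wpM2l//.
exact: expR_sub1_le.
Qed.

Let mvt_le (f df : R -> R) (b M : R) : (forall x : R, is_derive x (1 : R) f (df x)) ->
  (forall c, `|c| <= `|b| -> `|df c| <= M) -> `|f b - f 0| <= M * `|b|.
Proof.
move=> d hM.
have cf : continuous f by move=> x; exact/differentiable_continuous/derivable1_diffP.
have [b0|b0] := leP 0 b.
- have [|c] := @MVT_segment R f df 0 b b0 (fun x _ => d x); first exact: continuous_subspaceT.
  rewrite in_itv /= => /andP[c0 cb] ->; rewrite subr0 normrM ler_wpM2r//; apply: hM.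
  by rewrite !ger0_norm.
- have [|c] := @MVT_segment R f df b 0 (ltW b0) (fun x _ => d x); first exact: continuous_subspaceT.
  rewrite in_itv /= => /andP[c0 cb] h; rewrite distrC h sub0r normrM normrN ler_wpM2r//; apply: hM.
  by rewrite !ler0_norm ?(ltW b0)//; lra.
Qed.

Lemma norm_sin_le (b : R) : `|sin b| <= `|b|.
Proof.
have := @mvt_le (fun x => sin x) (fun x => cos x) b 1 (fun x => is_derive_sin x).
by rewrite sin0 subr0 mul1r; apply => c _; exact: cos_max.
Qed.

Lemma norm_cos_sub1_le (b : R) : `|cos b - 1| <= `|b| * `|b|.
Proof.
have := @mvt_le (fun x => cos x) (fun x => - sin x) b `|b| (fun x => is_derive_cos x).
rewrite cos0; apply => c cb; rewrite normrN; exact: le_trans (norm_sin_le c) cb.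
Qed.

Lemma norm_sin_sub_le (b : R) : `|sin b - b| <= 2 * `|b| * `|b|.
Proof.
have d (x : R) : is_derive x (1 : R) (fun x : R => sin x - x) (cos x - 1).
  have e1 := @is_derive_sin R x; have e2 := @is_derive_id R R x 1.
  exact: (@is_deriveB _ _ _ _ _ _ _ _ _ e1 e2).
have [b1|b1] := leP `|b| 1.
  have := @mvt_le (fun x => sin x - x) (fun x => cos x - 1) b `|b| d.
  rewrite sin0 !subr0 => H; apply: (le_trans (H _)); last first.
    by have := mulr_ge0 (normr_ge0 b) (normr_ge0 b); lra.
  move=> c cb; apply: (le_trans (norm_cos_sub1_le c)); rewrite -[leRHS]mul1r.
  by apply: ler_pM => //; exact: le_trans cb b1.
have h1 := norm_sin_le b; have h2 := ler_normB (sin b) b.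
apply: (le_trans h2); apply: (@le_trans _ _ (2 * `|b|)); first lra.
by apply: ler_peMr; [rewrite mulr_ge0|exact: ltW].
Qed.

(** With [w = a + i b], write [e^w - 1 - w] as
    [e^a (e^{ib} - 1 - i b) + (e^a - 1) i b + (e^a - 1 - a)]; each term is quadratic.
    The bound holds for all [w], so that it can be summed over unbounded frequencies. *)
Lemma cexp_sub1D_le (w : C) : normc (cexp w - 1 - w) <= 5 * normc w ^+ 2 * expR (normc w).
Proof.
case: w => a b; set w := a +i* b; set r := normc w.
have ha : `|a| <= r by have := normc_ge_Re w.
have hb : `|b| <= r by have := normc_ge_Im w.
have r0 : 0 <= r := normc_ge0 w.
have er : expR `|a| <= expR r by rewrite ler_expR.
have er0 := expR_ge0 r.
have -> : cexp w - 1 - w = (expR a * (cos b - 1) + (expR a - 1 - a)) +i*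
    (expR a * (sin b - b) + (expR a - 1) * b).
  by rewrite /w; apply/eqP; rewrite eq_complex /=; apply/andP; split; apply/eqP; ring.
apply: (le_trans (normc_le_ReIm _)); rewrite [complex.Re _]/= [complex.Im _]/=.
have k0 : expR a <= expR r by rewrite ler_expR (le_trans (ler_norm _)).
have k1 : `|expR a * (cos b - 1)| <= expR r * (r * r).
  rewrite normrM (ger0_norm (expR_ge0 _)); apply: ler_pM; rewrite ?expR_ge0//.
  by apply: (le_trans (norm_cos_sub1_le b)); apply: ler_pM.
have k2 : `|expR a - 1 - a| <= r ^+ 2 * expR r.
  apply: (le_trans (expR_sub1D_le a)); apply: ler_pM; rewrite ?expR_ge0 ?exprn_ge0//.
  by rewrite lerXn2r// nnegrE.
have k3 : `|expR a * (sin b - b)| <= expR r * (2 * r * r).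
  rewrite normrM (ger0_norm (expR_ge0 _)); apply: ler_pM; rewrite ?expR_ge0//.
  by apply: (le_trans (norm_sin_sub_le b)); apply: ler_pM; rewrite ?mulr_ge0// ler_wpM2l.
have k4 : `|(expR a - 1) * b| <= (r * expR r) * r.
  rewrite normrM; apply: ler_pM => //; apply: (le_trans (expR_sub1_le a)).
  by apply: ler_pM; rewrite ?expR_ge0.
have j1 := ler_normD (expR a * (cos b - 1)) (expR a - 1 - a).
have j2 := ler_normD (expR a * (sin b - b)) ((expR a - 1) * b).
have -> : 5 * r ^+ 2 * expR r = expR r * (r * r) + r ^+ 2 * expR r +
  (expR r * (2 * r * r) + r * expR r * r) by ring.
exact: (lerD (le_trans j1 (lerD k1 k2)) (le_trans j2 (lerD k3 k4))).
Qed.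

Lemma cderiv_cexp (z : C) : cderiv (@cexp R) z (cexp z).
Proof.
move=> eps eps0; pose K := 5 * expR 1 * (normc (cexp z) + 1) : R.
have K0 : 0 < K by rewrite !mulr_gt0 ?expR_gt0// ltr_wpDl// normc_ge0.
exists (Num.min 1 (eps / K)); first by rewrite lt_min ltr01 divr_gt0.
move=> h; rewrite lt_min => /andP[h1 h2].
have -> : cexp (z + h) - cexp z - cexp z * h = cexp z * (cexp h - 1 - h) by rewrite cexpD; ring.
have n0 := normc_ge0 h; have z0 := normc_ge0 (cexp z).
rewrite normcM; apply: (@le_trans _ _ ((normc (cexp z) + 1) * (5 * normc h ^+ 2 * expR 1))).
  apply: ler_pM; rewrite ?normc_ge0 ?lerDl//.
  apply: (le_trans (cexp_sub1D_le h)); rewrite ler_wpM2l ?mulr_ge0 ?exprn_ge0//.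
  by rewrite ler_expR ltW.
have -> : (normc (cexp z) + 1) * (5 * normc h ^+ 2 * expR 1) = K * normc h * normc h.
  by rewrite /K; ring.
by rewrite ler_wpM2r// mulrC -ler_pdivlMr// ltW.
Qed.

End ExponentialDerivative.

(** * The space of entire functions *)

Section EntireFunctions.
Context {R : realType} (nu alpha : R) (nu0 : 0 < nu).
Local Notation C := R[i].
Local Notation T := (measurableTypeR R).
Local Notation mu := (@lebesgue_measure R).
Local Notation I01 := (`[0, 1]%classic : set T).
Local Notation lam2 := (@lebesgue_measure R \x @lebesgue_measure R)%E.
Local Notation S := (@strip R : set (T * T)).
Local Notation F := (Fspace nu alpha).
Local Notation w := (weighted nu).
Local Notation e := (weighted_basis nu alpha).
Implicit Types (f g : C -> C) (n : int) (m : nat).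

Definition holomorphic f : Prop := forall z, exists c, cderiv f z c.

Lemma entireE f : entire f <-> holomorphic f.
Proof. by split=> H z; apply/derivable_cderiv; exact: H. Qed.

Lemma holomorphic_ccont f : holomorphic f -> forall z, ccont f z.
Proof. by move=> ef z; have [c /cderiv_ccont] := ef z. Qed.

Lemma holomorphicD f g : holomorphic f -> holomorphic g -> holomorphic (fun z => f z + g z).
Proof.
by move=> /entireE ef /entireE eg; apply/entireE => z; exact: derivableD.
Qed.

Lemma holomorphicM f g : holomorphic f -> holomorphic g -> holomorphic (fun z => f z * g z).
Proof.
by move=> /entireE ef /entireE eg; apply/entireE => z; exact: derivableM.
Qed.

Lemma holomorphic_comp f g : holomorphic f -> holomorphic g -> holomorphic (fun z => g (f z)).
Proof.
move=> /entireE ef /entireE eg; apply/entireE => z; apply/derivable1_diffP.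
apply: (@differentiable_comp _ (C^o) (C^o) (C^o) f g); apply/derivable1_diffP; [exact: ef|exact: eg].
Qed.

Lemma holomorphic_cst (a : C) : holomorphic (fun=> a).
Proof.
by apply/entireE => z; exact: derivable_cst.
Qed.

Lemma holomorphic_id : holomorphic (fun z : C => z).
Proof.
by apply/entireE => z; exact: derivable_id.
Qed.

Lemma holomorphic_cexp : holomorphic (@cexp R).
Proof. by move=> z; exists (cexp z); exact: cderiv_cexp. Qed.

Lemma Fspace_sub_L2space : F `<=` L2space nu alpha.
Proof.
move=> f [/entireE ef qf lf]; split=> //; first exact/cmeasurable_ccont/holomorphic_ccont.
by apply: aeW => p m; exact: qf.
Qed.

Lemma Fspace0 : F (fun=> 0).
Proof.
have [_ _ l0] := L2space0 nu alpha.
by split; [exact/entireE/holomorphic_cst|move=> z m; rewrite mulr0|].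
Qed.

Lemma Fspace_lin (c : C) f g : F f -> F g -> F (fun z => c * f z + g z).
Proof.
move=> Ff Fg; have [/entireE ef qf lf] := Ff; have [/entireE eg qg lg] := Fg.
have [_ _ l] := L2space_lin c (Fspace_sub_L2space Ff) (Fspace_sub_L2space Fg).
split; [exact/entireE/(holomorphicD (holomorphicM (holomorphic_cst c) ef) eg)| |exact: l].
by move=> z m; rewrite qf qg; ring.
Qed.

Definition exponent n (z : C) : C :=
  (nu / 2)%:C * z ^+ 2 + 2 * 'i%C * pi%:C * (alpha + n%:~R)%:C * z.

Definition kappa n : C := ((2 ^+ 0 * 0`!%:R) `^ (- 2^-1)
   * (2 * nu / pi) `^ (4^-1)
   * expR (- (pi ^+ 2 / nu) * (alpha + n%:~R) ^+ 2))%:C.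

Lemma psi0E n z : psi nu alpha 0 n z = kappa n * cexp (exponent n z).
Proof. by rewrite /psi hermiteE /= hornerC mulr1. Qed.

Lemma kappa_neq0 n : kappa n != 0.
Proof.
rewrite /kappa psi_coefE//; have h := hnorm_gt0 (freq_gt0 nu0) 0.
by rewrite fmorph_eq0 gt_eqF// mulr_gt0// expR_gt0.
Qed.

Lemma holomorphic_exponent n : holomorphic (exponent n).
Proof.
exact: (holomorphicD (holomorphicM (holomorphic_cst _) (holomorphicM holomorphic_id holomorphic_id))
  (holomorphicM (holomorphic_cst _) holomorphic_id)).
Qed.

Lemma holomorphic_psi0 n : holomorphic (psi nu alpha 0 n).
Proof.
have -> : psi nu alpha 0 n = (fun z => kappa n * cexp (exponent n z)).
  by apply/funext => z; exact: psi0E.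
exact: (holomorphicM (holomorphic_cst _) (holomorphic_comp (holomorphic_exponent n) holomorphic_cexp)).
Qed.

Lemma psi0_Fspace n : F (psi nu alpha 0 n).
Proof.
have [_ _ l] := psi_L2space alpha nu0 0 n.
by split=> //; [exact/entireE/holomorphic_psi0|move=> z m; exact: psi_quasiperiodic].
Qed.

Lemma psi0_neq0 n z : psi nu alpha 0 n z != 0.
Proof. by rewrite psi0E mulf_neq0 ?kappa_neq0 ?cexp_neq0. Qed.

Lemma holomorphic_div_psi0 f n : holomorphic f -> holomorphic (fun z => f z / psi nu alpha 0 n z).
Proof.
move=> ef; have -> : (fun z => f z / psi nu alpha 0 n z) =
    (fun z => f z * ((kappa n)^-1 * cexp (-1 * exponent n z))).
  apply/funext => z; congr (_ * _); apply: (mulfI (psi0_neq0 n z)).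
  rewrite mulfV ?psi0_neq0// psi0E mulN1r mulrACA mulfV ?kappa_neq0// mul1r.
  by rewrite -cexpD subrr cexp0.
exact: (holomorphicM ef (holomorphicM (holomorphic_cst _)
  (holomorphic_comp (holomorphicM (holomorphic_cst _) (holomorphic_exponent n)) holomorphic_cexp))).
Qed.

(** Both [g] and [psi 0 n] have the same multipliers, and [psi 0 n] has no zero, so that
    their quotient is entire of period 1; its integral over a period does not depend
    on the height [y], which therefore enters only through [psi 0 n]. *)
Lemma coef_Fspace g n : F g -> exists c : C, forall y,
  coef (phase nu alpha) n (w g) y = c * (hfuns nu alpha n 0 y)%:C.
Proof.
move=> [/entireE eg qg _]; pose k z := g z / psi nu alpha 0 n z.
have ek : holomorphic k by exact: holomorphic_div_psi0.
have pk z : k (z + 1) = k z.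
  rewrite /k -[1]/(1%:~R) qg psi_quasiperiodic -mulf_div divff ?mul1r//.
  by rewrite mulf_neq0 ?cexp_neq0.
have wE p : w g p = k (of_coords p) * e (0%N, n) p.
  by rewrite -weighted_psi// /weighted /k mulrA divfK// psi0_neq0.
exists (segint (fun u => k (u +i* 0)) 0 1) => y.
rewrite (periodic_segint_const ek pk 0 y) mulrC /coef /ip.
have ck : ccontinuous (fun u : R => k (u +i* y)).
  have -> : (fun u => k (u +i* y)) = (fun t : R => k (0 +i* y + t%:C * 1)).
    apply/funext => u; congr k; apply/eqP.
    by rewrite eq_complex /= !(mul0r, mulr0, mulr1, add0r, addr0, subr0) !eqxx.
  exact: (@ccont_line R k (0 +i* y) 1 (holomorphic_ccont ek) (normc1 R)).
rewrite -cintZ; [|exact: measurable_itv|exact: ccontinuous_integrable].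
apply: eq_cint => x _; rewrite wE /weighted_basis /basis /mode -[(x, y).1]/x -[(x, y).2]/y.
rewrite -[(0%N, n).1]/0%N -[(0%N, n).2]/n -[of_coords (x, y)]/(x +i* y).
set P := phase _ _ _; set X := fmode n x.
have -> : k (x +i* y) * (P * X * (hfuns nu alpha n 0 y)%:C) * P^*%C * X^*%C =
  (P * P^*%C) * (X * X^*%C) * ((hfuns nu alpha n 0 y)%:C * k (x +i* y)) by ring.
by rewrite !mulcJ normc_phase normc_cis !expr1n !mul1r.
Qed.

(** The Fourier coefficients of [g] are multiples of the ground Hermite function, which
    is orthogonal to the higher ones. *)
Lemma ip_Fspace_basis g m n : F g -> (0 < m)%N -> ip lam2 S (w g) (e (m, n)) = 0.
Proof.
move=> Fg m0; have Lg := Fspace_sub_L2space Fg; have [c hc] := coef_Fspace n Fg.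
have lh k : L2 mu [set: T] (fun y => (hfuns nu alpha n k y)%:C).
  by apply: L2_hfun; exact: freq_gt0.
rewrite ip_mode; first last.
- exact: lh.
- exact: (L2_weighted Lg).
- exact: (cmeas_L2space Lg).
- exact: normc_phase.
- exact: cmeas_phase.
have -> : coef (phase nu alpha) n (w g) = (fun y => c * (hfuns nu alpha n 0 y)%:C).
  by apply/funext.
rewrite (ipZl measurableT c (lh 0%N) (lh m)).
rewrite hfun_orthonormal; last exact: freq_gt0.
by case: m m0 => // m _; rewrite mulr0.
Qed.

End EntireFunctions.

(** * Series of exponentials *)

Section ComplexSeries.
Context {R : realType}.
Local Notation C := R[i].
Implicit Types (c d : nat -> C) (M : nat -> R).

(** The sum of a complex series through its real and imaginary parts, to be used for
    absolutely convergent series. *)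
Definition csum c : C :=
  limn (series (fun k => complex.Re (c k))) +i* limn (series (fun k => complex.Im (c k))).

Definition csummable c : Prop := cvgn (series (fun k => normc (c k))).

Lemma csummable_le c M : (forall k, normc (c k) <= M k) -> cvgn (series M) -> csummable c.
Proof.
move=> cM; apply: series_le_cvg => // n; first exact: normc_ge0.
exact: le_trans (normc_ge0 _) (cM n).
Qed.

Lemma csummable_ReIm c : csummable c ->
  cvgn (series (fun k => complex.Re (c k))) /\ cvgn (series (fun k => complex.Im (c k))).
Proof.
move=> sc; split; apply: normed_cvg; apply: (series_le_cvg _ _ _ sc) => n.
- exact: normr_ge0.
- exact: normc_ge0.
- exact: normc_ge_Re.
- exact: normr_ge0.
- exact: normc_ge0.
- exact: normc_ge_Im.
Qed.

Lemma csumD c d : csummable c -> csummable d -> csum (fun k => c k + d k) = csum c + csum d.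
Proof.
move=> /csummable_ReIm[c1 c2] /csummable_ReIm[d1 d2]; apply/eqP; rewrite eq_complex /=.
have -> : (fun k => complex.Re (c k + d k)) =
  (fun k => complex.Re (c k)) + (fun k => complex.Re (d k)) by apply/funext => k; rewrite ReD.
have -> : (fun k => complex.Im (c k + d k)) =
  (fun k => complex.Im (c k)) + (fun k => complex.Im (d k)) by apply/funext => k; rewrite ImD.
by rewrite !lim_seriesD// !eqxx.
Qed.

Lemma csumZ (a : C) c : csummable c -> csum (fun k => a * c k) = a * csum c.
Proof.
move=> /csummable_ReIm[c1 c2]; apply/eqP; rewrite eq_complex ReM ImM /=.
have -> : (fun k => complex.Re (a * c k)) =
  (complex.Re a *: (fun k => complex.Re (c k))) - (complex.Im a *: (fun k => complex.Im (c k))).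
  by apply/funext => k; rewrite ReM.
have -> : (fun k => complex.Im (a * c k)) =
  (complex.Re a *: (fun k => complex.Im (c k))) + (complex.Im a *: (fun k => complex.Re (c k))).
  by apply/funext => k; rewrite ImM.
rewrite lim_seriesB ?lim_seriesD; try exact: is_cvg_seriesZ.
by rewrite !lim_seriesZ// !eqxx.
Qed.

Lemma Re_sum (I : Type) (s : seq I) (F : I -> C) :
  complex.Re (\sum_(i <- s) F i) = \sum_(i <- s) complex.Re (F i).
Proof. exact: (big_morph _ (@ReD R) (erefl _)). Qed.

Lemma Im_sum (I : Type) (s : seq I) (F : I -> C) :
  complex.Im (\sum_(i <- s) F i) = \sum_(i <- s) complex.Im (F i).
Proof. exact: (big_morph _ (@ImD R) (erefl _)). Qed.

Lemma cvg_csum c : csummable c ->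
  normc (csum c - \sum_(0 <= k < n) c k) @[n --> \oo] --> (0 : R).
Proof.
move=> /csummable_ReIm[c1 c2].
apply/cvgrPdist_lt => eps eps0; have e2 : 0 < eps / 2 by rewrite divr_gt0.
have /cvgrPdist_lt/(_ _ e2) k1 := c1; have /cvgrPdist_lt/(_ _ e2) k2 := c2.
near=> n; rewrite sub0r normrN ger0_norm ?normc_ge0//.
apply: (le_lt_trans (normc_le_ReIm _)); rewrite ReD ImD ReN ImN Re_sum Im_sum /=.
rewrite [ltRHS](splitr eps); apply: ltrD; near: n; [exact: k1|exact: k2].
Unshelve. all: by end_near. Qed.

Lemma csum_bound c (B : R) : csummable c ->
  (forall n, \sum_(0 <= k < n) normc (c k) <= B) -> normc (csum c) <= 2 * B.
Proof.
move=> /csummable_ReIm[c1 c2] cB.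
have lb (u : nat -> R) : cvgn (series u) -> (forall k, `|u k| <= normc (c k)) ->
    `|limn (series u)| <= B.
  move=> cu uc; have bu n : `|series u n| <= B.
    by apply: le_trans (cB n); apply: (le_trans (ler_norm_sum _ _ _)); exact: ler_sum.
  rewrite ler_norml; apply/andP; split.
  - by apply: limr_ge => //; apply: nearW => n; have := bu n; rewrite ler_norml => /andP[].
  - by apply: limr_le => //; apply: nearW => n; have := bu n; rewrite ler_norml => /andP[].
apply: (le_trans (normc_le_ReIm _)); rewrite [complex.Re _]/= [complex.Im _]/= mulr2n mulrDl mul1r.
by apply: lerD; apply: lb => // k; [exact: normc_ge_Re|exact: normc_ge_Im].
Qed.

Lemma normc_cexp_le (w : C) : normc (cexp w) <= expR (normc w).
Proof. by rewrite normc_cexp ler_expR (le_trans (ler_norm _))// normc_ge_Re. Qed.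

(** Differentiation term by term: by [cexp_sub1D_le], for [|h| <= 1] the remainder of
    the term of index [k] is at most [20 |h|^2 |b k| e^{|lam k| (|z| + 2)}], which is
    summable by hypothesis. *)
Lemma holomorphic_series (b lam : nat -> C) :
  (forall r, cvgn (series (fun k => normc (b k) * expR (normc (lam k) * r)))) ->
  holomorphic (fun z => csum (fun k => b k * cexp (lam k * z))).
Proof.
move=> H z; pose M r k := normc (b k) * expR (normc (lam k) * r).
have n0 (x : C) : 0 <= normc x := normc_ge0 x.
have M0 r k : 0 <= M r k by rewrite mulr_ge0// expR_ge0.
have ell (x : R) : 0 <= x -> x ^+ 2 <= 4 * expR x.
  move=> x0; have := expR_ge1Dx (x / 2); have -> : expR x = expR (x / 2) * expR (x / 2).
    by rewrite -expRD -splitr.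
  by nra.
have s1 z' : csummable (fun k => b k * cexp (lam k * z')).
  apply: (csummable_le _ (H (normc z'))) => k; rewrite normcM ler_wpM2l//.
  by apply: (le_trans (normc_cexp_le _)); rewrite normcM.
have s2 : csummable (fun k => b k * lam k * cexp (lam k * z)).
  apply: (csummable_le _ (H (normc z + 1))) => k; rewrite 2!normcM -mulrA ler_wpM2l//.
  rewrite mulrDr mulr1 expRD mulrC; apply: ler_pM => //.
    by apply: (le_trans (normc_cexp_le _)); rewrite normcM.
  by apply: le_trans (expR_ge1Dx _); rewrite lerDr.
exists (csum (fun k => b k * lam k * cexp (lam k * z))) => eps eps0.
pose W := limn (series (M (normc z + 2))).
have Wn n : \sum_(0 <= k < n) M (normc z + 2) k <= W.
  apply: (@nondecreasing_cvgn_le _ (series (M (normc z + 2)))) => //; last exact: H.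
  by apply: nondecreasing_series => k _ _; exact: M0.
have W0 : 0 <= W by have := Wn 0%N; rewrite big_geq.
have W1 : 0 < 40 * (W + 1) by rewrite mulr_gt0// ltr_wpDl.
exists (Num.min 1 (eps / (40 * (W + 1)))); first by rewrite lt_min ltr01 divr_gt0.
move=> h; rewrite lt_min => /andP[h1 h2].
pose t k := b k * cexp (lam k * (z + h)) + ((-1) * (b k * cexp (lam k * z)) +
  (- h) * (b k * lam k * cexp (lam k * z))).
have sZ (a : C) (c : nat -> C) : csummable c -> csummable (fun k => a * c k).
  move=> sc; apply: (@csummable_le _ (normc a *: (fun k => normc (c k)))).
    by move=> k; rewrite normcM.
  exact: is_cvg_seriesZ.
have sD (c d : nat -> C) : csummable c -> csummable d -> csummable (fun k => c k + d k).
  move=> sc sd; apply: (@csummable_le _ ((fun k => normc (c k)) + (fun k => normc (d k)))).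
    by move=> k; exact: le_normcD.
  exact: is_cvg_seriesD.
have sX := sZ (-1) _ (s1 z); have sY := sZ (- h) _ s2.
have tE : csum (fun k => b k * cexp (lam k * (z + h))) - csum (fun k => b k * cexp (lam k * z)) -
    csum (fun k => b k * lam k * cexp (lam k * z)) * h = csum t.
  rewrite /t csumD//; last exact: sD.
  by rewrite csumD// !csumZ//; ring.
have tk k : normc (t k) <= 20 * normc h ^+ 2 * M (normc z + 2) k.
  have -> : t k = b k * cexp (lam k * z) * (cexp (lam k * h) - 1 - lam k * h).
    by rewrite /t mulrDr cexpD; ring.
  have l0 := n0 (lam k); have hh := n0 h.
  have q1 : normc (cexp (lam k * z)) <= expR (normc (lam k) * normc z).
    by apply: (le_trans (normc_cexp_le _)); rewrite normcM.
  have q2 : normc (cexp (lam k * h) - 1 - lam k * h) <=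
      20 * normc h ^+ 2 * (expR (normc (lam k)) * expR (normc (lam k))).
    apply: (le_trans (cexp_sub1D_le _)); rewrite normcM exprMn.
    have e1 : expR (normc (lam k) * normc h) <= expR (normc (lam k)).
      by rewrite ler_expR ler_piMr// ltW.
    have -> : 20 * normc h ^+ 2 * (expR (normc (lam k)) * expR (normc (lam k))) =
      5 * ((4 * expR (normc (lam k))) * normc h ^+ 2) * expR (normc (lam k)) by ring.
    apply: ler_pM => //; rewrite ?expR_ge0//; first by rewrite !mulr_ge0// exprn_ge0.
    by rewrite ler_wpM2l// ler_wpM2r ?exprn_ge0// ell.
  have -> : 20 * normc h ^+ 2 * M (normc z + 2) k = normc (b k) * expR (normc (lam k) * normc z) *
     (20 * normc h ^+ 2 * (expR (normc (lam k)) * expR (normc (lam k)))).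
    rewrite /M (_ : normc (lam k) * (normc z + 2) =
      normc (lam k) * normc z + (normc (lam k) + normc (lam k))); last by ring.
    by rewrite !expRD; ring.
  rewrite 2!normcM; apply: ler_pM => //; rewrite ?mulr_ge0//.
  by rewrite ler_wpM2l.
rewrite tE; apply: (@le_trans _ _ (2 * (20 * normc h ^+ 2 * W))).
  apply: csum_bound; first by apply: (sD _ _ (s1 (z + h))); exact: sD.
  move=> n; apply: (@le_trans _ _ (\sum_(0 <= k < n) 20 * normc h ^+ 2 * M (normc z + 2) k)).
    by apply: ler_sum => k _; exact: tk.
  by rewrite -mulr_sumr ler_wpM2l// !mulr_ge0// exprn_ge0.
have hh := n0 h; move: h2; rewrite ltr_pdivlMr// => /ltW h2.
have -> : 2 * (20 * normc h ^+ 2 * W) = normc h * (40 * W) * normc h by ring.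
rewrite ler_wpM2r//; apply: le_trans h2; rewrite ler_wpM2l//; lra.
Qed.

End ComplexSeries.

(** * Integer translations, and closedness of the space of entire functions *)

Section Translation.
Context {R : realType}.
Local Notation T := (measurableTypeR R).
Local Notation mu := (@lebesgue_measure R).
Local Notation lam2 := (@lebesgue_measure R \x @lebesgue_measure R)%E.
Local Notation S := (@strip R : set (T * T)).

Let measurable_addr (a : R) : measurable_fun [set: T] (fun x : T => x + a : T).
Proof. by apply: measurable_funD. Qed.

Let measurable_shift (a : R) :
  measurable_fun [set: T * T] (fun p : T * T => (p.1 + a, p.2) : T * T).
Proof.
apply: measurable_fun_pair; last exact: measurable_snd.
exact: (measurableT_comp (measurable_addr a) measurable_fst).
Qed.

Lemma lebesgue_measure_translate (a : R) (A : set T) : measurable A ->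
  mu ((fun x : T => x + a : T) @^-1` A) = mu A.
Proof.
move=> mA; pose m' : {measure set T -> \bar R} :=
  measure_function_pushforward__canonical__measure_function_Measure mu (measurable_addr a).
rewrite (@lebesgue_measure_unique R m' _ A mA)// => X [[x y] _ <-].
rewrite /m' /= /pushforward.
have -> : (fun t : T => t + a : T) @^-1` [set` `]x, y]] = [set` `]x - a, y - a]].
  by apply/seteqP; split=> t /=; rewrite !in_itv/= ltrBlDr lerBrDr.
rewrite !lebesgue_measure_itv/= !lte_fin ltrD2r; case: ifPn => // _.
by rewrite -!EFinB; congr EFin; ring.
Qed.

Lemma negligible_translate (a : R) (N : set (T * T)) : lam2.-negligible N ->
  lam2.-negligible ((fun p : T * T => (p.1 + a, p.2) : T * T) @^-1` N).
Proof.
move=> [B [mB B0 NB]].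
exists ((fun p : T * T => (p.1 + a, p.2) : T * T) @^-1` B); split.
- by rewrite -[X in measurable X]setTI; exact: measurable_shift.
- pose m' : {measure set (T * T) -> \bar R} :=
    measure_function_pushforward__canonical__measure_function_Measure lam2 (measurable_shift a).
  rewrite -[RHS]B0; apply: esym; apply: (@product_measure_unique _ _ _ _ _ mu mu m' _ B mB).
  move=> A1 A2 mA1 mA2; rewrite /m' /= /pushforward.
  have -> : (fun p : T * T => (p.1 + a, p.2) : T * T) @^-1` (A1 `*` A2) =
    ((fun x : T => x + a : T) @^-1` A1) `*` A2 by [].
  have mA : measurable ((fun x : T => x + a : T) @^-1` A1).
    by rewrite -[X in measurable X]setTI; exact: measurable_addr.
  by rewrite product_measure1E//; congr (_ * _)%E; exact: lebesgue_measure_translate.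
- by move=> p; exact: NB.
Qed.

(** An integer translation moves each point into the strip, and the countably many
    translates of a null set form a null set. *)
Lemma ae_strip_translate (P : T * T -> Prop) : {ae lam2, forall p, S p -> P p} ->
  {ae lam2, forall p, exists m : int, P (p.1 + m%:~R, p.2)}.
Proof.
move=> H; pose N (m : int) := (fun p : T * T => (p.1 + m%:~R, p.2) : T * T) @^-1`
  (~` [set p | S p -> P p]).
apply: (@negligibleS _ _ _ _ (\bigcup_(j in [set: nat]) oapp N set0 (@choice.unpickle int j))).
  move=> p /= H1; pose m := - Num.floor p.1.
  exists (choice.pickle m); first exact: I.
  rewrite choice.pickleK /= => H2; apply: H1; exists m; apply: H2; split=> //=.
  have /andP[h1 h2] := floor_itv p.1; rewrite in_itv/= /m mulrNz; rewrite intrD in h2.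
  by apply/andP; split; lra.
apply: negligible_bigcup => j; case: (@choice.unpickle int j) => [m|]; last exact: negligible_set0.
exact: negligible_translate.
Qed.

End Translation.

Section Closedness.
Context {R : realType} (nu alpha : R) (nu0 : 0 < nu).
Local Notation C := R[i].
Local Notation T := (measurableTypeR R).
Local Notation mu := (@lebesgue_measure R).
Local Notation lam2 := (@lebesgue_measure R \x @lebesgue_measure R)%E.
Local Notation S := (@strip R : set (T * T)).
Local Notation F := (Fspace nu alpha).
Local Notation w := (weighted nu).
Local Notation e := (weighted_basis nu alpha).
Local Notation psi0 := (psi nu alpha 0).

(** A parabola lies above its tangents: [p (beta + k)^2 >= 2 p t (beta + k) - p t^2],
    and [t] is chosen so that the terms are dominated by a multiple of [e^{-k}]. *)
Lemma is_cvg_gauss_series (p beta q : R) : 0 < p ->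
  cvgn (series (fun k => expR (- (p * (beta + k%:R) ^+ 2)) * expR (q * k%:R))).
Proof.
move=> p0; pose t := (q + 1) / (2 * p).
pose K := expR (- ((q + 1) * beta) + p * t ^+ 2).
have h : `|expR (- 1) : R| < 1.
  by rewrite ger0_norm ?expR_ge0// -[ltRHS]expR0 ltr_expR; lra.
have cg : cvgn (series (geometric K (expR (-1)))) := @is_cvg_geometric_series R K _ h.
apply: (@series_le_cvg R _ (geometric K (expR (-1))) _ _ _ cg) => k.
- by rewrite mulr_ge0// expR_ge0.
- by rewrite /geometric /= mulr_ge0 ?exprn_ge0 ?expR_ge0.
- rewrite /geometric /= -expRM_natl -!expRD ler_expR.
  have h1 : 0 <= p * (beta + k%:R - t) ^+ 2 by rewrite mulr_ge0 ?sqr_ge0// ltW.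
  have h2 : 2 * p * t = q + 1 by rewrite /t; field; rewrite gt_eqF.
  have -> : - (p * (beta + k%:R) ^+ 2) = - (p * (beta + k%:R - t) ^+ 2)
     - (2 * p * t) * (beta + k%:R) + p * t ^+ 2 by ring.
  by rewrite h2; lra.
Qed.

Definition lam (n : int) : C := 2 * 'i%C * pi%:C * n%:~R.

Lemma normc_lam n : normc (lam n) = 2 * pi * `|n%:~R|.
Proof.
have -> : lam n = 'i%C * (2 * pi * n%:~R)%:C.
  by rewrite /lam intrC !rmorphM /= rmorph_nat; ring.
rewrite normcM normc_real.
have -> : normc ('i%C : C) = 1 by rewrite /normc /= expr0n expr1n add0r sqrtr1.
by rewrite mul1r normrM ger0_norm// mulr_ge0// pi_ge0.
Qed.

Lemma exponent_lam n z : exponent nu alpha n z = exponent nu alpha 0 z + lam n * z.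
Proof.
rewrite /exponent /lam (rmorphD _ alpha (n%:~R)) (rmorphD _ alpha (0%:~R)) /= -!intrC.
by ring.
Qed.

Lemma psi0_lam n z : psi0 n z = cexp (exponent nu alpha 0 z) * (kappa nu alpha n * cexp (lam n * z)).
Proof. by rewrite psi0E exponent_lam cexpD; ring. Qed.

Lemma cexp_lam_int n (m : int) z : cexp (lam n * (z + m%:~R)) = cexp (lam n * z).
Proof.
have -> : lam n * (z + m%:~R) = lam n * z + 2 * 'i%C * pi%:C * (n * m)%:~R.
  by rewrite /lam intrM; ring.
by rewrite cexpD cexp_2pi_int mulr1.
Qed.

Lemma cexp_exponent0_int (m : int) z : cexp (exponent nu alpha 0 (z + m%:~R)) =
  multiplier nu alpha m z * cexp (exponent nu alpha 0 z).
Proof.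
apply: (mulfI (kappa_neq0 alpha nu0 0)).
by rewrite -psi0E psi_quasiperiodic psi0E; ring.
Qed.

Lemma normc_kappa n : normc (kappa nu alpha n) =
  hnorm (freq nu) 0 * expR (- (pi ^+ 2 / nu * (alpha + n%:~R) ^+ 2)).
Proof.
rewrite /kappa psi_coefE// normc_real ger0_norm ?mulNr//.
by rewrite mulr_ge0 ?expR_ge0// ltW// hnorm_gt0// freq_gt0.
Qed.

Section SumOfGroundModes.
Context (a : int -> C) (A : R).
Hypothesis aA : forall n, normc (a n) <= A.

Let b (n : int) : C := a n * kappa nu alpha n.
Let p : R := pi ^+ 2 / nu.
Let p0 : 0 < p. Proof. by rewrite divr_gt0// exprn_gt0// pi_gt0. Qed.
Let c0 : 0 <= hnorm (freq nu) 0. Proof. by rewrite ltW// hnorm_gt0// freq_gt0. Qed.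

Let b_le n : normc (b n) <= A * hnorm (freq nu) 0 * expR (- (p * (alpha + n%:~R) ^+ 2)).
Proof.
rewrite normcM normc_kappa mulrA; apply: ler_wpM2r; first exact: expR_ge0.
by apply: ler_wpM2r.
Qed.

Let cvg_pos r :
  cvgn (series (fun k => normc (b (Posz k)) * expR (normc (lam (Posz k)) * r))).
Proof.
have := is_cvg_seriesZ (k := A * hnorm (freq nu) 0) (@is_cvg_gauss_series p alpha (2 * pi * r) p0).
move=> cv; apply: (series_le_cvg _ _ _ cv) => k; first by rewrite mulr_ge0 ?normc_ge0 ?expR_ge0.
- apply: mulr_ge0; last by rewrite mulr_ge0 ?expR_ge0.
  by apply: mulr_ge0 => //; exact: le_trans (normc_ge0 _) (aA 0).
- rewrite [leRHS]mulrA normc_lam (_ : 2 * pi * `|k%:~R| * r = 2 * pi * r * k%:R).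
    by apply: ler_wpM2r; [exact: expR_ge0|exact: b_le].
  by rewrite ger0_norm ?ler0z//; ring.
Qed.

Let cvg_neg r :
  cvgn (series (fun k => normc (b (Negz k)) * expR (normc (lam (Negz k)) * r))).
Proof.
have nE k : (Negz k)%:~R = - (k%:R + 1) :> R by rewrite NegzE mulrNz -pmulrn -natr1.
have := is_cvg_seriesZ (k := A * hnorm (freq nu) 0 * expR (2 * pi * r))
  (@is_cvg_gauss_series p (1 - alpha) (2 * pi * r) p0).
move=> cv; apply: (series_le_cvg _ _ _ cv) => k; first by rewrite mulr_ge0 ?normc_ge0 ?expR_ge0.
- apply: mulr_ge0; last by rewrite mulr_ge0 ?expR_ge0.
  by rewrite !mulr_ge0 ?expR_ge0//; exact: le_trans (normc_ge0 _) (aA 0).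
- have -> : normc (lam (Negz k)) * r = 2 * pi * r + 2 * pi * r * k%:R.
    by rewrite normc_lam nE normrN ger0_norm ?addr_ge0//; ring.
  have := b_le (Negz k); rewrite nE.
  have -> : (alpha + - (k%:R + 1)) ^+ 2 = (1 - alpha + k%:R) ^+ 2 by ring.
  move=> hb; apply: (le_trans (ler_wpM2r (expR_ge0 _) hb)).
  rewrite expRD; set X := expR (- _); set Y := expR (2 * pi * r); set Z := expR _.
  have -> : A * hnorm (freq nu) 0 * X * (Y * Z) = A * hnorm (freq nu) 0 * Y * (X * Z) by ring.
  exact: lexx.
Qed.

(** The sum of the functions [a n * psi 0 n], with the factor that they share taken
    out: what remains are series of exponentials. *)
Definition ground_sum (z : C) : C := cexp (exponent nu alpha 0 z) *
  (csum (fun k => b (Posz k) * cexp (lam (Posz k) * z)) +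
   csum (fun k => b (Negz k) * cexp (lam (Negz k) * z))).

Lemma holomorphic_ground_sum : holomorphic ground_sum.
Proof.
apply: holomorphicM; first exact: (holomorphic_comp (holomorphic_exponent _ _ _) holomorphic_cexp).
by apply: holomorphicD; apply: holomorphic_series.
Qed.

Lemma ground_sum_quasiperiodic (m : int) z :
  ground_sum (z + m%:~R) = multiplier nu alpha m z * ground_sum z.
Proof.
have E (n : nat -> int) : (fun k => b (n k) * cexp (lam (n k) * (z + m%:~R))) =
    (fun k => b (n k) * cexp (lam (n k) * z)).
  by apply/funext => k; rewrite cexp_lam_int.
by rewrite /ground_sum (E Posz) (E Negz) cexp_exponent0_int mulrA.
Qed.

Definition ground_partial (N : nat) (z : C) : C :=
  \sum_(0 <= k < N) (a (Posz k) * psi0 (Posz k) z + a (Negz k) * psi0 (Negz k) z).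

Lemma cvg_ground_partial z :
  normc (ground_sum z - ground_partial N z) @[N --> \oo] --> (0 : R).
Proof.
have sm (n : nat -> int) : (forall r, cvgn (series (fun k => normc (b (n k)) * expR (normc (lam (n k)) * r)))) ->
    csummable (fun k => b (n k) * cexp (lam (n k) * z)).
  move=> H; apply: (csummable_le _ (H (normc z))) => k; rewrite normcM.
  by apply: ler_wpM2l; rewrite ?normc_ge0// (le_trans (normc_cexp_le _))// normcM.
have h1 := cvg_csum (sm _ cvg_pos); have h2 := cvg_csum (sm _ cvg_neg).
set E := cexp (exponent nu alpha 0 z).
set s1 := csum _ in h1; set s2 := csum _ in h2.
have h : normc E * (normc (s1 - \sum_(0 <= k < N) b (Posz k) * cexp (lam (Posz k) * z)) +
  normc (s2 - \sum_(0 <= k < N) b (Negz k) * cexp (lam (Negz k) * z))) @[N --> \oo] --> (0 : R).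
  have h3 := cvgD h1 h2; rewrite addr0 in h3.
  by rewrite -[X in _ --> X](mulr0 (normc E)); apply: cvgMr; exact: h3.
apply: (squeeze_cvgr _ (cvg_cst 0) h); near=> N; rewrite normc_ge0/=.
rewrite /ground_sum -/E -/s1 -/s2 /ground_partial.
have -> : \sum_(0 <= k < N) (a (Posz k) * psi0 (Posz k) z + a (Negz k) * psi0 (Negz k) z) =
  E * (\sum_(0 <= k < N) b (Posz k) * cexp (lam (Posz k) * z) +
       \sum_(0 <= k < N) b (Negz k) * cexp (lam (Negz k) * z)).
  rewrite -big_split mulr_sumr; apply: eq_bigr => k _ /=.
  by rewrite !psi0_lam -/E /b; ring.
rewrite -mulrBr normcM ler_wpM2l ?normc_ge0// opprD addrACA.
exact: le_normcD.
Unshelve. all: by end_near. Qed.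

End SumOfGroundModes.

Section OrthogonalToHigherModes.
Context (f : C -> C) (Lf : L2space nu alpha f).
Hypothesis f_perp : forall m n, (0 < m)%N -> ip lam2 S (w f) (e (m, n)) = 0.

Let u := w f.
Let Lu : L2 lam2 S u. Proof. exact: L2_weighted Lf. Qed.
Let mu_ : cmeas setT u. Proof. exact: cmeas_L2space Lf. Qed.
Let mS : measurable S. Proof. exact: measurable_strip. Qed.
Let a (n : int) : C := ip lam2 S u (e (0%N, n)).
Let Le i : L2 lam2 S (e i). Proof. exact: L2_weighted_basis. Qed.

Let a_le n : normc (a n) <= nq lam2 S u + 1.
Proof.
have := bessel mS Le (weighted_basis_orthonormal alpha nu0) Lu (_ : uniq [:: (0%N, n)]).
rewrite big_seq1 -/(a n) => /(_ isT).
have := normc_ge0 (a n); have := sqr_ge0 (normc (a n) - 1); nra.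
Qed.

Let g := ground_sum a.
Let G := ground_partial a.

Let s (N : nat) : seq (nat * int) :=
  [seq (0%N, Posz k) | k <- index_iota 0 N] ++ [seq (0%N, Negz k) | k <- index_iota 0 N].

Let uniq_s N : uniq (s N).
Proof.
rewrite cat_uniq !map_inj_uniq ?iota_uniq//=; try by move=> x y [].
rewrite andbT; apply/hasPn => _ /mapP[k _ ->]; apply/negP => /mapP[j _].
by case.
Qed.

Let weighted_G N p : w (G N) p = \sum_(i <- s N) ip lam2 S u (e i) * e i p.
Proof.
rewrite /weighted /G /ground_partial big_cat /= !big_map -big_split /= mulr_suml.
have hw n : a n * psi0 n (of_coords p) * (expR (- (nu / 2 * normc (of_coords p) ^+ 2)))%:C =
    a n * e (0%N, n) p by rewrite -weighted_psi// /weighted mulrA.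
by apply: eq_bigr => k _; rewrite mulrDl !hw.
Qed.

Let x (k : nat) : R := normc (a (Posz k)) ^+ 2 + normc (a (Negz k)) ^+ 2.

Let nq_G N : nq lam2 S (fun p => u p - w (G N) p) = nq lam2 S u - \sum_(0 <= k < N) x k.
Proof.
have -> : (fun p => u p - w (G N) p) =
    (fun p => u p - \sum_(i <- s N) ip lam2 S u (e i) * e i p).
  by apply/funext => p; rewrite weighted_G.
rewrite (nq_sub_proj mS Le (weighted_basis_orthonormal alpha nu0) Lu (uniq_s N)).
by rewrite big_cat /= !big_map -big_split.
Qed.

(** Only the terms with [m = 0] are left in the Parseval identity. *)
Let sum_x : (\sum_(k <oo) (x k)%:E = (nq lam2 S u)%:E)%E.
Proof.
rewrite nqK// -(weighted_basis_parseval alpha nu0 mu_ Lu).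
rewrite (esumID (range (fun n : int => (0%N, n)))); last first.
  by move=> i _; rewrite lee_fin sqr_ge0.
rewrite [X in (_ + X)%E]esum1 ?adde0; last first.
  move=> [m n] [_ /= H]; rewrite f_perp ?normc0 ?expr0n//.
  by rewrite lt0n; apply/eqP => m0; apply: H; exists n; rewrite ?m0.
rewrite setTI (esum_image setT (fun n : int => (0%N, n))); last by move=> m n _ _ [].
rewrite esum_int; last by move=> n; rewrite lee_fin sqr_ge0.
rewrite -nneseriesD//; try by move=> k _; rewrite lee_fin sqr_ge0.
Qed.

Let cvg_nq_G : nq lam2 S (fun p => u p - w (G N) p) @[N --> \oo] --> (0 : R).
Proof.
have x0 k : 0 <= x k by rewrite addr_ge0// sqr_ge0.
have c : (\sum_(0 <= k < N) (x k)%:E)%E @[N --> \oo] --> (nq lam2 S u)%:E.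
  by rewrite -sum_x; apply: is_cvg_nneseries => k _ _; rewrite lee_fin.
have c' : \sum_(0 <= k < N) x k @[N --> \oo] --> nq lam2 S u.
  have E : (fun N => \sum_(0 <= k < N) (x k)%:E)%E = (fun N => (\sum_(0 <= k < N) x k)%:E).
    by apply/funext => N; rewrite sumEFin.
  by rewrite E in c; exact: (fine_cvg c).
have -> : (fun N => nq lam2 S (fun p => u p - w (G N) p)) =
    (fun N => nq lam2 S u - \sum_(0 <= k < N) x k) by apply/funext => N; exact: nq_G.
by rewrite -[X in _ --> X](subrr (nq lam2 S u)); apply: cvgB => //; exact: cvg_cst.
Qed.

Let hol_g : holomorphic g. Proof. exact: holomorphic_ground_sum a_le. Qed.

Let mg : cmeas setT (w g).
Proof. by apply: cmeas_weighted; exact/cmeasurable_ccont/holomorphic_ccont/hol_g. Qed.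

Let mG N : cmeas setT (w (G N)).
Proof.
have -> : w (G N) = (fun p => \sum_(i <- s N) ip lam2 S u (e i) * e i p).
  by apply/funext => p; exact: weighted_G.
apply: cmeas_sum => i; apply: cmeasZ; apply: cmeas_basis; first exact: cmeas_phase.
by move=> n m; apply: L2_hfun; exact: freq_gt0.
Qed.

Let cvg_normc (z : nat -> C) (l : C) : normc (l - z N) @[N --> \oo] --> (0 : R) ->
  normc (z N) @[N --> \oo] --> normc l.
Proof.
move=> /cvgrPdist_lt H; apply/cvgrPdist_lt => eps eps0.
near=> N; have h : `|0 - normc (l - z N)| < eps by near: N; exact: H.
rewrite sub0r normrN ger0_norm ?normc_ge0// in h.
apply: le_lt_trans h; rewrite ler_norml.
have h1 := le_normcD (l - z N) (z N); rewrite subrK in h1.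
have h2 := le_normcD (z N - l) l; rewrite subrK in h2.
rewrite -(normcN (z N - l)) opprB in h2; apply/andP; split; lra.
Unshelve. all: by end_near. Qed.

(** The lemma of Fatou: the partial sums converge to [g] pointwise, and to [f] in norm. *)
Let sqn_diff : sqn lam2 S (fun p => u p - w g p) = 0%E.
Proof.
pose h (N : nat) (p : T * T) : \bar R := (normc (u p - w (G N) p) ^+ 2)%:E.
have mh N : measurable_fun S (h N).
  apply/measurable_EFinP; apply: measurable_sqr_normc; apply: cmeas_sub.
  by apply: cmeasB; [exact: mu_|exact: mG].
have h0 N p : S p -> (0 <= h N p)%E by rewrite lee_fin sqr_ge0.
have := @fatou _ _ _ lam2 S mS h mh h0.
have -> : (fun N => \int[lam2]_(p in S) h N p)%E =
    (fun N => (nq lam2 S (fun p => u p - w (G N) p))%:E).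
  apply/funext => N; rewrite nqK//; apply: (L2B mS Lu).
  split; first exact: (cmeas_sub _ (mG N)).
  have -> : w (G N) = (fun p => \sum_(i <- s N) ip lam2 S u (e i) * e i p).
    by apply/funext => p; exact: weighted_G.
  by have [] := L2_sum mS (s N) (fun i => L2Z mS (ip lam2 S u (e i)) (Le i)).
have cE : ((nq lam2 S (fun p => u p - w (G N) p))%:E @[N --> \oo] --> 0%E)%E.
  by apply: cvg_EFin; [exact: nearW|exact: cvg_nq_G].
rewrite is_cvg_limn_einfE; last by apply/cvg_ex; exists 0%E.
rewrite (cvg_lim _ cE)//.
have -> : (\int[lam2]_(p in S) limn_einf (h ^~ p))%E = sqn lam2 S (fun p => u p - w g p).
  apply: eq_integral => p _.
  have c : normc (u p - w (G N) p) ^+ 2 @[N --> \oo] --> normc (u p - w g p) ^+ 2.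
    have d : normc ((u p - w g p) - (u p - w (G N) p)) @[N --> \oo] --> (0 : R).
      pose r := expR (- (nu / 2 * normc (of_coords p) ^+ 2)).
      have E N : normc ((u p - w g p) - (u p - w (G N) p)) =
          r * normc (g (of_coords p) - G N (of_coords p)).
        have -> : (u p - w g p) - (u p - w (G N) p) = - ((g (of_coords p) - G N (of_coords p)) * r%:C).
          by rewrite /weighted -/r; ring.
        by rewrite normcN normcM normc_real ger0_norm ?expR_ge0// mulrC.
      have -> : (fun N => normc ((u p - w g p) - (u p - w (G N) p))) =
        (fun N => r * normc (g (of_coords p) - G N (of_coords p))) by apply/funext.
      rewrite -[X in _ --> X](mulr0 r); apply: cvgMr; exact: cvg_ground_partial a_le _.
    by have d' := cvg_normc d; rewrite expr2; under eq_fun do rewrite expr2; exact: cvgM.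
  have cE' : h ^~ p @ \oo --> (normc (u p - w g p) ^+ 2)%:E.
    by apply: cvg_EFin; [exact: nearW|exact: c].
  rewrite is_cvg_limn_einfE; last by apply/cvg_ex; eexists; exact: cE'.
  by rewrite (cvg_lim _ cE').
by move=> H; apply/eqP; rewrite eq_le H sqn_ge0.
Qed.

Let L2_g : L2 lam2 S (w g).
Proof.
have -> : w g = (fun p => u p - (u p - w g p)) by apply/funext => p; ring.
apply: (L2B mS Lu); split; last by rewrite sqn_diff.
by apply: cmeas_sub; apply: cmeasB; [exact: mu_|exact: mg].
Qed.

Let Fg : F g.
Proof.
split; first exact/entireE/hol_g.
- by move=> z m; exact: ground_sum_quasiperiodic.
- by rewrite sqnormE; case: L2_g.
Qed.

Let ae_strip : {ae lam2, forall p, S p -> f (of_coords p) = g (of_coords p)}.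
Proof.
have mh : measurable_fun S (fun p => (normc (u p - w g p) ^+ 2)%:E).
  apply/measurable_EFinP; apply: measurable_sqr_normc; apply: cmeas_sub.
  by apply: cmeasB; [exact: mu_|exact: mg].
have [/(_ _)H _] := @ae_eq_integral_abs _ _ _ lam2 S mS _ mh.
apply: filterS (H _) => [p hp Sp|].
  have [h] := hp Sp.
  have r0 : (expR (- (nu / 2 * normc (of_coords p) ^+ 2)))%:C != 0 :> C.
    by rewrite fmorph_eq0 gt_eqF// expR_gt0.
  apply: (mulIf r0); apply/eqP; rewrite -subr_eq0; apply/eqP.
  by apply: eq0_normc; apply/eqP; rewrite -sqrf_eq0; apply/eqP.
rewrite -[RHS]sqn_diff; apply: eq_integral => p _.
by rewrite gee0_abs// lee_fin sqr_ge0.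
Qed.

(** The function [g] is the pointwise sum of the expansion of [f]. It is entire, it
    agrees with [f] almost everywhere on the strip, and quasi-periodicity carries the
    equality to the whole plane. *)
Lemma exists_Fspace_ae_eq : exists2 h, F h & ae_eq_C f h.
Proof.
exists g => //; have [_ qf _] := Lf.
apply: (@filterS2 _ _ ae_lam2_filter) qf (ae_strip_translate ae_strip) => p hp [m hm].
have E : of_coords (p.1 + m%:~R, p.2) = of_coords p + m%:~R.
  by rewrite intrC; apply/eqP; rewrite eq_complex /= addr0 !eqxx.
move: hm; rewrite E hp /g ground_sum_quasiperiodic; apply: mulfI.
by rewrite mulf_neq0 ?cexp_neq0.
Qed.

End OrthogonalToHigherModes.

(** The space [F] is orthogonal to the functions [psi m n] with [m > 0], and
    orthogonality passes to limits. *)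
Lemma adherent_perp f : L2space nu alpha f ->
  (forall eps : R, 0 < eps -> exists2 g, F g & (lnorm nu (fun z => (f z - g z)%R) < eps%:E)%E) ->
  forall m n, (0 < m)%N -> ip lam2 S (w f) (e (m, n)) = 0.
Proof.
move=> Lf H m n m0; have mS : measurable S by exact: measurable_strip.
apply: (ip_limit_eq0 mS (L2_weighted Lf) (L2_weighted_basis alpha nu0 (m, n))).
move=> eps eps0; have [|g Fg hg] := H (Num.sqrt eps); first by rewrite sqrtr_gt0.
have Lg := Fspace_sub_L2space Fg; exists (w g); split.
- exact: L2_weighted Lg.
- exact: ip_Fspace_basis.
- move: hg; rewrite lnorm_lt ?sqrtr_gt0 ?weightedB ?sqr_sqrtr ?(ltW eps0)//.
  exact: (L2B mS (L2_weighted Lf) (L2_weighted Lg)).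
Qed.

Lemma Fspace_closed : closed_subspace nu (L2space nu alpha) F.
Proof.
split.
- exact: Fspace_sub_L2space.
- exact: Fspace0.
- by move=> c f g; exact: Fspace_lin.
- by move=> f Lf H; apply: (exists_Fspace_ae_eq Lf); exact: adherent_perp.
Qed.

End Closedness.

(** * The orthogonal expansion *)

Section Expansion.
Context {R : realType} (nu alpha : R) (nu0 : 0 < nu).
Local Notation C := R[i].
Local Notation T := (measurableTypeR R).
Local Notation lam2 := (@lebesgue_measure R \x @lebesgue_measure R)%E.
Local Notation S := (@strip R : set (T * T)).
Local Notation L := (L2space nu alpha).
Local Notation F := (Fspace nu alpha).
Local Notation w := (weighted nu).
Local Notation e := (weighted_basis nu alpha).
Local Notation partial := (psi_partial_sum nu alpha).
Implicit Types (a : nat -> int -> C) (J : {fset (nat * int)}).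

Let mS : measurable S. Proof. exact: measurable_strip. Qed.

Lemma psi_partial_sum_L2space a J : L (partial a J).
Proof.
rewrite /psi_partial_sum; elim: (enum_fset J) => [|i s ih].
  have -> : (fun z => \sum_(p <- [::] | (0 < p.1)%N) a p.1 p.2 * psi nu alpha p.1 p.2 z) =
    (fun=> 0) by apply/funext => z; rewrite big_nil.
  exact: L2space0.
have [i0|i0] := boolP (0 < i.1)%N; last first.
  by under eq_fun do rewrite big_cons (negbTE i0).
have := L2space_lin (a i.1 i.2) (psi_L2space alpha nu0 i.1 i.2) ih.
by under [X in L X -> _]eq_fun do rewrite /=; under [X in _ -> L X]eq_fun do rewrite big_cons i0.
Qed.

Lemma weighted_partial a J p :
  w (partial a J) p = \sum_(i <- J | (0 < i.1)%N) a i.1 i.2 * e i p.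
Proof.
rewrite /weighted /psi_partial_sum mulr_suml; apply: eq_bigr => -[m n] _ /=.
by rewrite -mulrA -weighted_psi.
Qed.

Lemma cvg_lnormP f a : L f ->
  ((fun J => lnorm nu (fun z => f z - partial a J z)) @ totally --> 0%E) <->
  (forall eps : R, 0 < eps -> exists J0 : {fset (nat * int)}, forall J, (J0 `<=` J)%fset ->
     nq lam2 S (fun p => w f p - w (partial a J) p) < eps).
Proof.
move=> Lf.
have LB J : L2 lam2 S (fun p => w f p - w (partial a J) p).
  exact: (L2B mS (L2_weighted Lf) (L2_weighted (psi_partial_sum_L2space a J))).
have E : (fun J => lnorm nu (fun z => f z - partial a J z)) =
    (fun J => (Num.sqrt (nq lam2 S (fun p => w f p - w (partial a J) p)))%:E).
  by apply/funext => J; rewrite lnormE weightedB.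
have FT : Filter (@totally (nat * int)%type) by apply: totally_filter.
rewrite E; split.
- move=> /fine_cvg /cvgrPdist_lt H eps eps0.
  have s0 : 0 < Num.sqrt eps by rewrite sqrtr_gt0.
  have [J0 _ HJ] := H _ s0; exists J0 => J /HJ /=.
  by rewrite sub0r normrN ger0_norm ?sqrtr_ge0// ltr_sqrt.
- move=> H; apply: cvg_EFin; first exact: nearW.
  apply/cvgrPdist_lt => eps eps0; have [J0 HJ] := H _ (exprn_gt0 2 eps0).
  exists J0 => // J /= /HJ h; rewrite sub0r normrN ger0_norm ?sqrtr_ge0//.
  by rewrite -[ltRHS](gtr0_norm eps0) -sqrtr_sqr ltr_sqrt// exprn_gt0.
Qed.

(** The coefficients are the inner products with the functions [psi m n]. Those with
    [m = 0] vanish because [psi 0 n] belongs to [F]; Parseval gives the summability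
    and the convergence. *)
Lemma orthocomplement_expansion f : orthocomplement nu L F f ->
  exists2 a, square_summable a & is_psi_series nu alpha a f.
Proof.
move=> [Lf fF]; pose a m n : C := ip lam2 S (w f) (e (m, n)).
have Lu := L2_weighted Lf; have mu_ := cmeas_L2space Lf.
have a0 n : a 0%N n = 0.
  rewrite -(fF _ (psi0_Fspace alpha nu0 n)) innerE; congr ip.
  by apply/funext => p; rewrite weighted_psi.
have P := weighted_basis_parseval alpha nu0 mu_ Lu.
exists a.
- apply: (@le_lt_trans _ _ (sqn lam2 S (w f))); last by case: Lu.
  have -> : (\esum_(p in [set p : nat * int | (0 < p.1)%N]) (normc (a p.1 p.2) ^+ 2)%:E)%E =
      (\esum_(p in [set p : nat * int | (0 < p.1)%N]) (normc (ip lam2 S (w f) (e p)) ^+ 2)%:E)%E.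
    by apply: eq_esum => -[m n] _.
  rewrite -P [leRHS](esumID [set p : nat * int | (0 < p.1)%N]); last first.
    by move=> i _; rewrite lee_fin sqr_ge0.
  by rewrite setTI leeDl//; apply: esum_ge0 => i _; rewrite lee_fin sqr_ge0.
- split=> //; first by move=> J; exact: psi_partial_sum_L2space.
  apply/(cvg_lnormP a Lf) => eps eps0.
  have [J0 HJ] := parseval_fset mS (L2_weighted_basis alpha nu0) (weighted_basis_orthonormal alpha nu0) Lu P eps0.
  exists J0 => J /HJ; congr (nq _ _ _ < _); apply/funext => p; congr (_ - _).
  rewrite weighted_partial [RHS]big_mkcond; apply: eq_bigr => -[[|m] n] _ //=.
  by rewrite -/(a 0%N n) a0 mul0r.
Qed.

(** The partial sums are orthogonal to [F] by [ip_Fspace_basis], hence so is their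
    limit. *)
Lemma expansion_orthocomplement f a : is_psi_series nu alpha a f -> orthocomplement nu L F f.
Proof.
move=> [Lf _ /(cvg_lnormP a Lf) H]; split=> // g Fg.
have Lg := L2_weighted (Fspace_sub_L2space Fg).
rewrite innerE; apply: (ip_limit_eq0 mS (L2_weighted Lf) Lg) => eps /H[J0 HJ].
exists (w (partial a J0)); split; last exact: HJ.
- exact: L2_weighted (psi_partial_sum_L2space a J0).
- have -> : w (partial a J0) =
      (fun p => \sum_(i <- [seq i <- J0 | (0 < i.1)%N]) a i.1 i.2 * e i p).
    by apply/funext => p; rewrite weighted_partial big_filter.
  rewrite (ip_suml mS _ (fun i => L2Z mS (a i.1 i.2) (L2_weighted_basis alpha nu0 i)) Lg).
  rewrite big_filter big1// => -[m n] /= m0.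
  rewrite (ipZl mS _ (L2_weighted_basis alpha nu0 _) Lg) (ipC mS Lg (L2_weighted_basis alpha nu0 _)).
  by rewrite ip_Fspace_basis// conjc0 mulr0.
Qed.

End Expansion.

Theorem corollary4p2 (R : realType) (nu alpha : R) (hnu : 0 < nu) :
  closed_subspace nu (L2space nu alpha) (Fspace nu alpha) /\
  forall f : R[i] -> R[i],
    orthocomplement nu (L2space nu alpha) (Fspace nu alpha) f <->
    exists2 a : nat -> int -> R[i],
      square_summable a & is_psi_series nu alpha a f.
Proof.
split; first exact: Fspace_closed.
move=> f; split; first exact: orthocomplement_expansion.
by move=> [a _ /(expansion_orthocomplement hnu)].
Qed.
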